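(* Set $(\mathcal E^0,\mathcal F^0):=(\mathscr E^{\mathrm I},\mathscr F^{\mathrm I})$ and $(\mathcal E^\infty,\mathcal F^\infty):=(\mathscr E^{\mathrm{V}},\mathscr F^{\mathrm{V}})$, and for $a\in(0,\infty)$ let $(\mathcal E^a,\mathcal F^a):=(\mathscr E^{\mathrm{IV}},\mathscr F^{\mathrm{IV}})$ with parameter $\lambda:=a$. Let $\{a^l:l\ge1\}\subset(0,\infty)$ be a sequence with $\lim_{l\to\infty}a^l=a\in[0,\infty]$. Then $(\mathcal E^{a^l},\mathcal F^{a^l})$ converges to $(\mathcal E^a,\mathcal F^a)$ in the sense of Mosco on $H$ as $l\to\infty$.
   Context: $\mathbb R^2_\pm:=\{\pm x_2>0\}$, $\mathbb R^2_0:=\mathbb R^2_+\cup\mathbb R^2_-$, $H:=L^2(\mathbb R^2)=L^2(\mathbb R^2_0)$ (Lebesgue measure), $u_\pm:=u|_{\mathbb R^2_\pm}$. For $u\in H^1(\mathbb R^2)$, $u|_{\mathbb R}$ is its trace on the $x_1$-axis. Forms on $H$: $\mathscr F^{\mathrm I}=H^1(\mathbb R^2)$, $\mathscr E^{\mathrm I}(u,u)=\frac12\int_{\mathbb R^2}|\nabla u|^2dx$; $\mathscr F^{\mathrm{IV}}=\{u\in H^1(\mathbb R^2):u|_{\mathbb R}\in H^1(\mathbb R)\}$, $\mathscr E^{\mathrm{IV}}(u,u)=\frac12\int_{\mathbb R^2}|\nabla u|^2dx+\lambda\int_{\mathbb R}\left(\frac{d(u|_{\mathbb R})}{dx_1}\right)^2dx_1$;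 $\mathscr F^{\mathrm V}=\{u\in L^2(\mathbb R^2_0):u_\pm\in H^1_0(\mathbb R^2_\pm)\}$, $\mathscr E^{\mathrm V}(u,u)=\frac12\int_{\mathbb R^2_0}|\nabla u|^2dx$. Mosco convergence: extend forms by $+\infty$ outside their domains. $(\mathcal E^{l},\mathcal F^{l})\to(\mathcal E,\mathcal F)$ in the sense of Mosco if (a) $u_l\to u$ weakly in $H$ implies $\mathcal E(u,u)\le\liminf_l\mathcal E^l(u_l,u_l)$; (b) for every $u\in H$ there are $u_l\to u$ strongly in $H$ with $\mathcal E(u,u)\ge\limsup_l\mathcal E^l(u_l,u_l)$. *)

(* Defs.v *)
From HB Require Import structures.
From mathcomp Require Import all_boot all_order all_algebra.
From mathcomp Require Import all_classical all_reals all_analysis.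
Set Implicit Arguments.
Unset Strict Implicit.
Unset Printing Implicit Defensive.
Import Order.TTheory GRing.Theory Num.Theory.
Import numFieldNormedType.Exports.

Local Open Scope classical_set_scope.
Local Open Scope ring_scope.

(* Existence and continuity of the directional derivatives of every order is
   the C^oo condition because V is finite-dimensional in all uses below. *)
Definition smooth (R : realType) (V : normedModType R) (f : V -> R^o) : Prop :=
  forall vs : seq V,
    let g := foldr (fun v h => 'D_v h) f vs in
    continuous g /\ forall x v, derivable g x v.

(* C_c^oo(W), its elements being extended by 0 outside W. *)
Definition test_function (R : realType) (V : normedModType R) (W : set V) :
    set (V -> R^o) :=
  [set f | [/\ smooth f, compact (closure [set x | f x != 0]) &
               closure [set x | f x != 0] `<=` W]].

Section Sobolev.
Context {R : realType}.

Definition leb : {measure set (measurableTypeR R) -> \bar R} :=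
  @lebesgue_measure R.
Definition leb2 :
    {measure set (measurableTypeR R * measurableTypeR R) -> \bar R} :=
  (@lebesgue_measure R \x @lebesgue_measure R)%E.

(* L^2(W), W a measurable subset of the plane. All the notions relative to W
   below only depend on the restriction of the function to W, and on that
   only up to a.e. equality. *)
Definition L2on (W : set (R * R)) (u : R * R -> R) : Prop :=
  u \_ W \in Lfun leb2 2%:E.

Definition weak_partial_of (W : set (R * R)) (v : R * R) (u g : R * R -> R) :
    Prop :=
  L2on W g /\ forall phi, test_function W phi ->
    (\int[leb2]_(x in W) (u x * 'D_v phi x) =
     - \int[leb2]_(x in W) (g x * phi x))%R.

(* The weak derivative (a.e. unique) when it exists in L^2(W), 0 otherwise. *)
Definition weak_partial W v u : R * R -> R :=
  xget (fun=> 0) [set g | weak_partial_of W v u g].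

Definition e1 : R * R := (1, 0).
Definition e2 : R * R := (0, 1).

Definition H1 (W : set (R * R)) : set (R * R -> R) :=
  [set u | [/\ L2on W u, exists g, weak_partial_of W e1 u g &
               exists g, weak_partial_of W e2 u g]].

Definition dirichlet (W : set (R * R)) (u : R * R -> R) : \bar R :=
  (\int[leb2]_(x in W)
     ((weak_partial W e1 u x) ^+ 2 + (weak_partial W e2 u x) ^+ 2)%:E)%E.

Definition H1norm2 (W : set (R * R)) (u : R * R -> R) : \bar R :=
  (\int[leb2]_(x in W) ((u x) ^+ 2)%:E + dirichlet W u)%E.

(* H^1_0(W): the closure of C_c^oo(W) in H^1(W). *)
Definition H10 (W : set (R * R)) : set (R * R -> R) :=
  [set u | H1 W u /\ exists phi : nat -> R * R -> R,
     (forall n, test_function W (phi n)) /\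
     H1norm2 W (phi n \- u) @[n --> \oo] --> 0%E].

Definition weak_deriv_of (f g : R -> R) : Prop :=
  g \in Lfun leb 2%:E /\ forall phi, test_function setT phi ->
    (\int[leb]_x (f x * 'D_1 phi x) = - \int[leb]_x (g x * phi x))%R.

Definition weak_deriv (f : R -> R) : R -> R :=
  xget (fun=> 0) [set g | weak_deriv_of f g].

Definition H1line : set (R -> R) :=
  [set f | f \in Lfun leb 2%:E /\ exists g, weak_deriv_of f g].

(* The trace on the x_1-axis: the continuous extension to H^1(R^2), with values
   in L^2(R), of phi |-> phi(., 0) on C_c^oo(R^2). *)
Definition trace_of (u : R * R -> R) (f : R -> R) : Prop :=
  f \in Lfun leb 2%:E /\ exists phi : nat -> R * R -> R,
    [/\ forall n, test_function setT (phi n),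
        H1norm2 setT (phi n \- u) @[n --> \oo] --> 0%E &
        (\int[leb]_x ((phi n (x, 0) - f x) ^+ 2)%:E)%E @[n --> \oo] --> 0%E].

Definition trace (u : R * R -> R) : R -> R :=
  xget (fun=> 0) [set f | trace_of u f].

Definition upper : set (R * R) := [set x | 0 < x.2].
Definition lower : set (R * R) := [set x | x.2 < 0].
Definition slit_plane : set (R * R) := upper `|` lower.

(* H = L^2(R^2): classes of a.e. equal functions; an element of H coerces to a
   representative. *)
Definition H := LspaceType2 leb2.

(* A closed quadratic form on H with its domain; [energy] is only meaningful
   on [domain]. *)
Record form := Form { domain : set H ; energy : H -> \bar R }.

Definition extended (E : form) (u : H) : \bar R :=
  if `[< domain E u >] then energy E u else +oo%E.

Definition formI : form := {|
  domain := [set u : H | H1 setT u] ;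
  energy := fun u => (2^-1%:E * dirichlet setT u)%E |}.

Definition formIV (lambda : R) : form := {|
  domain := [set u : H | H1 setT u /\ H1line (trace u)] ;
  energy := fun u => (2^-1%:E * dirichlet setT u +
    lambda%:E * \int[leb]_x ((weak_deriv (trace u) x) ^+ 2)%:E)%E |}.

Definition formV : form := {|
  domain := [set u : H | H10 upper u /\ H10 lower u] ;
  energy := fun u => (2^-1%:E * dirichlet slit_plane u)%E |}.

(* Only used for a in [0, +oo]; the value at -oo is irrelevant. *)
Definition form_at (a : \bar R) : form :=
  match a with
  | r%:E => if r == 0 then formI else formIV r
  | _ => formV
  end.

Definition weak_cvg (u_ : nat -> H) (u : H) : Prop :=
  forall v : H, (\int[leb2]_x (u_ l x * v x))%R @[l --> \oo] -->
                (\int[leb2]_x (u x * v x))%R.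

Definition strong_cvg (u_ : nat -> H) (u : H) : Prop :=
  'N[leb2]_2%:E[EFin \o ((u_ l : R * R -> R) \- u)%R]%E @[l --> \oo] --> 0%E.

Definition mosco_cvg (E_ : nat -> form) (E : form) : Prop :=
  (forall (u_ : nat -> H) (u : H), weak_cvg u_ u ->
     (extended E u <= limn_einf (fun l => extended (E_ l) (u_ l)))%E) /\
  (forall u : H, exists2 u_ : nat -> H, strong_cvg u_ u &
     (limn_esup (fun l => extended (E_ l) (u_ l)) <= extended E u)%E).

End Sobolev.

(* Main.v *)
(* For the lower bound, take a subsequence of bounded energies: the gradients of the
   u_l have weak L^2 limits, which are the gradient of u, and by Green's formula on the
   upper side of the axis the traces of the u_l converge weakly to that of u against
   test functions. When a is finite and positive the derivatives of the traces are
   bounded in L^2, and weak lower semicontinuity concludes. When a is infinite these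
   derivatives tend to 0, so the trace of u is constant, hence zero as it lies in
   L^2(R), and u belongs to H^1_0 of both sides. When a = 0 the line term is dropped.
   For the recovery sequence, the constant one works for a > 0, as the line term of an
   element of the domain converges (it vanishes for a infinite); for a = 0 the density
   of C_c^oo in H^1 provides slowly growing approximations with smooth traces. *)

From HB Require Import structures.
Require Import Defs.
From mathcomp Require Import all_boot all_order all_algebra.
From mathcomp Require Import all_classical all_reals all_analysis.
From mathcomp Require Import measurable_realfun generic_quotient ring lra.
Import Order.TTheory GRing.Theory Num.Theory.
Import numFieldNormedType.Exports.
Local Open Scope classical_set_scope.
Local Open Scope ring_scope.

Set Implicit Arguments.
Unset Strict Implicit.
Unset Printing Implicit Defensive.

(** The weak limits come from a representation argument. Along indices of bounded energy the
    pairings of the gradients with test functions converge by themselves, being pairings of the u_l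
    with derivatives of test functions. The limit functional is bounded, and minimising a quadratic
    functional over the dense subspace of test functions turns it into a scalar product. Read as an
    orthogonal projection, the same result gives the density of test functions in L^2 from a
    pi-system of boxes. Lower semicontinuity rests on the tangent inequality |f|^2 >= 2 <f, g> -
    |g|^2, whose right side is weakly continuous in f and tolerates the varying coefficient a^l. The
    obstacle is that weak derivatives and traces are chosen among functions defined up to a.e.
    equality. They are handled through the predicates defining them, together with a.e. uniqueness,
    and gradients are carried explicitly. A single mollifier, supported strictly on one side of the
    origin, serves both the density in H^1 of the plane and the approximation inside a half-plane
    that H^1_0 demands. *)

(** * Scalar product, strong and weak convergence in L^2 *)

Section L2.
Context d (T : measurableType d) (R : realType).
Context (mu : {measure set T -> \bar R}).
Local Notation L2 := (Lfun mu 2%:E).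
Implicit Types f g h : T -> R.

Lemma ae_mono (P Q : T -> Prop) : (forall x, P x -> Q x) ->
  {ae mu, forall x, P x} -> {ae mu, forall x, Q x}.
Proof. by move=> PQ; exact: filterS. Qed.

Lemma ae_mono2 (P Q S : T -> Prop) : (forall x, P x -> Q x -> S x) ->
  {ae mu, forall x, P x} -> {ae mu, forall x, Q x} -> {ae mu, forall x, S x}.
Proof. by move=> PQ; exact: filterS2. Qed.

Lemma integrableBR f g : mu.-integrable setT (EFin \o f) ->
  mu.-integrable setT (EFin \o g) ->
  mu.-integrable setT (EFin \o (fun x => f x - g x)).
Proof.
move=> hf hg; have := integrableB measurableT hf hg.
by apply: eq_integrable => // x _; rewrite /= EFinB.
Qed.

Lemma integrableZR (k : R) f : mu.-integrable setT (EFin \o f) ->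
  mu.-integrable setT (EFin \o (fun x => k * f x)).
Proof.
move=> hf; have := integrableZl measurableT k hf.
by apply: eq_integrable => // x _; rewrite /= EFinM.
Qed.

Lemma L2P f : f \in L2 <->
  measurable_fun setT f /\ (\int[mu]_x (f x ^+ 2)%:E < +oo)%E.
Proof.
split=> [hf|[mf hf]].
  split; first by move: hf; rewrite inE => /andP[]; rewrite inE.
  exact: (integrable_lty measurableT (Lfun2_integrable_sqr hf)).
rewrite inE; apply/andP; split; rewrite inE//= /finite_norm unlock.
apply: poweR_lty; apply: le_lt_trans hf.
rewrite le_eqVlt; apply/orP; left; apply/eqP; apply: eq_integral => x _.
by rewrite abse_EFin poweR_EFin powR_mulrn// real_normK// num_real.
Qed.

Lemma L2_measurable f : f \in L2 -> measurable_fun setT f.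
Proof. by case/L2P. Qed.

(** Taken on functions rather than on classes, so that representatives, derivatives and test
    functions mix freely. The real integral has a default value when it diverges, which is why
    bilinearity asks for membership in [L2]. *)
Definition ip f g : R := \int[mu]_x (f x * g x).

Lemma ip_integrable f g : f \in L2 -> g \in L2 ->
  mu.-integrable setT (EFin \o (fun x => f x * g x)).
Proof. by move=> hf hg; apply/Lfun1_integrable/Lfun2_mul_Lfun1. Qed.

Lemma ipC f g : ip f g = ip g f.
Proof. by apply: eq_Rintegral => x _; rewrite mulrC. Qed.

Lemma ip_ge0 f : 0 <= ip f f.
Proof. by apply: Rintegral_ge0 => x _; rewrite -expr2 sqr_ge0. Qed.

Lemma ipDl f g h : f \in L2 -> g \in L2 -> h \in L2 ->
  ip (f \+ g) h = ip f h + ip g h.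
Proof.
move=> hf hg hh; rewrite /ip -RintegralD//; try exact: ip_integrable.
by apply: eq_Rintegral => x _; rewrite /= mulrDl.
Qed.

Lemma ipZl a f g : f \in L2 -> g \in L2 -> ip (a \*o f) g = a * ip f g.
Proof.
move=> hf hg; rewrite /ip -RintegralZl//; last exact: ip_integrable.
by apply: eq_Rintegral => x _; rewrite /= mulrA.
Qed.

Lemma L2D f g : f \in L2 -> g \in L2 -> f \+ g \in L2.
Proof. by move=> hf hg; apply: (Lfun_addr_closed _ _).2 => //; exact: (lee1n 2). Qed.

Lemma L2Z a f : f \in L2 -> a \*o f \in L2.
Proof.
move=> hf; have -> : a \*o f = a \o* f by apply/funext => x; rewrite /= mulrC.
by apply: Lfun_scale => //; rewrite ler1n.
Qed.

Lemma L2B f g : f \in L2 -> g \in L2 -> f \- g \in L2.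
Proof.
move=> hf hg; have -> : f \- g = f \+ (-1 \*o g).
  by apply/funext => x /=; rewrite mulN1r.
by apply: L2D => //; exact: L2Z.
Qed.

Lemma L20 : (cst 0 : T -> R) \in L2.
Proof. by apply: (Lfun_addr_closed _ _).1; exact: (lee1n 2). Qed.

Lemma ipBl f g h : f \in L2 -> g \in L2 -> h \in L2 ->
  ip (f \- g) h = ip f h - ip g h.
Proof.
move=> hf hg hh; have -> : f \- g = f \+ (-1 \*o g).
  by apply/funext => x /=; rewrite mulN1r.
by rewrite ipDl ?ipZl ?mulN1r//; exact: L2Z.
Qed.

Lemma ipDr f g h : f \in L2 -> g \in L2 -> h \in L2 ->
  ip h (f \+ g) = ip h f + ip h g.
Proof. by move=> *; rewrite ipC ipDl// (ipC h) (ipC h). Qed.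

Lemma ipBr f g h : f \in L2 -> g \in L2 -> h \in L2 ->
  ip h (f \- g) = ip h f - ip h g.
Proof. by move=> *; rewrite ipC ipBl// (ipC h) (ipC h). Qed.

Lemma ipZr a f g : f \in L2 -> g \in L2 -> ip g (a \*o f) = a * ip g f.
Proof. by move=> *; rewrite ipC ipZl// (ipC g). Qed.

Lemma ip_sqrD f g : f \in L2 -> g \in L2 ->
  ip (f \+ g) (f \+ g) = ip f f + 2 * ip f g + ip g g.
Proof.
by move=> hf hg; rewrite ipDl ?ipDr ?(ipC g f)//; [ring|exact: L2D].
Qed.

Lemma ip_sqrB f g : f \in L2 -> g \in L2 ->
  ip (f \- g) (f \- g) = ip f f - 2 * ip f g + ip g g.
Proof.
by move=> hf hg; rewrite ipBl ?ipBr ?(ipC g f)//; [ring|exact: L2B].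
Qed.

Lemma ip_sqrBC f g : ip (f \- g) (f \- g) = ip (g \- f) (g \- f).
Proof. by apply: eq_Rintegral => x _ /=; ring. Qed.

Lemma ip_sqrE f : f \in L2 -> (ip f f)%:E = (\int[mu]_x (f x ^+ 2)%:E)%E.
Proof.
move=> /L2P[mf hf]; rewrite /ip /Rintegral fineK.
  by apply: eq_integral => x _; rewrite expr2.
under eq_integral do rewrite -expr2.
rewrite ge0_fin_numE// integral_ge0// => x _; rewrite lee_fin sqr_ge0//.
Qed.

Lemma CauchySchwarz f g : f \in L2 -> g \in L2 ->
  (ip f g) ^+ 2 <= ip f f * ip g g.
Proof.
move=> hf hg; set a := ip f f; set b := ip f g; set c := ip g g.
have key t : 0 <= a - 2 * t * b + t ^+ 2 * c.
  have := ip_ge0 (f \- (t \*o g)).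
  have htg : t \*o g \in L2 by exact: L2Z.
  by rewrite ip_sqrB// ipZr// ipZr// ipZl// -/a -/b -/c mulrA expr2 !mulrA.
have a0 : 0 <= a := ip_ge0 f.
have c0 : 0 <= c := ip_ge0 g.
have [c_eq0|cn0] := eqVneq c 0.
  have [b0|bn0] := eqVneq b 0; first by rewrite b0 expr2 mul0r mulr_ge0.
  (* With c = 0 the expression is affine in t, and this t gives it the value -1. *)
  have := key ((a + 1) / (2 * b)).
  rewrite c_eq0 mulr0 addr0.
  have -> : 2 * ((a + 1) / (2 * b)) * b = a + 1.
    by field; rewrite bn0.
  lra.
have cp : 0 < c by rewrite lt_neqAle eq_sym cn0.
have := key (b / c).
have -> : a - 2 * (b / c) * b + (b / c) ^+ 2 * c = (a * c - b ^+ 2) / c.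
  by field.
by rewrite pmulr_lge0 ?invr_gt0// subr_ge0.
Qed.

Lemma ip_sqrD_le f g : f \in L2 -> g \in L2 ->
  ip (f \+ g) (f \+ g) <= 2 * ip f f + 2 * ip g g.
Proof.
move=> hf hg; rewrite ip_sqrD//; have := ip_ge0 (f \- g).
rewrite ip_sqrB//; lra.
Qed.

(** The triangle inequality for squared norms; the factor 2 spares the square roots, at the price of
    constants such as e / 4 or e / 16 further on. *)
Lemma ip_sqrB_le f g h : f \in L2 -> g \in L2 -> h \in L2 ->
  ip (f \- h) (f \- h) <=
  2 * ip (f \- g) (f \- g) + 2 * ip (g \- h) (g \- h).
Proof.
move=> hf hg hh; have -> : f \- h = (f \- g) \+ (g \- h).
  by apply/funext => x /=; ring.
by apply: ip_sqrD_le; exact: L2B.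
Qed.

Lemma L2_le f g : measurable_fun setT f -> g \in L2 ->
  (forall x, `|f x| <= `|g x|) -> f \in L2.
Proof.
move=> mf hg fg; apply/L2P; split=> //; have /L2P[mg] := hg.
apply: le_lt_trans; apply: ge0_le_integral => //.
- by move=> x _; rewrite lee_fin sqr_ge0.
- by apply/measurable_EFinP; exact: measurable_funX.
- by apply/measurable_EFinP; exact: measurable_funX.
- move=> x _; rewrite lee_fin -(real_normK (num_real (f x))).
  by rewrite -(real_normK (num_real (g x))) lerXn2r// nnegrE.
Qed.

Lemma L2M_bounded f (b : T -> R) (M : R) : f \in L2 -> measurable_fun setT b ->
  (forall x, `|b x| <= M) -> f \* b \in L2.
Proof.
move=> hf mb bM; have hM : M \*o f \in L2 by exact: L2Z.
apply: (L2_le _ hM); first by apply: measurable_funM => //; exact: L2_measurable.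
move=> x /=; rewrite !normrM mulrC ler_wpM2r//.
by rewrite (le_trans (bM x))// ler_norm.
Qed.

Lemma ip_le f g : f \in L2 -> g \in L2 -> (forall x, `|f x| <= `|g x|) ->
  ip f f <= ip g g.
Proof.
move=> hf hg fg; apply: le_Rintegral => //; try exact: ip_integrable.
move=> x _; rewrite -!expr2 -(real_normK (num_real (f x))).
by rewrite -(real_normK (num_real (g x))) lerXn2r// nnegrE.
Qed.

Lemma eq_ip f f' g g' : f \in L2 -> f' \in L2 -> g \in L2 -> g' \in L2 ->
  ae_eq mu setT f f' -> ae_eq mu setT g g' -> ip f g = ip f' g'.
Proof.
move=> hf hf' hg hg' ff' gg'; congr fine.
apply: ae_eq_integral => //.
- by apply/measurable_EFinP; apply: measurable_funM; exact: L2_measurable.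
- by apply/measurable_EFinP; apply: measurable_funM; exact: L2_measurable.
- by move: ff' gg'; apply: filterS2 => x ff' gg' _; rewrite ff'// gg'.
Qed.

Lemma ip0l g : ip (cst 0) g = 0.
Proof.
rewrite /ip (_ : (fun x => _) = cst 0) ?Rintegral_cst ?mul0r//.
by apply/funext => x; rewrite mul0r.
Qed.

Lemma ip_eq0 f : f \in L2 -> ip f f = 0 -> ae_eq mu setT f (cst 0).
Proof.
move=> hf f0; have mf2 : measurable_fun setT (fun x => (f x ^+ 2)%:E).
  by apply/measurable_EFinP; apply: measurable_funX; exact: L2_measurable.
have /(ae_eq_integral_abs mu measurableT mf2) :
    (\int[mu]_x `|(f x ^+ 2)%:E| = 0)%E.
  under eq_integral do rewrite gee0_abs ?lee_fin ?sqr_ge0//.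
  by rewrite -ip_sqrE// f0.
apply: filterS => x /(_ Logic.I) [] /eqP; rewrite sqrf_eq0 => /eqP fx _.
by [].
Qed.

Definition cvgL2 (u_ : nat -> T -> R) u :=
  (fun n => ip (u_ n \- u) (u_ n \- u)) @ \oo --> (0 : R).

Definition cvgL2w (u_ : nat -> T -> R) u :=
  forall v, v \in L2 -> (fun n => ip (u_ n) v) @ \oo --> ip u v.

Lemma eq_cvg_to (U : topologicalType) (f g : nat -> U) (l l' : U) :
  f @ \oo --> l -> (forall n, f n = g n) -> l = l' -> g @ \oo --> l'.
Proof. by move=> fl /funext <- <-. Qed.

Lemma sqr_cvg0 (x_ : nat -> R) :
  (fun n => x_ n ^+ 2) @ \oo --> (0 : R) -> x_ @ \oo --> (0 : R).
Proof.
move=> /cvgrPdist_lt h; apply/cvgrPdist_lt => e e0.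
have e20 : 0 < e ^+ 2 by rewrite exprn_gt0.
apply: filterS (h _ e20) => n; rewrite !sub0r !normrN ger0_norm ?sqr_ge0//.
by rewrite -real_normK ?num_real// ltr_pXn2r// ?nnegrE// ltW.
Qed.

(** Expanding around the limits leaves three terms with at least one factor tending to 0, each
    controlled by Cauchy-Schwarz in its squared form. *)
Lemma cvgL2_ip u_ u v_ v : (forall n, u_ n \in L2) -> u \in L2 ->
  (forall n, v_ n \in L2) -> v \in L2 -> cvgL2 u_ u -> cvgL2 v_ v ->
  (fun n => ip (u_ n) (v_ n)) @ \oo --> ip u v.
Proof.
move=> hu_ hu hv_ hv cu cv.
have E n : ip (u_ n) (v_ n) = ip (u_ n \- u) (v_ n \- v) + ip u (v_ n \- v)
    + ip (u_ n \- u) v + ip u v.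
  by rewrite !ipBl ?ipBr//; [ring|exact: L2B].
have cs0 p_ p q_ q : (forall n, p_ n \in L2) -> p \in L2 ->
    (forall n, q_ n \in L2) -> q \in L2 ->
    (fun n => ip (p_ n) (p_ n) * ip (q_ n) (q_ n)) @ \oo --> (0 : R) ->
    (fun n => ip (p_ n) (q_ n)) @ \oo --> (0 : R).
  move=> hp_ hp hq_ hq c0; apply: sqr_cvg0; apply: (squeeze_cvgr _ (cvg_cst 0) c0).
  by apply: nearW => n; rewrite /= sqr_ge0/= CauchySchwarz.
have hd_ n : u_ n \- u \in L2 by exact: L2B.
have he_ n : v_ n \- v \in L2 by exact: L2B.
have h1 : (fun n => ip (u_ n \- u) (v_ n \- v)) @ \oo --> (0 : R).
  by apply: (cs0 _ u _ v) => //; rewrite -[X in _ --> X](mulr0 0); exact: cvgM.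
have h2 : (fun n => ip u (v_ n \- v)) @ \oo --> (0 : R).
  apply: (cs0 (fun=> u) u _ v) => //.
  by rewrite -[X in _ --> X](mulr0 (ip u u)); apply: cvgMr.
have h3 : (fun n => ip (u_ n \- u) v) @ \oo --> (0 : R).
  apply: (cs0 _ u (fun=> v) v) => //.
  by rewrite -[X in _ --> X](mul0r (ip v v)); apply: cvgMl.
apply: (eq_cvg_to (cvgD (cvgD (cvgD h1 h2) h3) (cvg_cst (ip u v)))).
  by move=> n; rewrite E.
by rewrite !add0r.
Qed.

Lemma cvgL2_cst u : cvgL2 (fun=> u) u.
Proof.
rewrite /cvgL2 (_ : (fun _ => _) = cst 0); first exact: cvg_cst.
apply/funext => n; rewrite /ip (_ : (fun x => _) = cst 0) ?Rintegral_cst ?mul0r//.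
by apply/funext => x /=; rewrite subrr mul0r.
Qed.

Lemma cvgL2_weak u_ u : (forall n, u_ n \in L2) -> u \in L2 ->
  cvgL2 u_ u -> cvgL2w u_ u.
Proof. by move=> *; move=> v hv; apply: cvgL2_ip => //; exact: cvgL2_cst. Qed.

Lemma cvgL2D u_ u v_ v : (forall n, u_ n \in L2) -> u \in L2 ->
  (forall n, v_ n \in L2) -> v \in L2 -> cvgL2 u_ u -> cvgL2 v_ v ->
  cvgL2 (fun n => u_ n \+ v_ n) (u \+ v).
Proof.
move=> hu_ hu hv_ hv cu cv.
apply: (@squeeze_cvgr _ _ _ _ (cst 0) (fun n => 2 * ip (u_ n \- u) (u_ n \- u)
  + 2 * ip (v_ n \- v) (v_ n \- v))).
- apply: nearW => n; rewrite ip_ge0/=.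
  have -> : (u_ n \+ v_ n) \- (u \+ v) = (u_ n \- u) \+ (v_ n \- v).
    by apply/funext => x /=; ring.
  by apply: ip_sqrD_le; exact: L2B.
- exact: cvg_cst.
- rewrite -[X in _ --> X](addr0 0) -[X in X + _](mulr0 2) -[X in _ + X](mulr0 2).
  by apply: cvgD; apply: cvgMr.
Qed.

Lemma cvgL2_dominated u_ u h : (forall n, u_ n \in L2) -> u \in L2 ->
  h \in L2 -> (forall x, u_ ^~ x @ \oo --> u x) ->
  (forall n x, `|u_ n x| <= `|h x|) -> cvgL2 u_ u.
Proof.
move=> hu_ hu hh cu dom.
have dom_lim x : `|u x| <= `|h x|.
  apply: (ler_cvg_to (cvg_norm (cu x)) (cvg_cst `|h x|)).
  by apply: nearW => n; exact: dom.
apply: (@fine_cvg _ _ _ _ (fun n => \int[mu]_x ((u_ n \- u) x * (u_ n \- u) x)%:E)%E 0).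
rewrite (_ : 0%:E = (\int[mu]_x (cst 0%:E) x)%E); last by rewrite integral0.
(* Both [u_ n] and [u] are bounded by |h|, so the square of their difference is at most 4 h^2. *)
apply: (@dominated_cvg _ _ _ mu _ _ _ _ (fun x => (4 * (h x * h x))%:E)) => //.
- move=> n; apply/measurable_EFinP; apply: measurable_funM; apply: L2_measurable; exact: L2B.
- move=> x _; apply: cvg_EFin; first exact: nearW.
  rewrite -[X in _ --> X](mulr0 0).
  have c0 : (fun n => u_ n x - u x) @ \oo --> 0.
    by rewrite -(subrr (u x)); apply: cvgB => //; exact: cvg_cst.
  by apply: cvgM.
- by apply: (@integrableZl _ _ _ mu setT measurableT 4 (fun x => (h x * h x)%:E)); exact: ip_integrable.
- move=> n x _ /=; rewrite lee_fin -!expr2 ger0_norm ?sqr_ge0//.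
  rewrite -(real_normK (num_real (_ - _))) -(real_normK (num_real (h x))).
  have -> : 4 * `|h x| ^+ 2 = (`|h x| + `|h x|) ^+ 2 by ring.
  rewrite lerXn2r ?nnegrE ?addr_ge0//.
  by rewrite (le_trans (ler_normB _ _))// lerD.
Qed.
End L2.

(** * Limits and lower limits in the extended reals *)

Lemma EFin_cvgn (R : realType) (x_ : nat -> R) (l : R) :
  x_ @ \oo --> l -> (fun n => (x_ n)%:E) @ \oo --> l%:E.
Proof. by move=> cx; apply: cvg_EFin; [exact: nearW|exact: cx]. Qed.

Section limn_einf.
Context (R : realType).
Implicit Types (u : (\bar R)^nat).

Lemma limn_einfE u : limn_einf u = ereal_sup (range (einfs u)).
Proof. by rewrite limn_einf_lim; apply/cvg_lim => //; exact: cvg_einfs_sup. Qed.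

Lemma limn_einf_le u (e : \bar R) :
  (forall N, exists2 n, (N <= n)%N & (u n <= e)%E) -> (limn_einf u <= e)%E.
Proof.
move=> ue; rewrite limn_einfE; apply: ge_ereal_sup => _ [N _ <-].
have [n Nn un] := ue N; apply: le_trans un.
by apply: ereal_inf_lbound; exists n.
Qed.

Lemma limn_einf_lt u (e : \bar R) : (limn_einf u < e)%E ->
  forall N, exists2 n, (N <= n)%N & (u n < e)%E.
Proof.
move=> ue N; have : (einfs u N < e)%E.
  apply: le_lt_trans ue; rewrite limn_einfE.
  by apply: ereal_sup_ubound; exists N.
by rewrite /einfs => /ereal_inf_lt[_ [n Nn <-] un]; exists n.
Qed.

End limn_einf.

(** * Completeness, Riesz representation and density in L^2 *)

Section Hilbert.
Context d (T : measurableType d) (R : realType).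
Context (mu : {measure set T -> \bar R}).
Local Notation L2 := (Lfun mu 2%:E).
Local Notation ip := (ip mu).
Implicit Types f g h : T -> R.

Lemma cvg_of_sqr_increments (x_ : nat -> R) (C : R) :
  (forall k, 4 ^+ k * (x_ k.+1 - x_ k) ^+ 2 <= C) -> cvgn x_.
Proof.
move=> xC; have C0 : 0 <= C.
  by apply: le_trans (xC 0%N); rewrite mulr_ge0// ?sqr_ge0// exprn_ge0.
(* [C + 1] stands for the square root of C, as C <= (C + 1)^2. *)
have inc k : `|x_ k.+1 - x_ k| <= (C + 1) * 2^-1 ^+ k.
  rewrite -(ler_pXn2r (n := 2))// ?nnegrE ?mulr_ge0 ?exprn_ge0 ?addr_ge0//.
  have p0 : 0 < (4 : R) ^+ k by rewrite exprn_gt0.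
  rewrite real_normK ?num_real// -(ler_pM2l p0) (le_trans (xC k))//.
  rewrite exprMn -exprM mulnC exprM mulrCA.
  have -> : (4 : R) ^+ k * (2^-1 ^+ 2) ^+ k = 1.
    by rewrite -exprMn [X in X ^+ k](_ : _ = 1) ?expr1n//; field.
  by rewrite mulr1 expr2; nra.
have : cvgn (series (telescope x_)).
  apply: normed_cvg; apply: (series_le_cvg (v_ := geometric (C + 1) 2^-1)).
  - by move=> n /=; rewrite normr_ge0.
  - by move=> n /=; rewrite mulr_ge0 ?addr_ge0// exprn_ge0// invr_ge0.
  - exact: inc.
  - apply: is_cvg_geometric_series.
    by rewrite ger0_norm ?invr_ge0// invf_lt1// ltr1n.
move=> /cvg_ex[l tl]; apply/cvg_ex; exists (x_ 0%N + l).
apply: (eq_cvg_to (cvgD (cvg_cst (x_ 0%N)) tl)) => // n.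
by rewrite [RHS]eq_sum_telescope.
Qed.

(** Riesz-Fischer: along a fast subsequence the squared increments, weighted by 4^k, have an
    integrable sum, so the subsequence converges almost everywhere; Fatou's lemma then gives the
    convergence of the whole sequence in norm. *)
Lemma L2_complete (u_ : nat -> T -> R) : (forall n, u_ n \in L2) ->
  (forall e, 0 < e -> exists N, forall m n, (N <= m)%N -> (N <= n)%N ->
     ip (u_ m \- u_ n) (u_ m \- u_ n) <= e) ->
  exists2 u, u \in L2 & cvgL2 mu u_ u.
Proof.
move=> hu_ cauchy.
have e8 k : 0 < (8 : R)^-1 ^+ k by rewrite exprn_gt0// invr_gt0.
have [N HN] := choice (fun k => cauchy _ (e8 k)).
(* The maximum makes the indices nondecreasing, so that [s j] passes every threshold [N k] with k <=
   j. *)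
pose s k := (\max_(i < k.+1) N i)%N.
have sN k j : (k <= j)%N -> (N k <= s j)%N.
  move=> kj; rewrite /s; have := @leq_bigmax _ (fun i : 'I_j.+1 => N i).
  by move=> /(_ (inord k)); rewrite inordK// ltnS.
pose v k := u_ (s k).
have hv k : v k \in L2 by exact: hu_.
have hdv k : v k.+1 \- v k \in L2 by exact: L2B.
have vinc k : ip (v k.+1 \- v k) (v k.+1 \- v k) <= 8^-1 ^+ k.
  by apply: HN; apply: sN.
(* The integral of [F k] is at most 4^k 8^-k = 2^-k, and a finite sum of the [F k] at x forces
   increments of order 2^-k there. *)
pose F k x := (4 ^+ k * (v k.+1 x - v k x) ^+ 2)%:E.
have mF k : measurable_fun setT (F k).
  apply/measurable_EFinP; apply: measurable_funM => //.
  by apply: measurable_funX; exact: (L2_measurable (hdv k)).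
have F0 k x : (0 <= F k x)%E.
  by rewrite lee_fin; apply: mulr_ge0; rewrite ?sqr_ge0// exprn_ge0.
pose Psi x := (\sum_(0 <= k <oo) F k x)%E.
have mPsi : measurable_fun setT Psi.
  by apply: ge0_emeasurable_sum => // k x _ _.
have Psi0 x : (0 <= Psi x)%E by apply: nneseries_ge0 => k _ _.
have iF k : (\int[mu]_x F k x <= (2^-1 ^+ k)%:E)%E.
  rewrite /F; under eq_integral do rewrite EFinM.
  rewrite ge0_integralZl_EFin ?exprn_ge0//; last 2 first.
  - by move=> x _; rewrite lee_fin sqr_ge0.
  - apply/measurable_EFinP; apply: measurable_funX.
    exact: (L2_measurable (hdv k)).
  rewrite -(ip_sqrE (hdv k)) -EFinM lee_fin.
  have p0 : 0 <= (4 : R) ^+ k by rewrite exprn_ge0.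
  apply: le_trans (ler_wpM2l p0 (vinc k)) _.
  by rewrite -exprMn [X in X ^+ k](_ : _ = 2^-1)//; field.
have iPsi : mu.-integrable setT Psi.
  apply/integrableP; split => //.
  under eq_integral do rewrite gee0_abs//.
  rewrite /Psi integral_nneseries//.
  apply: (@le_lt_trans _ _ (\sum_(0 <= k <oo) (2^-1 ^+ k)%:E)%E).
    by apply: lee_nneseries => [? _ _|? _]; [apply: integral_ge0|exact: iF].
  have g1 : `|2^-1 : R| < 1 by rewrite ger0_norm ?invr_ge0// invf_lt1// ltr1n.
  rewrite (_ : limn _ = (1 / (1 - 2^-1 : R))%:E) ?ltry//; apply/cvg_lim => //.
  have := @cvg_geometric_series R 1 _ g1.
  move=> /EFin_cvgn /eq_cvg_to; apply => // n /=.
  rewrite /series /= sumEFin; congr EFin; apply: eq_bigr => k _.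
  by rewrite mul1r.
have aecvg : {ae mu, forall x, cvgn (v^~ x)}.
  apply: filterS (integrable_ae measurableT iPsi) => x /(_ Logic.I) fPx.
  apply: (@cvg_of_sqr_increments _ (fine (Psi x))) => k.
  rewrite -lee_fin fineK//.
  have := @nneseries_lim_ge R (F^~ x) xpredT 0%N k.+1 (fun k _ _ => F0 k x).
  apply: le_trans; rewrite big_nat_recr//= leeDr//.
  by apply: sume_ge0.
(* An upper limit is measurable everywhere and agrees with the limit wherever the latter exists, so
   no exceptional set has to be removed. *)
pose u x := fine (limn_esup (fun k => (v k x)%:E)).
have mu_ : measurable_fun setT u.
  apply: (measurableT_comp (@fine_measurable _ _ measurableT)).
  apply: measurable_fun_limn_esup => k; apply/measurable_EFinP.
  exact: L2_measurable.
have uE x : cvgn (v^~ x) -> (v^~ x) @ \oo --> u x.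
  move=> cvx; have /EFin_cvgn/cvg_limn_einf_sup[_ ul] := cvx.
  by rewrite /u ul.
have bnd e n M : (forall k, (M <= k)%N -> ip (u_ n \- v k) (u_ n \- v k) <= e) ->
    (\int[mu]_x ((u_ n x - u x) ^+ 2)%:E <= e%:E)%E.
  move=> le_e.
  pose G k x := ((u_ n x - v k x) ^+ 2)%:E.
  have mG k : measurable_fun setT (G k).
    apply/measurable_EFinP/measurable_funX; apply: measurable_funB; exact: L2_measurable.
  rewrite (@ae_eq_integral _ _ _ mu _ (fun x => limn_einf (G^~ x)))//; last first.
  - apply: filterS aecvg => x /uE cvx _; apply/esym.
    have c1 : (fun k => u_ n x - v k x) @ \oo --> u_ n x - u x.
      by apply: cvgB => //; exact: cvg_cst.
    have /EFin_cvgn/cvg_limn_einf_sup[<- _] :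
        (fun k => (u_ n x - v k x) ^+ 2) @ \oo --> (u_ n x - u x) ^+ 2.
      by rewrite expr2; apply: cvgM.
    by [].
  - by rewrite /limn_einf; apply: measurableT_comp => //; apply: measurable_fun_limn_esup => k; apply: measurableT_comp.
  - apply/measurable_EFinP/measurable_funX; apply: measurable_funB => //; exact: L2_measurable.
  apply: le_trans (fatou _ _ _ _) _ => //.
    by move=> k x _; rewrite lee_fin sqr_ge0.
  apply: limn_einf_le => K; exists (maxn K M); first exact: leq_maxl.
  rewrite /G -(ip_sqrE (f := u_ n \- v (maxn K M))); last exact: L2B.
  by rewrite lee_fin le_e// leq_maxr.
have hu e n M : (forall k, (M <= k)%N -> ip (u_ n \- v k) (u_ n \- v k) <= e) ->
    u_ n \- u \in L2.
  move=> /bnd le_e; apply/L2P; split.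
    by apply: measurable_funB => //; exact: L2_measurable.
  exact: le_lt_trans le_e (ltry _).
have tail e : 0 < e -> exists N0, forall n, (N0 <= n)%N ->
    forall k, (N0 <= k)%N -> ip (u_ n \- v k) (u_ n \- v k) <= e.
  move=> e0; have [N1 HN1] := cauchy _ e0.
  have /(cvgrPdist_lt _ _).1 /(_ e e0) [N2 _ HN2] :
      (fun k => (8 : R)^-1 ^+ k) @ \oo --> 0.
    apply: cvg_expr; rewrite ger0_norm ?invr_ge0// invf_lt1// ltr1n//.
  exists (maxn (maxn N1 N2) (N N2)) => n; rewrite !geq_max.
  move=> /andP[/andP[n1 n2] n3] k; rewrite !geq_max => /andP[/andP[k1 k2] k3].
  apply: (@le_trans _ _ (8^-1 ^+ N2)).
    by apply: HN => //; exact: sN.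
  have := HN2 _ (leqnn N2); rewrite /= sub0r normrN => h.
  by apply/ltW; apply: le_lt_trans h; rewrite ler_norm.
have hu2 : u \in L2.
  have [N0 HN0] := tail 1 ltr01.
  rewrite (_ : u = u_ N0 \- (u_ N0 \- u)).
    by apply: L2B => //; exact: hu (HN0 _ (leqnn N0)).
  by apply/funext => x /=; ring.
exists u => //; apply/cvgrPdist_le => e e0.
have [N0 HN0] := tail e e0; near=> n.
rewrite sub0r normrN ger0_norm ?ip_ge0// -lee_fin ip_sqrE; last exact: L2B.
by apply: (bnd _ _ N0); apply: HN0; near: n; exists N0.
Unshelve. all: by end_near. Qed.

Definition subspaceL2 (D : set (T -> R)) := [/\ D (cst 0),
  forall f, D f -> f \in L2 & forall a f g, D f -> D g -> D (f \+ (a \*o g))].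

Lemma linear_form_eq0 (a b : R) : 0 <= b ->
  (forall t, 0 <= t * a + t ^+ 2 * b) -> a = 0.
Proof.
(* The minimiser is -a / (2 b); [b + 1] avoids a division by zero and still yields a negative value
   unless a = 0. *)
move=> b0 h; have := h (- a / (2 * (b + 1))).
have bn0 : b + 1 != 0 by rewrite gt_eqF// ltr_wpDl.
have -> : - a / (2 * (b + 1)) * a + (- a / (2 * (b + 1))) ^+ 2 * b =
    - (a ^+ 2 * ((b + 2) / (4 * (b + 1) ^+ 2))) by field; rewrite bn0.
rewrite oppr_ge0 pmulr_lle0; first by rewrite exprn_even_le0//= => /eqP.
by rewrite divr_gt0 ?mulr_gt0 ?exprn_gt0// ltr_wpDl.
Qed.

(** The bound by C + |f|^2 / 2 makes J f = |f|^2 / 2 - L f bounded below on D. A minimising sequence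
    is Cauchy by the parallelogram identity, its limit g may lie outside D, and stationarity of J at
    g is the representation. The last clause places g in the closure of D, so that with L = [ip f]
    the lemma is the orthogonal projection. *)
Lemma riesz_subspace (D : set (T -> R)) (L : (T -> R) -> R) C :
  subspaceL2 D ->
  (forall a f g, D f -> D g -> L (f \+ (a \*o g)) = L f + a * L g) ->
  (forall f, D f -> L f <= C + ip f f / 2) ->
  exists g, [/\ g \in L2, forall f, D f -> L f = ip g f &
    forall e, 0 < e -> exists2 f, D f & ip (g \- f) (g \- f) <= e].
Proof.
move=> [D0 DL2 Dlin] Llin LC.
pose J f := ip f f / 2 - L f.
pose S := [set J f | f in D].
have JC f : D f -> - C <= J f by move=> /LC; rewrite /J; lra.
have infS : has_inf S.
  split; first by exists (J (cst 0)), (cst 0).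
  by exists (- C) => _ [f /JC + <-].
set m := inf S.
have mJ f : D f -> m <= J f.
  by move=> Df; apply: ge_inf; [exact: infS.2|exists f].
have /choice[phi hphi] : forall n : nat, exists f, D f /\ J f < m + n.+1%:R^-1.
  move=> n; have n0 : (0 : R) < n.+1%:R^-1 by rewrite invr_gt0.
  by have [_ [f Df <-] Jf] := inf_adherent n0 infS; exists f.
have Dphi n : D (phi n) := (hphi n).1.
have L2phi n : phi n \in L2 by exact: DL2.
(* Both values of J are compared with the value at the midpoint: |p - q|^2 / 4 = J p + J q - 2 J ((p
   + q) / 2). *)
have cauchy n k : ip (phi n \- phi k) (phi n \- phi k) <=
    4 * (n.+1%:R^-1 + k.+1%:R^-1).
  have Dh : D ((cst 0 \+ (2^-1 \*o phi n)) \+ (2^-1 \*o phi k)).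
    exact: (Dlin _ _ _ (Dlin _ _ _ D0 (Dphi n)) (Dphi k)).
  have := mJ _ Dh; rewrite /J Llin//; last exact: Dlin.
  rewrite Llin// (_ : L (cst 0) = 0); last first.
    have := Llin (-1) _ _ D0 D0; rewrite mulN1r subrr => L0; rewrite -[RHS]L0.
    by congr L; apply/funext => x /=; rewrite mulr0 addr0.
  rewrite (_ : cst 0 \+ (2^-1 \*o phi n) = 2^-1 \*o phi n); last first.
    by apply/funext => x /=; rewrite add0r.
  rewrite ip_sqrD; [|exact: L2Z|exact: L2Z].
  rewrite !(ipZl, ipZr)//; try exact: L2Z.
  rewrite ip_sqrB//.
  have := (hphi n).2; have := (hphi k).2; rewrite /J.
  by move: n.+1%:R^-1 k.+1%:R^-1 => p q; lra.
have inv_small e : 0 < e -> exists N, forall n, (N <= n)%N -> n.+1%:R^-1 <= e :> R.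
  move=> e0; have /(cvgrPdist_le _ _).1 /(_ e e0)[N _ HN] := @cvg_harmonic R.
  exists N => n /HN; rewrite /= sub0r normrN ger0_norm//.
have [g hg gphi] : exists2 g, g \in L2 & cvgL2 mu phi g.
  apply: L2_complete => // e e0.
  have e8 : 0 < e / 8 by rewrite divr_gt0.
  have [N HN] := inv_small _ e8.
  exists N => n k /HN + /HN +; have := cauchy n k.
  by move: n.+1%:R^-1 k.+1%:R^-1 => p q; lra.
exists g; split=> //; last first.
  move=> e e0; have /cvgrPdist_le/(_ e e0)[N _ HN] := gphi.
  exists (phi N) => //; have := HN N (leqnn N).
  by rewrite /= sub0r normrN ger0_norm ?ip_ge0// ip_sqrBC.
move=> f Df; apply/eqP; rewrite eq_sym -subr_eq0; apply/eqP.
have hf := DL2 _ Df.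
apply: (@linear_form_eq0 _ (ip f f / 2)); first by rewrite divr_ge0// ip_ge0.
move=> t.
(* As g may lie outside D, minimality is used at [phi n] shifted by t f and passed to the limit,
   where the defect 1 / n.+1 disappears. *)
have lim1 : (fun n => t * (ip (phi n) f - L f) + t ^+ 2 * (ip f f / 2)) @ \oo -->
    t * (ip g f - L f) + t ^+ 2 * (ip f f / 2).
  apply: cvgD; last exact: cvg_cst.
  apply: cvgMr; apply: cvgB; last exact: cvg_cst.
  exact: cvgL2_weak gphi _ hf.
have lim2 : (fun n => - (n.+1%:R^-1 : R)) @ \oo --> (0 : R).
  by rewrite -oppr0; apply: cvgN; exact: cvg_harmonic.
apply: (ler_cvg_to lim2 lim1); apply: nearW => n.
have Dn : D (phi n \+ (t \*o f)) by exact: Dlin.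
have := mJ _ Dn; rewrite /J Llin//.
rewrite ip_sqrD//; last exact: L2Z.
rewrite !(ipZl, ipZr)//; last exact: L2Z.
by have := (hphi n).2; rewrite /J; move: n.+1%:R^-1 => q; lra.
Qed.

Definition denseL2 (D : set (T -> R)) := forall f e, f \in L2 -> 0 < e ->
  exists2 g, D g & ip (f \- g) (f \- g) <= e.

(** For g in D close to f, orthogonality gives |f - g|^2 = |f|^2 + |g|^2, so |f|^2 is arbitrarily
    small. *)
Lemma denseL2_eq0 (D : set (T -> R)) f : (forall g, D g -> g \in L2) ->
  denseL2 D -> f \in L2 -> (forall g, D g -> ip f g = 0) ->
  ae_eq mu setT f (cst 0).
Proof.
move=> DL2 dD hf f0; apply: ip_eq0 => //; apply/eqP; rewrite eq_le ip_ge0 andbT.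
apply/ler_addgt0Pl => e e0; rewrite addr0.
have [g Dg fg] := dD _ _ hf e0; have hg := DL2 _ Dg.
apply: le_trans fg; rewrite ip_sqrB// (f0 g)// mulr0 subr0 lerDl; exact: ip_ge0.
Qed.

(** The common bound M controls the pairing with v - f uniformly in n, once f in D is close to v. *)
Lemma cvgL2w_dense (D : set (T -> R)) (g_ : nat -> T -> R) g M :
  (forall f, D f -> f \in L2) -> denseL2 D -> (forall n, g_ n \in L2) -> g \in L2 ->
  (forall n, ip (g_ n) (g_ n) <= M) ->
  (forall f, D f -> (fun n => ip (g_ n) f) @ \oo --> ip g f) -> cvgL2w mu g_ g.
Proof.
move=> DL2 dD hg_ hg gM cD v hv.
have small (p q : T -> R) e B : p \in L2 -> q \in L2 -> 0 < e -> ip p p <= B ->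
    ip q q <= e ^+ 2 / (B + 1) -> `|ip p q| <= e.
  move=> hp hq e0 pB qe; have B0 : 0 <= B := le_trans (ip_ge0 _ _) pB.
  rewrite -(ler_pXn2r (n := 2))// ?nnegrE ?normr_ge0 ?(ltW e0)//.
  rewrite real_normK ?num_real// (le_trans (CauchySchwarz hp hq))//.
  rewrite (le_trans (ler_pM (ip_ge0 _ _) (ip_ge0 _ _) pB qe))//.
  rewrite mulrA ler_pdivrMr ?ltr_wpDl// mulrC ler_wpM2l ?sqr_ge0// lerDl//.
apply/cvgrPdist_le => e e0; have e3 : 0 < e / 3 by rewrite divr_gt0.
set B := M + ip g g.
have M0 : 0 <= M := le_trans (ip_ge0 _ _) (gM 0%N).
have B0 : 0 <= B by rewrite addr_ge0// ip_ge0.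
have d0 : 0 < (e / 3) ^+ 2 / (B + 1) by rewrite divr_gt0 ?exprn_gt0// ltr_wpDl.
have [f Df vf] := dD _ _ hv d0; have hf := DL2 _ Df.
have /cvgrPdist_le/(_ _ e3) := cD _ Df; apply: filterS => n hn.
have hvf : v \- f \in L2 by exact: L2B.
have -> : ip g v - ip (g_ n) v = ip g (v \- f) + (ip g f - ip (g_ n) f) - ip (g_ n) (v \- f).
  by rewrite !ipBr//; ring.
have h1 : `|ip g (v \- f)| <= e / 3.
  by apply: (small _ _ _ B) => //; rewrite lerDr.
have h2 : `|ip (g_ n) (v \- f)| <= e / 3.
  by apply: (small _ _ _ B) => //; rewrite (le_trans (gM n))// lerDl ip_ge0.
apply: le_trans (ler_normB _ _) _; apply: le_trans (lerD (ler_normD _ _) (lexx _)) _.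
by move: h1 h2 hn; lra.
Qed.

(** The limits against D determine the weak limit: the limit functional inherits linearity, and |g_n
    - f|^2 >= 0 gives the bound M / 2 + |f|^2 / 2 that [riesz_subspace] requires. *)
Lemma weak_limit_dense (D : set (T -> R)) (g_ : nat -> T -> R) (L : (T -> R) -> R) M :
  subspaceL2 D -> denseL2 D -> (forall n, g_ n \in L2) ->
  (forall n, ip (g_ n) (g_ n) <= M) ->
  (forall f, D f -> (fun n => ip (g_ n) f) @ \oo --> L f) ->
  exists g, [/\ g \in L2, forall f, D f -> L f = ip g f & cvgL2w mu g_ g].
Proof.
move=> sD dD hg_ gM cD; have [D0 DL2 Dlin] := sD.
have [|f Df|g [hg gL _]] := @riesz_subspace D L (M / 2) sD.
- move=> a f h Df Dh.
  have c1 := cD _ (Dlin a _ _ Df Dh).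
  have c2 : (fun n => ip (g_ n) (f \+ (a \*o h))) @ \oo --> L f + a * L h.
    apply: (eq_cvg_to (cvgD (cD _ Df) (cvgMr (cD _ Dh)))) => // n.
    rewrite ipDr ?ipZr//; try exact: DL2.
    by apply: L2Z; exact: DL2.
  exact: cvg_unique c1 c2.
- apply: (ler_cvg_to (cD _ Df) (cvg_cst (M / 2 + ip f f / 2))).
  apply: nearW => n; have := ip_ge0 mu (g_ n \- f).
  rewrite ip_sqrB//; last exact: DL2.
  by have := gM n; lra.
exists g; split=> //; apply: (@cvgL2w_dense D g_ g M) => // f Df.
by rewrite -gL//; exact: cD.
Qed.

(** The squared norm lies above its tangent at g. The left side is weakly continuous in f, which
    makes this the source of weak lower semicontinuity. *)
Lemma ip_tangent_le f g : f \in L2 -> g \in L2 -> 2 * ip f g - ip g g <= ip f f.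
Proof. by move=> hf hg; have := ip_ge0 mu (f \- g); rewrite ip_sqrB//; lra. Qed.

Lemma cvg_ip_tangent (f_ : nat -> T -> R) g : g \in L2 -> cvgL2w mu f_ g ->
  (fun n => 2 * ip (f_ n) g - ip g g) @ \oo --> ip g g.
Proof.
move=> hg c; rewrite [X in _ --> X](_ : _ = 2 * ip g g - ip g g); last by ring.
by apply: cvgB; [apply: cvgMr; exact: c|exact: cvg_cst].
Qed.

(** Dynkin's theorem applied to f times the indicator of [E n]: f itself may fail to be integrable
    when the measure is infinite, and stability of G under intersection keeps the hypothesis
    available after localisation. *)
Lemma orth_pi_system (G : set (set T)) (E : nat -> set T) f : f \in L2 ->
  d.-measurable = <<s G>> -> setI_closed G -> (forall n, G (E n)) ->
  \bigcup_n E n = setT ->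
  (forall A, G A -> (\1_A : T -> R) \in L2 /\ ip f (\1_A) = 0) ->
  ae_eq mu setT f (cst 0).
Proof.
move=> hf mG GI GE ET Gf.
have mE n : measurable (E n) by rewrite mG; apply: sub_sigma_algebra.
suff : forall n, ae_eq mu setT (EFin \o (f \* \1_(E n))) (cst 0%E).
  move=> /ae_foralln; apply: filterS => x fE _.
  have : [set: T] x by []. 
  rewrite -ET => -[n _ En]; have := fE n Logic.I.
  by rewrite /= indicE mem_set// mulr1 => -[].
move=> n; set h := f \* \1_(E n).
have ih : mu.-integrable setT (EFin \o h).
  by apply: ip_integrable => //; exact: (Gf _ (GE n)).1.
have ihA A : measurable A -> mu.-integrable A (EFin \o h).
  by move=> mA; exact: integrableS ih.
suff P : forall A, measurable A -> \int[mu]_(x in A) h x = 0.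
  apply: integral_ae_eq => // A _ mA; rewrite integral0.
  have := P A mA; rewrite /Rintegral => Ah.
  by rewrite -[LHS]fineK ?Ah//; apply: integrable_fin_num => //; exact: ihA.
rewrite mG => S; apply: (@dynkin_induction _ _ G (fun A => \int[mu]_(x in A) h x = 0)) => //.
- by have [_] := Gf _ (GE n); rewrite /ip /h.
- move=> A GA; have [_] := Gf _ (GI _ _ GA (GE n)).
  move=> AE0; rewrite -[RHS]AE0 /ip [LHS]Rintegral_mkcond.
  apply: eq_Rintegral => x _.
  rewrite patchE indicI /h /= [in RHS]indicE.
  by case: ifP => xA; rewrite ?mul1r ?mul0r ?mulr0.
- move=> A mA A0.
  have := @Rintegral_setU _ _ _ mu A (~` A) h mA (measurableC mA).
  rewrite setUv A0 add0r => <- //; last by apply/disj_setPS; rewrite setICr.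
  by have [_] := Gf _ (GE n).
- move=> F mF tF F0; rewrite /Rintegral integral_bigcup//; last first.
    by apply: ihA; exact: bigcup_measurable.
  rewrite eseries0// => k _ _.
  have := F0 k; rewrite /Rintegral => Fh.
  by rewrite -[LHS]fineK ?Fh//; apply: integrable_fin_num => //; exact: ihA.
Qed.

(** Project f onto the closure of D: the remainder is orthogonal to D, hence to the indicators of
    the sets of G, hence zero almost everywhere. *)
Lemma dense_pi_system (D : set (T -> R)) (G : set (set T)) (E : nat -> set T) :
  subspaceL2 D ->
  d.-measurable = <<s G>> -> setI_closed G -> (forall n, G (E n)) ->
  \bigcup_n E n = setT ->
  (forall A, G A -> (\1_A : T -> R) \in L2 /\
     exists2 g_ : nat -> T -> R, forall n, D (g_ n) & cvgL2 mu g_ \1_A) ->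
  denseL2 D.
Proof.
move=> sD mG GI GE ET GD f e hf e0; have [D0 DL2 Dlin] := sD.
have [|g Dg|g [hg gf gD]] := @riesz_subspace D (ip f) (ip f f / 2) sD.
- by move=> a g h Dg Dh; rewrite ipDr ?ipZr//; try exact: DL2; apply: L2Z; exact: DL2.
- have hg := DL2 _ Dg; have := ip_ge0 mu (f \- g); rewrite ip_sqrB//; lra.
have hfg : f \- g \in L2 by exact: L2B.
have fg0 : ae_eq mu setT (f \- g) (cst 0).
  apply: (orth_pi_system hfg mG GI GE ET) => A /GD[hA [g_ Dg_ cA]]; split=> //.
  have c1 : (fun n => ip (f \- g) (g_ n)) @ \oo --> ip (f \- g) \1_A.
    apply: cvgL2_ip => //; first by move=> n; exact: DL2.
    exact: cvgL2_cst.
  have c2 : (fun n => ip (f \- g) (g_ n)) @ \oo --> (0 : R).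
    apply: (eq_cvg_to (cvg_cst 0)) => // n.
    by rewrite ipBl//; [rewrite gf// subrr|exact: DL2].
  exact: cvg_unique c1 c2.
have [k Dk gk] := gD _ e0; exists k => //; have hk := DL2 _ Dk.
rewrite (@eq_ip _ _ _ _ _ (g \- k) _ (g \- k))//; try exact: L2B.
  by apply: filterS fg0 => x /(_ Logic.I) /= /eqP; rewrite subr_eq0 => /eqP ->.
by apply: filterS fg0 => x /(_ Logic.I) /= /eqP; rewrite subr_eq0 => /eqP ->.
Qed.

End Hilbert.

(** * Smooth functions and test functions *)

Section smooth.
Context (R : realType).

(** A class stable under directional derivatives contains all the iterated derivatives of its
    members. Smoothness is often proved below by exhibiting such a class. *)
Lemma smooth_coind (V : normedModType R) (C : set (V -> R^o)) :
  (forall f, C f -> [/\ continuous f, forall x v, derivable f x v &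
     forall v, C ('D_v f)]) ->
  forall f, C f -> smooth f.
Proof.
move=> HC f Cf vs; suff /HC[cg dg _] : C (foldr (fun v h => 'D_v h) f vs) by [].
by elim: vs => //= v vs /HC[_ _]; apply.
Qed.

Section normed.
Context (V : normedModType R).
Implicit Types f g : V -> R^o.

Lemma smooth_continuous f : smooth f -> continuous f.
Proof. by move=> /(_ [::])[]. Qed.

Lemma smooth_derivable f x v : smooth f -> derivable f x v.
Proof. by move=> /(_ [::])[_]; apply. Qed.

Lemma smooth_derive f v : smooth f -> smooth ('D_v f).
Proof. by move=> sf vs; have := sf (rcons vs v); rewrite foldr_rcons. Qed.

Lemma smooth_cst (k : R) : smooth (cst k : V -> R^o).
Proof.
apply: (@smooth_coind V (range (fun k : R => cst k : V -> R^o))); last by exists k.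
move=> _ [c _ <-]; split=> [|x v|v].
- by move=> x; exact: cst_continuous.
- exact: derivable_cst.
- by exists 0 => //; apply/funext => x; rewrite derive_cst.
Qed.

(** Leibniz's rule turns a product into a sum of products, so stability under derivation asks for
    closing the smooth functions under both operations at once. *)
Inductive smooth_alg : (V -> R^o) -> Prop :=
| smooth_alg_gen f : smooth f -> smooth_alg f
| smooth_algD f g : smooth_alg f -> smooth_alg g -> smooth_alg (fun x => f x + g x)
| smooth_algM f g : smooth_alg f -> smooth_alg g -> smooth_alg (fun x => f x * g x).

Lemma smooth_algE f : smooth_alg f -> smooth f.
Proof.
apply: smooth_coind => {}f.
elim=> {f}[f sf|f g af [cf df Df] ag [cg dg Dg]|f g af [cf df Df] ag [cg dg Dg]].
- split; [exact: smooth_continuous|by move=> *; exact: smooth_derivable|].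
  by move=> v; apply: smooth_alg_gen; exact: smooth_derive.
- split=> [x|x v|v].
  + by apply: (@continuousD _ R^o); [exact: cf|exact: cg].
  + exact: (derivableD (df x v) (dg x v)).
  + rewrite (_ : 'D_v _ = (fun x => 'D_v f x + 'D_v g x)).
      by apply: smooth_algD.
    by apply/funext => x; rewrite -deriveD.
- split=> [x|x v|v].
  + by apply: (@continuousM R); [exact: cf|exact: cg].
  + exact: (derivableM (df x v) (dg x v)).
  + rewrite (_ : 'D_v _ = (fun x => f x * 'D_v g x + g x * 'D_v f x)).
      by apply: smooth_algD; exact: smooth_algM.
    by apply/funext => x; exact: deriveM.
Qed.

Lemma smoothD f g : smooth f -> smooth g -> smooth (f \+ g).
Proof. by move=> sf sg; apply: smooth_algE; apply: smooth_algD; exact: smooth_alg_gen. Qed.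

Lemma smoothM f g : smooth f -> smooth g -> smooth (fun x => f x * g x).
Proof. by move=> sf sg; apply: smooth_algE; apply: smooth_algM; exact: smooth_alg_gen. Qed.

Lemma smoothZ (k : R) f : smooth f -> smooth (fun x => k * f x).
Proof. by move=> sf; apply: (smoothM (f := cst k)) => //; exact: smooth_cst. Qed.

Lemma derive_supp f v x : ~ closure [set x | f x != 0] x -> 'D_v f x = 0.
Proof.
move=> nx; have nbx : \forall y \near x, f y = 0.
  move: nx; rewrite /closure /= => /existsNP[B /not_implyP[Bx /set0P/negP/negPn/eqP fB]].
  apply: filterS Bx => y By; apply: contrapT => /eqP fy.
  by have : ([set x | f x != 0] `&` B) y by []; rewrite fB.
have [->|v0] := eqVneq v 0; first by rewrite derive0.
by rewrite (near_eq_derive (g := cst 0))// ?derive_cst.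
Qed.

End normed.

Definition linear_fun (U V : normedModType R) (l : U -> V) :=
  forall a x y, l (a *: x + y) = a *: l x + l y.

(** The difference quotients coincide literally, so the derivatives of a composition with an affine
    map are read off directly. *)
Lemma affine_quotient (U V : normedModType R) (l : U -> V) (c : V)
    (f : V -> R^o) (x v : U) : linear_fun l ->
  (fun h : R => h^-1 *: (((fun y => f (l y + c)) \o shift x) (h *: v) - f (l x + c))) =
  (fun h => h^-1 *: ((f \o shift (l x + c)) (h *: l v) - f (l x + c))).
Proof. by move=> hl; apply/funext => h /=; rewrite hl addrA. Qed.

Lemma derivable_affine (U V : normedModType R) (l : U -> V) (c : V)
    (f : V -> R^o) (x v : U) : linear_fun l -> derivable f (l x + c) (l v) ->
  derivable (fun x => f (l x + c) : R^o) x v.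
Proof. by move=> hl; rewrite /derivable affine_quotient. Qed.

Lemma derive_affine (U V : normedModType R) (l : U -> V) (c : V)
    (f : V -> R^o) (v : U) : linear_fun l ->
  'D_v (fun x => f (l x + c) : R^o) = (fun x => 'D_(l v) f (l x + c)).
Proof. by move=> hl; apply/funext => x; rewrite /derive affine_quotient. Qed.

Lemma smooth_affine (U V : normedModType R) (l : U -> V) (c : V)
    (f : V -> R^o) : linear_fun l -> continuous l -> smooth f ->
  smooth (fun x => f (l x + c) : R^o).
Proof.
move=> hl cl sf.
apply: (@smooth_coind U [set g | exists2 f : V -> R^o, smooth f &
  g = (fun x => f (l x + c))]); last by exists f.
move=> _ [{sf}f sf ->]; split=> [x|x v|v].
- apply: (@continuous_comp _ _ _ (fun x => l x + c) f); last exact: smooth_continuous.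
  by apply: (@continuousD _ V _ l (cst c)); [exact: cl|exact: cst_continuous].
- by apply: (derivable_affine hl); exact: smooth_derivable.
- by exists ('D_(l v) f); [exact: smooth_derive|rewrite (derive_affine _ _ _ hl)].
Qed.

Lemma smooth_is_derive1 (f : R -> R^o) (g : R -> R^o) :
  (forall x, is_derive (x : R) (1 : R) f (g x)) ->
  continuous f /\ forall v, 'D_v f = (fun x => v * g x) /\ forall x, derivable f x v.
Proof.
move=> fg; have df x : differentiable f x by apply/derivable1_diffP.
split=> [x|v]; first exact: differentiable_continuous.
split=> [|x]; last exact: diff_derivable.
apply/funext => x; rewrite deriveE// -[v in LHS]mulr1 -[_ * _]/(v *: (1 : R)).
by rewrite linearZ_LR -deriveE// derive_val.
Qed.

(** On the line the derivative along v is v times the derivative along 1, whence the stability under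
    scalar multiples. *)
Lemma smooth_coind1 (C : set (R -> R^o)) :
  (forall (k : R) f, C f -> C (fun x => k * f x)) ->
  (forall f, C f -> exists2 g, C g & forall x, is_derive (x : R) (1 : R) f (g x)) ->
  forall f, C f -> smooth f.
Proof.
move=> CZ CD; apply: smooth_coind => f /CD[g Cg /smooth_is_derive1[cf fg]].
split=> // [x v|v]; first by have [_] := fg v; apply.
by have [-> _] := fg v; exact: CZ.
Qed.

Lemma smooth_antiderivative (F f : R -> R^o) :
  (forall x, is_derive (x : R) (1 : R) F (f x)) -> smooth f -> smooth F.
Proof.
move=> Ff sf; apply: (@smooth_coind R [set g | g = F \/ smooth g]); last by left.
move=> g [->{g}|sg].
  have [cF dF] := smooth_is_derive1 Ff; split=> // [x v|v].
    by have [_] := dF v; apply.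
  by right; have [-> _] := dF v; exact: smoothZ.
split=> [|x v|v]; first exact: smooth_continuous.
- exact: smooth_derivable.
- by right; exact: smooth_derive.
Qed.

(** The polynomial in 1/t makes the family stable under derivation, p becoming X^2 (p - p'). *)
Definition exp_inv (p : {poly R}) (t : R) : R :=
  if 0 < t then p.[t^-1] * expR (- t^-1) else 0.

(** Coefficientwise, s^(i+2) / (i+2)! <= exp s. Two powers are gained so that, with s = 1/h, the
    function [exp_inv p] is O(h^2) and its derivative at 0 vanishes. *)
Lemma poly_expR_le (p : {poly R}) :
  exists C, forall s, 0 < s -> `|p.[s]| * expR (- s) <= C / s ^+ 2.
Proof.
exists (\sum_(i < size p) `|p`_i| * (i.+2)`!%:R) => s s0.
rewrite horner_coef (le_trans (ler_wpM2r (expR_ge0 _) (ler_norm_sum _ _ _)))//.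
rewrite !mulr_suml; apply: ler_sum => i _.
rewrite normrM normrX (gtr0_norm s0) -!mulrA ler_wpM2l//.
rewrite ler_pdivlMr ?exprn_gt0// expRN mulrAC -exprD addn2.
rewrite ler_pdivrMr ?expR_gt0//.
have := @expR_ge1Dxn R s i.+1 (ltW s0).
have f0 : (0 : R) < (i.+2)`!%:R by rewrite ltr0n fact_gt0.
move=> h; have : s ^+ i.+2 / (i.+2)`!%:R <= expR s by lra.
by rewrite ler_pdivrMr// mulrC.
Qed.

Lemma is_derive_exp_inv (p : {poly R}) (t : R) :
  is_derive t (1 : R) (exp_inv p : R -> R^o) (exp_inv ('X^2 * (p - p^`())) t).
Proof.
have [t0|t0|->] := ltgtP t 0.
- rewrite /exp_inv ltNge (ltW t0)/=.
  apply: (@near_eq_is_derive _ _ _ (cst 0)).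
  by near=> u; rewrite ltNge ltW//; near: u; exact: lt_nbhsl.
- have tn0 : t != 0 by rewrite gt_eqF.
  apply: (@near_eq_is_derive _ _ _ (fun t : R => p.[t^-1] * expR (- t^-1) : R^o)).
    by near=> u; rewrite /exp_inv ifT//; near: u; apply: (cvgr_gt t) => //; exact: cvg_id.
  have dV : is_derive t (1 : R) (fun t : R => t^-1 : R^o) (- t ^- 2).
    exact: (@is_derive_eq _ _ _ _ _ _ _ _ (@is_deriveV R id t 1 1 tn0 (is_derive_id _ _)) (mulr1 _)).
  have dh : is_derive t^-1 (1 : R) (horner p : R -> R^o) p^`().[t^-1].
    by apply: DeriveDef; [exact: derivable_horner|rewrite derivE derive1E].
  have d1 := @is_derive1_comp R (horner p) (fun t : R => t^-1) t _ _ dh dV.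
  have dN : is_derive t (1 : R) (fun t : R => - t^-1 : R^o) (t ^- 2).
    exact: (@is_derive_eq _ _ _ _ _ _ _ _ (is_deriveN dV) (opprK _)).
  have d2 := @is_derive1_comp R expR (fun t : R => - t^-1) t _ _ (is_derive_expR _) dN.
  apply: (@is_derive_eq _ _ _ _ _ _ _ _ (is_deriveM d1 d2)).
  rewrite /exp_inv t0 /= hornerM hornerXn hornerD hornerN.
  rewrite -![_ *: _]/(_ * _) -exprVn; ring.
rewrite /exp_inv ltxx.
have [C HC] := poly_expR_le p.
have f0 (h : R) : `|exp_inv p h| <= `|C| * h ^+ 2.
  rewrite /exp_inv; case: ifPn => [h0|_]; last by rewrite normr0 mulr_ge0// sqr_ge0.
  have hi : 0 < h^-1 by rewrite invr_gt0.
  rewrite normrM (ger0_norm (expR_ge0 _)) (le_trans (HC _ hi))//.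
  by rewrite exprVn invrK ler_wpM2r ?sqr_ge0// ler_norm.
have cv : (fun h : R => h^-1 *: (((exp_inv p : R -> R^o) \o shift (0 : R)) (h *: (1 : R))
    - exp_inv p 0)) @ 0^' --> (0 : R).
  apply/cvgrPdist_le => e e0; near=> h.
  have hn0 : h != 0 by near: h; exact: nbhs_dnbhs_neq.
  rewrite sub0r normrN /= addr0 {2}/exp_inv ltxx subr0.
  rewrite -[_ *: _]/(_ * _) -[_%:A]/(_ * _) mulr1 normrM normfV.
  rewrite ler_pdivrMl ?normr_gt0// (le_trans (f0 _))//.
  rewrite -(real_normK (num_real h)) expr2 mulrA mulrC ler_wpM2l//.
  have C0 : 0 < `|C| + 1 by rewrite ltr_wpDl.
  apply: (@le_trans _ _ ((`|C| + 1) * `|h|)); first by rewrite ler_wpM2r// lerDl.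
  rewrite mulrC -ler_pdivlMr//; apply: ltW; near: h.
  apply: dnbhs0_lt; exact: divr_gt0.
apply: DeriveDef.
  by apply/cvg_ex; exists 0; rewrite /exp_inv in cv *.
by apply/cvg_lim => //; rewrite /exp_inv in cv *.
Unshelve. all: by end_near. Qed.

Lemma smooth_exp_inv (p : {poly R}) : smooth (exp_inv p : R -> R^o).
Proof.
apply: (@smooth_coind1 (range exp_inv)); last by exists p.
- move=> k _ [q _ <-]; exists (k *: q) => //; apply/funext => t.
  by rewrite /exp_inv; case: ifP; rewrite ?mulr0// hornerZ mulrA.
- move=> _ [q _ <-]; exists (exp_inv ('X^2 * (q - q^`()))); first by exists ('X^2 * (q - q^`())).
  by move=> x; exact: is_derive_exp_inv.
Qed.

Section test.
Context (V : normedModType R).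
Implicit Types (f g : V -> R^o) (W : set V).

(** Any compact subset of W off which f vanishes may take the place of the support, whose closure is
    awkward to compute. *)
Lemma test_intro W (K : set V) f : smooth f -> compact K -> K `<=` W ->
  (forall x, ~ K x -> f x = 0) -> test_function W f.
Proof.
move=> sf cK KW fK; have sK : closure [set x | f x != 0] `<=` K.
  have /closure_id -> : closed K by apply: compact_closed => //; exact: norm_hausdorff.
  by apply: closure_subset => x /= /eqP fx; apply: contrapT => /fK.
split=> //; last exact: subset_trans sK KW.
exact: subclosed_compact (@closed_closure _ _) cK sK.
Qed.

Lemma test_supp W f x : test_function W f -> ~ W x -> f x = 0.
Proof.
move=> [_ _ sW] nWx; apply: contrapT => /eqP fx; apply/nWx/sW.
exact: subset_closure.
Qed.

Lemma test_smooth W f : test_function W f -> smooth f.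
Proof. by case. Qed.

Lemma test_subset W W' f : W `<=` W' -> test_function W f -> test_function W' f.
Proof. by move=> WW [? ? ?]; split=> //; exact: subset_trans WW. Qed.

Lemma test_off W f x : test_function W f -> ~ closure [set x | f x != 0] x -> f x = 0.
Proof.
by move=> _ nx; apply: contrapT => /eqP fx; apply: nx; exact: subset_closure.
Qed.

Lemma testM W f g : test_function W f -> smooth g ->
  test_function W (fun x => f x * g x).
Proof.
move=> tf sg; have [sf cf fW] := tf.
apply: (test_intro _ cf fW); first exact: smoothM.
by move=> x /(test_off tf) ->; rewrite mul0r.
Qed.

Lemma test_derive W f v : test_function W f -> test_function W ('D_v f).
Proof.
move=> tf; have [sf cf fW] := tf.
apply: (test_intro _ cf fW); first exact: smooth_derive.
by move=> x; exact: derive_supp.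
Qed.

Lemma test_lin W (a : R) f g : test_function W f -> test_function W g ->
  test_function W (f \+ (a \*o g)).
Proof.
move=> tf tg; have [sf cf fW] := tf; have [sg cg gW] := tg.
apply: (test_intro _ (compactU cf cg)).
- by apply: smoothD => //; exact: smoothZ.
- by rewrite subUset.
- move=> x /not_orP[nf ng] /=.
  by rewrite (test_off tf nf) (test_off tg ng) mulr0 addr0.
Qed.

Lemma test_cst0 W : test_function W (cst 0).
Proof. by apply: (@test_intro _ set0) => //; [exact: smooth_cst|exact: compact0]. Qed.

Lemma test_bounded W f : test_function W f -> exists M, forall x, `|f x| <= M.
Proof.
move=> tf; have [sf cf fW] := tf.
have : compact (f @` closure [set x | f x != 0]).
  apply: continuous_compact => //; apply: continuous_subspaceT.
  exact: smooth_continuous.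
move=> /compact_bounded[M [_ HM]]; exists (Num.max (M + 1) 0) => x.
have [Kx|/(test_off tf) ->] := pselect (closure [set x | f x != 0] x).
  rewrite le_max; apply/orP; left; apply: (HM (M + 1)); first by rewrite ltrDl.
  by exists x.
by rewrite normr0 le_max lexx orbT.
Qed.

Lemma test_compact_support W f : test_function W f ->
  exists2 r, 0 < r & forall x, r < `|x| -> f x = 0.
Proof.
move=> tf; have [sf /compact_bounded[M [_ HM]] fW] := tf.
exists (Num.max (M + 1) 1); first by rewrite lt_max ltr01 orbT.
move=> x; rewrite gt_max => /andP[Mx _]; apply: (test_off tf) => Kx.
have := HM (M + 1); rewrite ltrDl => /(_ ltr01 _ Kx) /=.
by rewrite leNgt Mx.
Qed.

Lemma test_reflect f (x : V) : test_function setT f ->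
  test_function setT (fun y => f (x - y) : R^o).
Proof.
move=> tf; have [sf cf _] := tf.
apply: (@test_intro _ ((fun y => x - y) @` closure [set x | f x != 0])) => //.
- rewrite (_ : (fun y => _) = (fun y => f (- y + x))); last first.
    by apply/funext => y; rewrite addrC.
  apply: (smooth_affine (l := -%R)) => //; last exact: oppr_continuous.
  by move=> a y z; rewrite opprD scalerN.
- apply: continuous_compact => //; apply: continuous_subspaceT => y.
  by apply: (@continuousB _ V V (cst x) id) => //; exact: cst_continuous.
- move=> y ny; apply: (test_off tf) => Kxy; apply: ny; exists (x - y) => //.
  by rewrite opprB addrCA subrr addr0.
Qed.

End test.

Lemma smooth_fst (f : R -> R^o) : smooth f -> smooth (fun x : R * R => f x.1 : R^o).
Proof.
move=> sf; rewrite (_ : (fun x => _) = (fun x => f (x.1 + 0))); last first.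
  by apply/funext => x; rewrite addr0.
by apply: (@smooth_affine (R * R)%type R fst) => // x; exact: cvg_fst.
Qed.

Lemma smooth_snd (f : R -> R^o) : smooth f -> smooth (fun x : R * R => f x.2 : R^o).
Proof.
move=> sf; rewrite (_ : (fun x => _) = (fun x => f (x.2 + 0))); last first.
  by apply/funext => x; rewrite addr0.
by apply: (@smooth_affine (R * R)%type R snd) => // x; exact: cvg_snd.
Qed.

Lemma test_tensor (W1 W2 : set R) (f g : R -> R^o) :
  test_function W1 f -> test_function W2 g ->
  test_function (W1 `*` W2) (fun x : R * R => f x.1 * g x.2 : R^o).
Proof.
move=> tf tg; have [sf cf fW] := tf; have [sg cg gW] := tg.
apply: (test_intro _ (compact_setX cf cg)).
- by apply: smoothM; [exact: smooth_fst|exact: smooth_snd].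
- by move=> [x y] [/= Kx Ky]; split; [exact: fW|exact: gW].
- move=> [x y] /not_andP[/= nx|/= ny].
    by rewrite (test_off tf nx) mul0r.
  by rewrite (test_off tg ny) mulr0.
Qed.

Definition expinv := exp_inv 1.

Lemma expinvE t : 0 < t -> expinv t = expR (- t^-1).
Proof. by move=> t0; rewrite /expinv /exp_inv t0 hornerC mul1r. Qed.

Lemma expinv0 t : t <= 0 -> expinv t = 0.
Proof. by move=> t0; rewrite /expinv /exp_inv ltNge t0. Qed.

Lemma expinv_gt0 t : 0 < t -> 0 < expinv t.
Proof. by move=> t0; rewrite expinvE// expR_gt0. Qed.

Lemma expinv_ge0 t : 0 <= expinv t.
Proof. by have [t0|/expinv0 ->//] := ltP 0 t; rewrite ltW// expinv_gt0. Qed.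

Lemma expinv_le1 t : expinv t <= 1.
Proof.
have [t0|/expinv0 ->] := ltP 0 t; last exact: ler01.
by rewrite expinvE// expR_le1 oppr_le0 invr_ge0 ltW.
Qed.

Lemma le_expinv s t : s <= t -> expinv s <= expinv t.
Proof.
move=> st; have [s0|/expinv0 ->] := ltP 0 s; last exact: expinv_ge0.
have t0 := lt_le_trans s0 st; rewrite !expinvE// ler_expR lerN2.
by rewrite lef_pV2// posrE.
Qed.

Lemma smooth_expinv_affine (a c : R) : smooth (fun t : R => expinv (a * t + c) : R^o).
Proof.
apply: (@smooth_affine R R ( *%R a)); last exact: smooth_exp_inv.
  by move=> k x y; rewrite mulrDr -![_ *: _]/(_ * _) mulrCA.
by move=> x; apply: (@continuousM R R (cst a) id) => //; exact: cst_continuous.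
Qed.

Lemma cvg_expinv (t : R) :
  (fun n : nat => expinv (n%:R * t)) @ \oo --> (if 0 < t then 1 : R else 0).
Proof.
case: ifPn => [t0|]; last first.
  rewrite -leNgt => t0; apply: (eq_cvg_to (cvg_cst 0)) => // n.
  by rewrite expinv0// mulr_ge0_le0.
have h : (fun n : nat => expR (- (n.+1%:R^-1 * t^-1))) @ \oo --> (1 : R).
  rewrite -[X in _ --> X]expR0; apply: continuous_cvg; first exact: continuous_expR.
  rewrite -oppr0; apply: cvgN; rewrite -(mul0r t^-1).
  by apply: cvgMl; exact: cvg_harmonic.
rewrite -(cvg_shiftn 1); apply: (eq_cvg_to h) => // n.
by rewrite /= addn1 expinvE ?mulr_gt0// invfM.
Qed.

Lemma test_segment (a b : R) (f : R -> R^o) : smooth f ->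
  (forall t, t < a -> f t = 0) -> (forall t, b < t -> f t = 0) ->
  test_function setT f.
Proof.
move=> sf fa fb; apply: (test_intro sf (@segment_compact _ a b)) => // t /negP.
by rewrite in_itv/= negb_and -!ltNge => /orP[/fa|/fb].
Qed.

(* Smooth, built on exp (-1/t) extended by 0 to t <= 0, and tending to the
   indicator of ]a, b] as n grows. *)
Definition bump (a b : R) (n : nat) (t : R) : R :=
  expinv (n%:R * t + - n%:R * a) *
  expinv (- (n%:R * n%:R) * t + n%:R * (n%:R * b + 1)).

Lemma test_bump a b n : test_function setT (bump a b n : R -> R^o).
Proof.
apply: (@test_segment a (b + 1)).
- by apply: smoothM; exact: smooth_expinv_affine.
- move=> t ta; rewrite /bump expinv0 ?mul0r// mulNr -mulrBr mulr_ge0_le0//.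
  by rewrite subr_le0 ltW.
- move=> t bt; rewrite /bump [X in _ * X]expinv0 ?mulr0//.
  have -> : - (n%:R * n%:R) * t + n%:R * (n%:R * b + 1) = n%:R * (n%:R * (b - t) + 1) by ring.
  case: n => [|n]; first by rewrite !mul0r.
  apply: mulr_ge0_le0 => //; have : (1 : R) <= n.+1%:R by rewrite ler1n.
  by move: bt; move: n.+1%:R => m; nra.
Qed.

Lemma bump_ge0 a b n t : 0 <= bump a b n t.
Proof. by rewrite mulr_ge0// expinv_ge0. Qed.

Lemma bump_le a b n t : bump a b n t <= \1_(`]a, (b + 1)]) t.
Proof.
rewrite indicE; case: (boolP (t \in _)) => [_|].
  by rewrite mulr_ile1// ?expinv_ge0// expinv_le1.
move=> /negP tab; have [ta|at_] := leP t a.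
  by rewrite /bump expinv0 ?mul0r// mulNr -mulrBr mulr_ge0_le0// subr_le0.
have [tb|bt] := leP t (b + 1).
  by case: tab; apply/mem_set; rewrite /= in_itv/= at_.
rewrite /bump [X in _ * X]expinv0 ?mulr0//.
have -> : - (n%:R * n%:R) * t + n%:R * (n%:R * b + 1) = n%:R * (n%:R * (b - t) + 1) by ring.
case: n => [|n]; first by rewrite !mul0r.
apply: mulr_ge0_le0 => //; have : (1 : R) <= n.+1%:R by rewrite ler1n.
  by move: bt; move: n.+1%:R => m; nra.
Qed.

(** The argument of the second factor is n (n (b - t) + 1): at least n for t <= b, so that b itself
    is included, and eventually negative for t > b. *)
Lemma cvg_bump a b t : (fun n => bump a b n t) @ \oo --> (\1_(`]a, b]) t : R).
Proof.
have argE n : - (n%:R * n%:R) * t + n%:R * (n%:R * b + 1) =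
  n%:R * (n%:R * (b - t) + 1) :> R by ring.
have c1 := @cvg_expinv (t - a).
have c2 : (fun n : nat => expinv (- (n%:R * n%:R) * t + n%:R * (n%:R * b + 1))) @ \oo -->
    (if t <= b then 1 else 0 : R).
  case: ifPn => [tb|]; last first.
    rewrite -ltNge => bt; apply: cvg_near_cst; near=> n; rewrite argE expinv0//.
    have tb : 0 < t - b by rewrite subr_gt0.
    have : (t - b)^-1 <= n%:R by near: n; exact: nbhs_infty_ger.
    rewrite -(ler_pM2r tb) mulVf ?gt_eqF// => h.
    apply: mulr_ge0_le0 => //; lra.
  apply: (@squeeze_cvgr _ _ _ _ (fun n : nat => expinv (n%:R * 1)) (cst 1)).
  - apply: nearW => n; rewrite expinv_le1 andbT argE le_expinv// ler_wpM2l//.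
    by rewrite lerDr mulr_ge0// subr_ge0.
  - by have := @cvg_expinv 1; rewrite ltr01.
  - exact: cvg_cst.
have -> : \1_(`]a, b]) t = (if 0 < t - a then 1 else 0) * (if t <= b then 1 else 0) :> R.
  rewrite indicE subr_gt0; case: (ltP a t) => [at_|ta]; last first.
    rewrite mul0r (negbTE (_ : t \notin _))//; apply/negP; rewrite inE /= in_itv/=.
    by rewrite ltNge ta.
  case: (leP t b) => [tb|bt]; last first.
    rewrite mulr0 (negbTE (_ : t \notin _))//; apply/negP; rewrite inE /= in_itv/=.
    by rewrite [t <= b]leNgt bt andbF.
  by rewrite mulr1 mem_set//= in_itv/= at_.
apply: (eq_cvg_to (cvgM c1 c2)) => // n.
rewrite /bump -[LHS]/(expinv (n%:R * (t - a)) * _).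
by congr (expinv _ * _); ring.
Unshelve. all: by end_near. Qed.

End smooth.

(** * Density of test functions in L^2 of the line and of the plane *)

Section plane.
Context (R : realType).
Local Notation leb := (@leb R).
Local Notation leb2 := (@leb2 R).
Local Notation R1 := (measurableTypeR R).
Local Notation R2 := (measurableTypeR R * measurableTypeR R)%type.
Local Notation e1 := (@e1 R).
Local Notation e2 := (@e2 R).
Local Notation L2 := (Lfun leb2 2%:E).
Local Notation ip2 := (ip leb2).

Definition boxes : set (set R2) :=
  [set A `*` B | A in (@ocitv R : set (set R1)) & B in (@ocitv R : set (set R1))].

Lemma ocitv_measurable (A : set R1) : ocitv A -> measurable A.
Proof. by move=> oA; exact: sub_sigma_algebra. Qed.

Lemma bigcup_ocitv : \bigcup_n (`](- n%:R), n%:R]%classic : set R) = setT.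
Proof.
rewrite -subTset => x _; have [n _ Hn] := nbhs_infty_gtr `|x|.
exists n => //=; rewrite in_itv/=; have := Hn n (leqnn n).
by rewrite /= ltr_norml => /andP[-> /ltW].
Qed.

(** A strip over a half-open interval is a countable union of boxes, so both projections are
    measurable for the sigma-algebra generated by the boxes. *)
Lemma measurable_boxes : (measurable : set (set R2)) = <<s boxes >>.
Proof.
rewrite eqEsubset; split; last first.
  apply: smallest_sub; first exact: sigma_algebra_measurable.
  move=> _ [A oA] [B oB] <-.
  by apply: measurableX; exact: ocitv_measurable.
apply: smallest_sub; first exact: smallest_sigma_algebra.
pose T0 := g_sigma_algebraType boxes.
have mfst : measurable_fun (setT : set T0) (fst : T0 -> R1).
  suff : preimage_set_system (setT : set T0) (fst : T0 -> R1) (@ocitv R) `<=` measurable.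
    exact: (@measurability _ _ T0 R1 setT fst (@ocitv R)).
  move=> _ [A oA <-]; rewrite setTI.
  rewrite (_ : fst @^-1` A = \bigcup_n (A `*` `](- n%:R), n%:R]%classic)).
    apply: bigcupT_measurable => n; apply: sub_sigma_algebra.
    by exists A => //; exists `](- n%:R), n%:R]%classic => //; exact: is_ocitv.
  by rewrite -setX_bigcupr bigcup_ocitv; apply/seteqP; split => [x|x []].
have msnd : measurable_fun (setT : set T0) (snd : T0 -> R1).
  suff : preimage_set_system (setT : set T0) (snd : T0 -> R1) (@ocitv R) `<=` measurable.
    exact: (@measurability _ _ T0 R1 setT snd (@ocitv R)).
  move=> _ [A oA <-]; rewrite setTI.
  rewrite (_ : snd @^-1` A = \bigcup_n (`](- n%:R), n%:R]%classic `*` A)).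
    apply: bigcupT_measurable => n; apply: sub_sigma_algebra.
    by exists `](- n%:R), n%:R]%classic; [exact: is_ocitv|exists A].
  by rewrite -setX_bigcupl bigcup_ocitv; apply/seteqP; split => [x|x []].
rewrite subUset; split => _ [A mA <-].
- exact: mfst.
- exact: msnd.
Qed.

Lemma boxes_setI : setI_closed boxes.
Proof.
move=> _ _ [A oA] [B oB] <- [A' oA'] [B' oB'] <-.
rewrite -setXI; exists (A `&` A'); first exact: ocitvI.
by exists (B `&` B') => //; exact: ocitvI.
Qed.

Lemma leb_ocitv_lty (A : set R1) : ocitv A -> (leb A < +oo)%E.
Proof.
move=> [[a b] _ <-]; rewrite -[X in (X < _)%E]/(lebesgue_measure `]a, b]%classic).
by rewrite lebesgue_measure_itv/=; case: ifP; rewrite ?ltry.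
Qed.

Lemma leb2X (A B : set R1) : measurable A -> measurable B ->
  leb2 (A `*` B) = (leb A * leb B)%E.
Proof. by move=> mA mB; exact: (@product_measure1E _ _ _ _ _ leb leb). Qed.

Lemma indic_L2 d (T : measurableType d) (mu : {measure set T -> \bar R}) (A : set T) :
  measurable A -> (mu A < +oo)%E -> (\1_A : T -> R) \in Lfun mu 2%:E.
Proof.
move=> mA Aoo; apply/L2P; split => //.
rewrite (_ : (\int[mu]_x _ = \int[mu]_x (\1_A x)%:E)%E).
  by rewrite integral_indic// setIT.
apply: eq_integral => x _.
by rewrite indicE; case: (_ \in _); rewrite ?expr1n ?expr0n.
Qed.

(** The plane carries the product sigma-algebra, so an open set has to be written as a countable
    union of boxes with rational centres. *)
Lemma continuous_measurable2 (f : R * R -> R) : continuous f ->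
  measurable_fun setT (f : R2 -> R).
Proof.
move=> cf; apply: (measurability _ (RGenOpens.measurableE R)).
move=> _ [_ [a [b ->] <-]]; rewrite setTI.
have : open (f @^-1` `]a, b[) by apply: open_comp => // x _; exact: cf.
move: (f @^-1` _) => U oU.
pose box (q : (rat * rat) * nat) : set R2 :=
  `](ratr q.1.1 - q.2.+1%:R^-1), (ratr q.1.1 + q.2.+1%:R^-1)[%classic `*`
  `](ratr q.1.2 - q.2.+1%:R^-1), (ratr q.1.2 + q.2.+1%:R^-1)[%classic.
rewrite (_ : U = \bigcup_(q in [set q | box q `<=` U]) box q).
  rewrite bigcup_mkcond; apply: countable_bigcupT_measurable; first exact: countableP.
  by move=> q; case: ifP => // _; apply: measurableX; exact: measurable_itv.
apply/seteqP; split => [[x y] Uxy|x [q]]; last by move=> h; exact: h.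
have [e /= e0 exy] : nbhs_ball (x, y) U by apply/nbhs_ballP; exact: oU.
(* A radius r below e / 2: the rational centre is within r of (x, y), hence the whole box within 2
   r. *)
have [n _ Hn] := near_infty_natSinv_lt (PosNum (divr_gt0 e0 (ltr0Sn R 1))).
have := Hn n (leqnn n); rewrite /=; set r := n.+1%:R^-1 => re.
have r0 : 0 < r by rewrite invr_gt0.
have [p] := @rat_in_itvoo R (x - r) (x + r) ltac:(lra).
have [q] := @rat_in_itvoo R (y - r) (y + r) ltac:(lra).
rewrite !in_itv/= => /andP[q1 q2] /andP[p1 p2].
exists ((p, q), n).
  move=> [x' y'] [/=]; rewrite !in_itv/= -/r => /andP[x1 x2] /andP[y1 y2].
  by apply: exy; split; rewrite /ball/= ltr_norml; lra.
by split; rewrite /= in_itv/= -/r; lra.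
Qed.

Lemma prod_norm_ge (x : R * R) : `|x.1| <= `|x| /\ `|x.2| <= `|x|.
Proof. by rewrite [X in _ <= X /\ _]/Num.norm /= !le_max !lexx orbT. Qed.

Lemma L2_of_bounded_support d (T : measurableType d) (mu : {measure set T -> \bar R})
    (f : T -> R) (A : set T) (M : R) : measurable_fun setT f ->
  measurable A -> (mu A < +oo)%E -> (forall x, `|f x| <= M) ->
  (forall x, ~ A x -> f x = 0) -> f \in Lfun mu 2%:E.
Proof.
move=> mf mA Aoo fM fA; have h1 := L2Z M (indic_L2 mA Aoo).
apply: (L2_le mf h1) => x /=; rewrite indicE.
have [Ax|nAx] := pselect (A x).
  by rewrite mem_set// mulr1 (le_trans (fM x))// ler_norm.
by rewrite fA// normr0.
Qed.

Lemma test_L2_line (f : R -> R^o) : test_function setT f ->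
  (f : R1 -> R) \in Lfun leb 2%:E.
Proof.
move=> tf; have [M fM] := test_bounded tf.
have [r r0 fr] := test_compact_support tf.
(* The interval is open on the left, so it starts at -r - 1 in order to contain [-r, r]. *)
apply: (@L2_of_bounded_support _ _ leb _ (`](- r - 1), r]%classic : set R1) M) => //.
- by apply: continuous_measurable_fun; exact: smooth_continuous (test_smooth tf).
- by apply: leb_ocitv_lty; exact: is_ocitv.
- move=> x; apply: contra_notP => fx /=; rewrite in_itv/=.
  have : `|x| <= r by rewrite leNgt; apply/negP => /fr.
  by rewrite ler_norml; lra.
Qed.

Lemma box_lty (A B : set R1) : ocitv A -> ocitv B -> (leb2 (A `*` B) < +oo)%E.
Proof.
move=> oA oB; rewrite leb2X; [|exact: ocitv_measurable|exact: ocitv_measurable].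
have := leb_ocitv_lty oA; have := leb_ocitv_lty oB.
move=> Boo Aoo; rewrite lte_mul_pinfty// ge0_fin_numE//.
Qed.

Lemma measurable_box (A B : set R1) : ocitv A -> ocitv B ->
  measurable (A `*` B : set R2).
Proof. by move=> oA oB; apply: measurableX; exact: ocitv_measurable. Qed.

Lemma test_L2 (f : R * R -> R^o) : test_function setT f ->
  (f : R2 -> R) \in Lfun leb2 2%:E.
Proof.
move=> tf; have [M fM] := test_bounded tf.
have [r r0 fr] := test_compact_support tf.
pose I : set R1 := `](- r - 1), r]%classic.
apply: (@L2_of_bounded_support _ _ leb2 _ (I `*` I) M) => //.
- by apply: continuous_measurable2; exact: smooth_continuous (test_smooth tf).
- by apply: measurable_box; exact: is_ocitv.
- by apply: box_lty; exact: is_ocitv.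
- move=> x; apply: contra_notP => fx; rewrite /I /= !in_itv/=.
  have : `|x| <= r by rewrite leNgt; apply/negP => /fr.
  have [x1 x2] := prod_norm_ge x.
  move=> xr; have := le_trans x1 xr; have := le_trans x2 xr.
  by rewrite !ler_norml; lra.
Qed.

Lemma subspace_test_line :
  subspaceL2 leb (test_function setT : set (R -> R^o)).
Proof.
split; first exact: test_cst0.
- by move=> f; exact: test_L2_line.
- by move=> a f g; exact: test_lin.
Qed.

Lemma subspace_test : subspaceL2 leb2 (test_function setT : set (R * R -> R^o)).
Proof.
split; first exact: test_cst0.
- by move=> f; exact: test_L2.
- by move=> a f g; exact: test_lin.
Qed.

Lemma ocitv_L2 (a b : R) : (\1_(`]a, b]%classic) : R1 -> R) \in Lfun leb 2%:E.
Proof.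
by apply: indic_L2; [apply: ocitv_measurable; exact: is_ocitv|apply: leb_ocitv_lty; exact: is_ocitv].
Qed.

Lemma cvgL2_bump a b : cvgL2 leb (bump a b) (\1_(`]a, b]%classic : set R1)).
Proof.
apply: (@cvgL2_dominated _ R1 _ leb (bump a b) _ (\1_(`]a, (b + 1)]%classic : set R1))).
- by move=> n; apply: test_L2_line; exact: test_bump.
- exact: ocitv_L2.
- exact: ocitv_L2.
- by move=> x; exact: cvg_bump.
- by move=> n x; rewrite (ger0_norm (bump_ge0 _ _ _ _)) (le_trans (bump_le _ _ _ _))// ler_norm.
Qed.

Lemma dense_test_line : denseL2 leb (test_function setT : set (R -> R^o)).
Proof.
apply: (@dense_pi_system _ _ _ leb _ (@ocitv R) (fun n => `](- n%:R), n%:R]%classic)).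
- exact: subspace_test_line.
- by [].
- exact: ocitvI.
- by move=> n; exact: is_ocitv.
- exact: bigcup_ocitv.
move=> A oA; split.
  by apply: indic_L2; [exact: ocitv_measurable|exact: leb_ocitv_lty].
case: oA => -[a b] _ <-; exists (bump a b : nat -> R -> R) => /=.
  by move=> n; exact: test_bump.
exact: cvgL2_bump.
Qed.

Lemma indicX (A B : set R) (x : R2) : \1_(A `*` B) x = \1_A x.1 * \1_B x.2 :> R.
Proof.
rewrite !indicE; have [Ax|nA] := pselect (A x.1); have [Bx|nB] := pselect (B x.2).
- by rewrite !mem_set// mulr1.
- by rewrite (memNset nB) mulr0 memNset// => -[].
- by rewrite (memNset nA) mul0r memNset// => -[].
- by rewrite (memNset nA) mul0r memNset// => -[].
Qed.

Lemma test_bump2 a b a' b' n :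
  test_function setT (fun x : R * R => bump a b n x.1 * bump a' b' n x.2 : R^o).
Proof. by apply: test_subset (test_tensor (test_bump a b n) (test_bump a' b' n)). Qed.

Lemma dense_test : denseL2 leb2 (test_function setT : set (R * R -> R^o)).
Proof.
pose I n : set R1 := `](- n%:R), n%:R]%classic.
apply: (@dense_pi_system _ _ _ leb2 _ boxes (fun n => I n `*` I n)).
- exact: subspace_test.
- exact: measurable_boxes.
- exact: boxes_setI.
- by move=> n; exists (I n); [exact: is_ocitv|exists (I n) => //; exact: is_ocitv].
- rewrite -subTset => -[x y] _.
  have : [set: R] (Num.max `|x| `|y|) by [].
  have [n _ Hn] := nbhs_infty_gtr (Num.max `|x| `|y|).
  have := Hn n (leqnn n); rewrite /= gt_max !ltr_norml => /andP[/andP[x1 x2] /andP[y1 y2]] _.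
  by exists n => //; split; rewrite /I /= in_itv/=; apply/andP; split => //; exact: ltW.
move=> _ [A oA] [B oB] <-; split.
  by apply: indic_L2; [exact: measurable_box|exact: box_lty].
case: oA => -[a b] _ <-; case: oB => -[a' b'] _ <- /=.
exists (fun n (x : R2) => bump a b n x.1 * bump a' b' n x.2).
  by move=> n; exact: test_bump2.
pose J : set R2 := `]a, (b + 1)]%classic `*` `]a', (b' + 1)]%classic.
apply: (@cvgL2_dominated _ R2 _ leb2 _ _ (\1_J)).
- by move=> n; apply: test_L2; exact: test_bump2.
- by apply: indic_L2; [apply: measurable_box; exact: is_ocitv|apply: box_lty; exact: is_ocitv].
- by apply: indic_L2; [apply: measurable_box; exact: is_ocitv|apply: box_lty; exact: is_ocitv].
- by move=> x; rewrite indicX; apply: cvgM; exact: cvg_bump.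
- move=> n x; rewrite indicX ger0_norm; last by apply: mulr_ge0; exact: bump_ge0.
  by apply: le_trans (ler_norm _); apply: ler_pM; rewrite ?bump_ge0 ?bump_le.
Qed.

Lemma pairr_continuous (y : R) : continuous (fun t : R => (t, y)).
Proof.
move=> u; apply: (@cvg_pair _ _ _ (nbhs u) (nbhs u) (nbhs y) _ _ _ id (cst y)).
  exact: cvg_id.
exact: cvg_cst.
Qed.

Lemma pair_continuous (x : R) : continuous (fun t : R => (x, t)).
Proof.
move=> u; apply: (@cvg_pair _ _ _ (nbhs u) (nbhs x) (nbhs u) _ _ _ (cst x) id).
  exact: cvg_cst.
exact: cvg_id.
Qed.

(** * Half-planes and Green's formula for test functions *)

Definition halfline (s : R) : set R := [set y | 0 < s * y].
(* The upper side of the axis for s = 1, the lower one for s = -1. *)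
Definition side (s : R) : set (R * R) := [set x | 0 < s * x.2].

Lemma upperE : upper = side 1.
Proof. by apply/seteqP; split => x; rewrite /upper /side /= mul1r. Qed.

Lemma lowerE : lower = side (-1).
Proof. by apply/seteqP; split => x; rewrite /lower /side /= mulN1r oppr_gt0. Qed.

Lemma measurable_halfline s : measurable (halfline s : set R1).
Proof.
have -> : halfline s = setT `&` (fun y => s * y) @^-1` `]0, +oo[%classic.
  by rewrite setTI; apply/seteqP; split => y; rewrite /halfline /= in_itv/= andbT.
exact: (@measurable_funM _ R1 R setT (cst s) id).
Qed.

Lemma sideE s : side s = setT `*` halfline s.
Proof. by apply/seteqP; split => [x h|x []//]; split. Qed.

Lemma measurable_side s : measurable (side s : set R2).
Proof. by rewrite sideE; apply: measurableX => //; exact: measurable_halfline. Qed.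

Lemma indic_side s (x : R2) : \1_(side s) x = \1_(halfline s) x.2 :> R.
Proof. by rewrite sideE indicX indicT mul1r. Qed.

Lemma integral_derive_segment (f g : R -> R) (a b : R) : a < b ->
  (forall t, is_derive (t : R) (1 : R) (f : R -> R^o) (g t)) -> continuous g ->
  (\int[leb]_(t in `[a, b]) (g t)%:E = (f b - f a)%:E)%E.
Proof.
move=> ab fg cg; have df t : derivable (f : R -> R^o) t 1 by [].
have cf : continuous f.
  by move=> t; apply: differentiable_continuous; exact/derivable1_diffP.
rewrite (@continuous_FTC2 _ g f a b ab) ?EFinB//.
- exact: continuous_subspaceT.
- split => //.
  + by apply: cvg_at_right_filter; exact: cf.
  + by apply: cvg_at_left_filter; exact: cf.
- by move=> t _; rewrite derive1E derive_val.
Qed.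

Lemma integral_mul_indic (g : R -> R) (A B : set R) :
  (forall t, B t -> ~ A t -> g t = 0) -> A `<=` B ->
  (\int[leb]_t (g t * \1_B t)%:E = \int[leb]_(t in A) (g t)%:E)%E.
Proof.
move=> gAB AB; rewrite [RHS]integral_mkcond; apply: eq_integral => t _.
rewrite patchE indicE; case: ifPn => [/set_mem At|/negP nA].
  by rewrite mem_set ?mulr1//; exact: AB.
have {}nA : ~ A t by move=> h; apply: nA; exact: mem_set.
case: (boolP (t \in B)) => [/set_mem Bt|_]; last by rewrite mulr0.
by rewrite gAB// mul0r.
Qed.

Section compact_support.
Context (f g : R -> R) (r : R)
  (r0 : 0 < r) (fg : forall t, is_derive (t : R) (1 : R) (f : R -> R^o) (g t))
  (cg : continuous g) (fr : forall t, r < `|t| -> f t = 0)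
  (gr : forall t, r < `|t| -> g t = 0).

Lemma integral_derive_line : (\int[leb]_t (g t)%:E = 0)%E.
Proof.
have r0' := r0.
have r1 : - (r + 1) < r + 1 by lra.
have := integral_derive_segment r1 fg cg.
have -> : f (r + 1) = 0 by apply: fr; rewrite ger0_norm; lra.
have -> : f (- (r + 1)) = 0 by apply: fr; rewrite normrN ger0_norm; lra.
rewrite subr0 -[0%:E]/0%E => i0; rewrite -[RHS]i0 -[RHS](@integral_mul_indic _ _ setT)//.
  by apply: eq_integral => t _; rewrite indicT mulr1.
move=> t _ nt; apply: gr; rewrite ltNge; apply/negP => tr; apply: nt.
by rewrite /= in_itv/=; move: tr; rewrite ler_norml; lra.
Qed.

(** The point 0 is the lower end of the half-line for s = 1 and its upper end for s = -1, whence the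
    factor -s. *)
Lemma integral_derive_halfline (s : R) : s = 1 \/ s = -1 ->
  (\int[leb]_t (g t * \1_(halfline s) t)%:E = (- s * f 0)%:E)%E.
Proof.
have r0' := r0.
have gab (t : R) : ~ (- (r + 1) <= t <= r + 1) -> g t = 0.
  move=> nt; apply: gr; rewrite ltNge; apply/negP => tr; apply: nt.
  by move: tr; rewrite ler_norml; lra.
case=> ->.
- rewrite (@integral_mul_indic _ `]0, (r + 1)]%classic).
  + rewrite integral_itv_obnd_cbnd; last first.
      apply/measurable_EFinP; apply: measurable_funTS.
      exact: continuous_measurable_fun.
    rewrite (integral_derive_segment _ fg cg); last lra.
    have -> : f (r + 1) = 0 by apply: fr; rewrite ger0_norm; lra.
    by rewrite sub0r mulN1r.
  + move=> t; rewrite /halfline /= mul1r in_itv/= => t0 nt; apply: gab => ht.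
    by apply: nt; lra.
  + by move=> t; rewrite /halfline /= in_itv/= mul1r => /andP[].
- rewrite (@integral_mul_indic _ `[- (r + 1), 0[%classic).
  + rewrite integral_itv_bndo_bndc; last first.
      apply/measurable_EFinP; apply: measurable_funTS.
      exact: continuous_measurable_fun.
    rewrite (integral_derive_segment _ fg cg); last lra.
    have -> : f (- (r + 1)) = 0 by apply: fr; rewrite normrN ger0_norm; lra.
    by rewrite subr0 opprK mul1r.
  + move=> t; rewrite /halfline /= mulN1r oppr_gt0 in_itv/= => t0 nt; apply: gab => ht.
    by apply: nt; lra.
  + by move=> t; rewrite /halfline /= in_itv/= mulN1r oppr_gt0 => /andP[].
Qed.

End compact_support.

Lemma is_derive_section2 (F : R * R -> R^o) (x t : R) :
  (forall p v, derivable F p v) ->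
  is_derive t (1 : R) (fun t => F (x, t) : R^o) ('D_e2 F (x, t)).
Proof.
move=> sF; have hl : @linear_fun R R (R * R)%type (fun t => (0, t)).
  by move=> a y z; congr (_, _); rewrite /= scaler0 addr0.
have E : (fun t => F (x, t)) = (fun t => F ((0, t) + (x, 0))).
  by apply/funext => u; congr F; congr (_, _); rewrite /= ?add0r ?addr0.
apply: DeriveDef.
  by rewrite E; apply: (@derivable_affine _ _ _ (fun t => (0, t))).
rewrite E; transitivity ('D_(0, 1) F ((0, t) + (x, 0))).
  by rewrite /derive -(affine_quotient (x, 0) F t 1 hl).
by congr ('D_ _ F _); congr (_, _); rewrite /= ?add0r ?addr0.
Qed.

Lemma is_derive_section1 (F : R * R -> R^o) (t y : R) :
  (forall p v, derivable F p v) ->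
  is_derive t (1 : R) (fun t => F (t, y) : R^o) ('D_e1 F (t, y)).
Proof.
move=> sF; have hl : @linear_fun R R (R * R)%type (fun t => (t, 0)).
  by move=> a u z; congr (_, _); rewrite /= scaler0 addr0.
have E : (fun t => F (t, y)) = (fun t => F ((t, 0) + (0, y))).
  by apply/funext => u; congr F; congr (_, _); rewrite /= ?add0r ?addr0.
apply: DeriveDef.
  by rewrite E; apply: (@derivable_affine _ _ _ (fun t => (t, 0))).
rewrite E; transitivity ('D_(1, 0) F ((t, 0) + (0, y))).
  by rewrite /derive -(affine_quotient (0, y) F t 1 hl).
by congr ('D_ _ F _); congr (_, _); rewrite /= ?add0r ?addr0.
Qed.

Lemma L2_support_integrable d (T : measurableType d) (mu : {measure set T -> \bar R})
    (f : T -> R) (A : set T) : f \in Lfun mu 2%:E -> measurable A -> (mu A < +oo)%E ->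
  (forall x, ~ A x -> f x = 0) -> mu.-integrable setT (EFin \o f).
Proof.
move=> hf mA Aoo fA; have := ip_integrable hf (indic_L2 mA Aoo).
congr (_.-integrable _ _); apply/funext => x /=; rewrite indicE.
have [Ax|nA] := pselect (A x); first by rewrite mem_set// mulr1.
by rewrite fA// mul0r.
Qed.

Lemma test_indic_integrable (F : R * R -> R^o) (A : set R2) : test_function setT F ->
  measurable A -> leb2.-integrable setT (EFin \o (fun x : R2 => F x * \1_A x)).
Proof.
move=> tF mA; have [r r0 Fr] := test_compact_support tF.
pose I : set R1 := `](- r - 1), r]%classic.
apply: (@L2_support_integrable _ R2 leb2 _ (I `*` I)).
- apply: (L2M_bounded (M := 1) (test_L2 tF)) => // x.
  by rewrite indicE; case: (_ \in _); rewrite ?normr1 ?normr0.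
- by apply: measurable_box; exact: is_ocitv.
- by apply: box_lty; exact: is_ocitv.
- move=> x nx; rewrite (Fr x) ?mul0r// ltNge; apply/negP => xr; apply: nx.
  have [x1 x2] := prod_norm_ge x.
  have := le_trans x1 xr; have := le_trans x2 xr.
  by rewrite !ler_norml /I /= !in_itv/=; lra.
Qed.

Lemma fubini_eval12 (f : R2 -> R) (h : R1 -> R) :
  leb2.-integrable setT (EFin \o f) ->
  (forall x, \int[leb]_y (f (x, y))%:E = (h x)%:E)%E ->
  \int[leb2]_x f x = \int[leb]_x h x.
Proof.
move=> hf fh; rewrite /Rintegral; congr fine.
rewrite -[LHS](@integral12_prod_meas1 _ _ _ _ _ leb leb _ hf).
by apply: eq_integral => x _; rewrite -fh.
Qed.

Lemma fubini_eval21 (f : R2 -> R) (h : R1 -> R) :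
  leb2.-integrable setT (EFin \o f) ->
  (forall y, \int[leb]_x (f (x, y))%:E = (h y)%:E)%E ->
  \int[leb2]_x f x = \int[leb]_y h y.
Proof.
move=> hf fh; rewrite /Rintegral; congr fine.
rewrite -[LHS](@integral21_prod_meas1 _ _ _ _ _ leb leb _ hf).
by apply: eq_integral => y _; rewrite -fh.
Qed.

Lemma test_trace (F : R * R -> R^o) : test_function setT F ->
  test_function setT (fun x => F (x, 0) : R^o).
Proof.
move=> tF; have sF := test_smooth tF; have [r r0 Fr] := test_compact_support tF.
apply: (@test_segment _ (- r) r).
- have := @smooth_affine _ R (R * R)%type (fun t => (t, 0)) 0 F.
  rewrite (_ : (fun x => F ((x, 0) + 0)) = (fun x => F (x, 0))); last first.
    by apply/funext => x; rewrite addr0.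
  apply => //; last exact: pairr_continuous.
  by move=> a u z; congr (_, _); rewrite /= scaler0 addr0.
- move=> t tr; apply: Fr; have [/= + _] := prod_norm_ge (t, 0); apply: lt_le_trans.
  by rewrite ltr_normr; lra.
- move=> t tr; apply: Fr; have [/= + _] := prod_norm_ge (t, 0); apply: lt_le_trans.
  by rewrite ltr_normr; lra.
Qed.

Lemma test_integrable_line (f : R -> R^o) : test_function setT f ->
  leb.-integrable setT (EFin \o (f : R1 -> R)).
Proof.
move=> tf; have [r r0 fr] := test_compact_support tf.
apply: (@L2_support_integrable _ R1 leb _ `](- r - 1), r]%classic).
- exact: test_L2_line.
- by apply: ocitv_measurable; exact: is_ocitv.
- by apply: leb_ocitv_lty; exact: is_ocitv.
- move=> t nt; apply: fr; rewrite ltNge; apply/negP => tr; apply: nt.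
  by move: tr; rewrite /= in_itv/= ler_norml; lra.
Qed.

(** Fubini with the vertical variable inside: each vertical line meets the side in a half-line,
    whose end contributes the value on the axis. *)
Lemma green2 (F : R * R -> R^o) (s : R) : s = 1 \/ s = -1 -> test_function setT F ->
  \int[leb2]_x ('D_e2 F x * \1_(side s) x) = - s * \int[leb]_x F (x, 0).
Proof.
move=> hs tF; have sF := test_smooth tF.
have tD := test_derive e2 tF.
have [r r0 Fr] := test_compact_support tF.
have [q q0 Dq] := test_compact_support tD.
have far (x t : R) : r + q < `|t| -> F (x, t) = 0 /\ 'D_e2 F (x, t) = 0.
  move=> tr; have [_ /= ht] := prod_norm_ge (x, t).
  by split; [apply: Fr|apply: Dq]; lra.
rewrite (@fubini_eval12 _ (fun x => - s * F (x, 0))).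
- by rewrite RintegralZl//; exact/test_integrable_line/test_trace.
- by apply: test_indic_integrable => //; exact: measurable_side.
- move=> x; under eq_integral do rewrite indic_side.
  apply: (@integral_derive_halfline (fun t => F (x, t)) (fun t => 'D_e2 F (x, t)) (r + q)) => //.
  + by rewrite addr_gt0.
  + by move=> t; apply: is_derive_section2 => p v; exact: smooth_derivable.
  + move=> t; apply: (@continuous_comp _ _ _ (fun t => (x, t)) ('D_e2 F)); last first.
      by apply: smooth_continuous; exact: test_smooth tD.
    exact: pair_continuous.
  + by move=> t /(far x)[].
  + by move=> t /(far x)[].
Qed.

(** A horizontal line lies wholly inside or wholly outside the side, so integrating horizontally
    first leaves no boundary term. *)
Lemma green1 (F : R * R -> R^o) (s : R) : test_function setT F ->
  \int[leb2]_x ('D_e1 F x * \1_(side s) x) = 0.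
Proof.
move=> tF; have sF := test_smooth tF.
have tD := test_derive e1 tF.
have [r r0 Fr] := test_compact_support tF.
have [q q0 Dq] := test_compact_support tD.
have far (x t : R) : r + q < `|t| -> F (t, x) = 0 /\ 'D_e1 F (t, x) = 0.
  move=> tr; have [/= ht _] := prod_norm_ge (t, x).
  by split; [apply: Fr|apply: Dq]; lra.
rewrite (@fubini_eval21 _ (fun=> 0)).
- by rewrite Rintegral_cst// mul0r.
- by apply: test_indic_integrable => //; exact: measurable_side.
- move=> y; under eq_integral do rewrite indic_side.
  rewrite (_ : (fun x => _) = (fun x : R => (\1_(halfline s) y * 'D_e1 F (x, y))%:E)); last first.
    by apply/funext => x; rewrite mulrC.
  under eq_integral do rewrite EFinM.
  have sec0 : (\int[leb]_x ('D_e1 F (x, y))%:E = 0)%E.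
    apply: (@integral_derive_line (fun x => F (x, y)) _ (r + q)) => //.
    + by rewrite addr_gt0.
    + by move=> t; apply: is_derive_section1 => p v; exact: smooth_derivable.
    + move=> t; apply: (@continuous_comp _ _ _ (fun t => (t, y)) ('D_e1 F)).
        exact: pairr_continuous.
      by apply: smooth_continuous; exact: test_smooth tD.
    + by move=> t /(far y)[].
    + by move=> t /(far y)[].
  rewrite indicE; case: (_ \in _) => /=.
    by under eq_integral do rewrite mul1e.
  by under eq_integral do rewrite mul0e; rewrite integral0.
Qed.

Lemma ae_slit_plane : {ae leb2, forall x : R2, @slit_plane R x}.
Proof.
exists (setT `*` [set (0 : R)] : set R2); split.
- by apply: measurableX => //; exact: measurable_set1.
- by rewrite leb2X//= /Defs.leb lebesgue_measure_set1 mule0.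
- move=> [x y] /= nxy; split => //=; apply: contrapT => /eqP y0; apply: nxy.
  rewrite /slit_plane /upper /lower /=.
  by move: y0; rewrite neq_lt => /orP[|]; [right|left].
Qed.

Lemma indic_slit_plane (x : R2) :
  \1_(@slit_plane R) x = \1_(side 1) x + \1_(side (-1)) x :> R.
Proof.
rewrite /slit_plane upperE lowerE !indicE in_setU.
have [h1|h1] := pselect (side 1 x).
  rewrite (mem_set h1) memNset ?addr0// /side /= => h2.
  by move: h1 h2; rewrite /side /= mul1r mulN1r; lra.
by rewrite (memNset h1) add0r.
Qed.

Lemma measurable_slit_plane : measurable (@slit_plane R : set R2).
Proof.
by rewrite /slit_plane upperE lowerE; apply: measurableU; exact: measurable_side.
Qed.

(** Up to the axis the plane is the union of its two sides, and their boundary terms cancel. *)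
Lemma test_integral_derive (F : R * R -> R^o) (v : R * R) : v = e1 \/ v = e2 ->
  test_function setT F -> \int[leb2]_x ('D_v F x) = 0.
Proof.
move=> hv tF; have tD := test_derive v tF.
have mhalf s := measurable_side s.
have iD s : leb2.-integrable setT (EFin \o (fun x : R2 => 'D_v F x * \1_(side s) x)).
  exact: test_indic_integrable.
have -> : \int[leb2]_x ('D_v F x) =
    \int[leb2]_x ('D_v F x * \1_(side 1) x + 'D_v F x * \1_(side (-1)) x).
  congr fine; apply: ae_eq_integral => //.
  - by apply/measurable_EFinP; apply: L2_measurable; exact: test_L2.
  - apply/measurable_EFinP; apply: measurable_funD; apply: measurable_funM => //;
    by apply: L2_measurable; exact: test_L2.
  - apply: ae_mono ae_slit_plane => x slx _.
    by rewrite -mulrDr -indic_slit_plane indicE mem_set// mulr1.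
rewrite RintegralD//; case: hv => hv; rewrite {}hv.
  by rewrite !green1// addr0.
by rewrite !green2//; [ring|right|left].
Qed.

Lemma deriveM_test (f g : R * R -> R^o) v x : smooth f -> smooth g ->
  'D_v (fun y => f y * g y : R^o) x = f x * 'D_v g x + g x * 'D_v f x.
Proof. by move=> sf sg; apply: deriveM; exact: smooth_derivable. Qed.

Lemma test_ibp (f g : R * R -> R^o) v : v = e1 \/ v = e2 ->
  test_function setT f -> test_function setT g ->
  ip leb2 f ('D_v g) = - ip leb2 ('D_v f) g.
Proof.
move=> hv tf tg; have := test_integral_derive hv (testM tf (test_smooth tg)).
under eq_Rintegral do rewrite (deriveM_test _ _ (test_smooth tf) (test_smooth tg)) [X in _ + X]mulrC.
rewrite RintegralD//; [|apply: ip_integrable|apply: ip_integrable].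
- by move=> /eqP; rewrite addr_eq0 => /eqP.
- exact: test_L2.
- by apply: test_L2; exact: test_derive.
- by apply: test_L2; exact: test_derive.
- exact: test_L2.
Qed.

(** Multiplying by the indicator turns integrals over W into scalar products on the whole plane. *)
Definition restr (W : set (R * R)) (f : R * R -> R) : R * R -> R :=
  fun x => f x * \1_W x.

Lemma patch_restr (W : set (R * R)) (f : R * R -> R) : f \_ W = restr W f.
Proof.
apply/funext => x; rewrite patchE /restr indicE.
by case: ifP; rewrite ?mulr1 ?mulr0.
Qed.

Lemma restr_L2 (W : set R2) (f : R2 -> R) : measurable W ->
  f \in Lfun leb2 2%:E -> restr W f \in Lfun leb2 2%:E.
Proof.
move=> mW hf; apply: (L2M_bounded (M := 1) hf) => // x.
by rewrite indicE; case: (_ \in _); rewrite ?normr1 ?normr0.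
Qed.

Lemma test_green2 (f g : R * R -> R^o) (s : R) : s = 1 \/ s = -1 ->
  test_function setT f -> test_function setT g ->
  ip leb2 (restr (side s) f) ('D_e2 g) = - ip leb2 (restr (side s) ('D_e2 f)) g
   - s * ip leb (fun x => f (x, 0)) (fun x => g (x, 0)).
Proof.
move=> hs tf tg; have := green2 hs (testM tf (test_smooth tg)).
have hf := test_L2 tf; have hg := test_L2 tg.
have hDf := test_L2 (test_derive e2 tf); have hDg := test_L2 (test_derive e2 tg).
have mh := measurable_side s.
rewrite mulNr => <-.
rewrite (@eq_Rintegral _ _ _ leb2 _ (fun x => restr (side s) f x * 'D_e2 g x +
    restr (side s) ('D_e2 f) x * g x)); last first.
  move=> x _; rewrite (deriveM_test _ _ (test_smooth tf) (test_smooth tg)) /restr; ring.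
rewrite RintegralD//; [by rewrite /ip; ring| |];
  by apply: ip_integrable => //; exact: restr_L2.
Qed.

(** Green's formula for f against itself expresses |f(., 0)|^2 as -2 times the pairing of f and
    ['D_e2 f] on the upper side. The inequality is the continuity of the trace. *)
Lemma test_trace_ineq (f : R * R -> R^o) : test_function setT f ->
  ip leb (fun x => f (x, 0)) (fun x => f (x, 0)) <=
  ip leb2 f f + ip leb2 ('D_e2 f) ('D_e2 f).
Proof.
move=> tf; have hf := test_L2 tf; have hDf := test_L2 (test_derive e2 tf).
have mh := measurable_side (1 : R).
have hrf := restr_L2 mh hf; have hrD := restr_L2 mh hDf.
have h1 : (1 : R) = 1 \/ (1 : R) = -1 by left.
have := test_green2 h1 tf tf; rewrite mul1r.
have -> : ip leb2 (restr (side 1) ('D_e2 f)) f = ip leb2 (restr (side 1) f) ('D_e2 f).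
  by apply: eq_Rintegral => x _; rewrite /restr; ring.
have := ip_ge0 leb2 (restr (side 1) f \+ 'D_e2 f).
rewrite ip_sqrD//.
have : ip leb2 (restr (side 1) f) (restr (side 1) f) <= ip leb2 f f.
  apply: ip_le => // x; rewrite /restr normrM indicE.
  by case: (_ \in _); rewrite ?normr1 ?normr0 ?mulr1 ?mulr0.
lra.
Qed.

(** * A kernel of mass 1 supported away from the origin *)

Lemma antiderivative (g : R -> R) (r : R) : continuous g ->
  leb.-integrable setT (EFin \o (g : R1 -> R)) ->
  (forall t, r < `|t| -> g t = 0) ->
  exists G : R -> R, [/\ forall t, is_derive (t : R) (1 : R) (G : R -> R^o) (g t),
    forall t, t < - r -> G t = 0 & forall t, r <= t -> G t = \int[leb]_x g x].
Proof.
move=> cg ig gr.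
pose G x := \int[leb]_(t in `]-oo, x]) g t.
have GE x : G x = \int[leb]_t (g t * \1_(`]-oo, x]%classic) t).
  rewrite /G Rintegral_mkcond; apply: eq_Rintegral => t _.
  by rewrite patchE indicE; case: ifP; rewrite ?mulr1 ?mulr0.
exists G; split=> [t|t tr|t tr].
- have tt : t < t + 1 by rewrite ltrDl.
  have ig' : leb.-integrable (`]-oo, (t + 1)]%classic : set R1) (EFin \o g).
    by apply: integrableS ig.
  have [dG G'] := @continuous_FTC1 R g -oo%O t (t + 1) tt ig' (ltNyr t) (cg t).
  by apply: DeriveDef; [exact: dG|rewrite -derive1E; exact: G'].
- rewrite GE (_ : (fun t0 => _) = cst 0) ?Rintegral_cst ?mul0r//.
  apply/funext => u /=; rewrite indicE; case: (boolP (u \in _)) => [/set_mem|_].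
    rewrite /= in_itv/= => ut; rewrite gr ?mul0r// ltr_normr.
    by apply/orP; right; lra.
  by rewrite mulr0.
- rewrite GE; apply: eq_Rintegral => u _; rewrite indicE.
  have [ur|ru] := leP u r.
    by rewrite mem_set ?mulr1//= in_itv/= (le_trans ur).
  by rewrite gr ?mul0r// (lt_le_trans ru)// ler_norm.
Qed.

(** Positive exactly on ]1, 2[, so that the kernel built from it stays away from 0. *)
Definition bump12 (t : R) : R := expinv (1 * t - 1) * expinv ((-1) * t + 2).

Lemma smooth_bump12 : smooth (bump12 : R -> R^o).
Proof. by apply: smoothM; exact: smooth_expinv_affine. Qed.

Lemma bump12_0 t : ~ (1 < t < 2) -> bump12 t = 0.
Proof.
move=> t12; have [t1|t1] := leP t 1.
  by rewrite /bump12 expinv0 ?mul0r//; lra.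
have [t2|t2] := leP 2 t.
  by rewrite /bump12 [X in _ * X]expinv0 ?mulr0//; lra.
by case: t12; rewrite t1.
Qed.

Lemma test_bump12 : test_function setT (bump12 : R -> R^o).
Proof.
apply: (@test_segment _ 1 2) => [|t t1|t t2]; first exact: smooth_bump12.
- by apply: bump12_0; lra.
- by apply: bump12_0; lra.
Qed.

(** The antiderivative [B] is kept with the kernel: the mass is an increment of [B], and remains so
    after an affine change of variable. *)
Lemma exists_kernel : exists (b B : R -> R),
  [/\ smooth (b : R -> R^o), forall t, 0 <= b t, forall t, ~ (1 < t < 2) -> b t = 0,
      forall t, is_derive (t : R) (1 : R) (B : R -> R^o) (b t) & B 2 - B 1 = 1].
Proof.
have cb : continuous bump12 := smooth_continuous smooth_bump12.
have far t : 2 < `|t| -> bump12 t = 0.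
  move=> h; apply: bump12_0 => /andP[h1 h2]; move: h.
  by rewrite ltNge ler_norml; lra.
have [B [dB _ _]] := antiderivative cb (test_integrable_line test_bump12) far.
(* By the mean value theorem this increment is a value of [bump12] inside ]1, 2[. *)
have K0 : 0 < B 2 - B 1.
  have cB : {within `[1, 2], continuous B}.
    apply: continuous_subspaceT => t; apply: (@differentiable_continuous _ R R^o).
    exact/derivable1_diffP.
  have l12 : 1 < 2 :> R by lra.
  have [c] := @MVT R B bump12 1 2 l12 (fun t _ => dB t) cB.
  rewrite in_itv/= => /andP[c1 c2] ->; apply: mulr_gt0; last by rewrite subr_gt0.
  by apply: mulr_gt0; apply: expinv_gt0; lra.
set K := B 2 - B 1 in K0; exists (fun t => K^-1 * bump12 t), (fun t => K^-1 * B t).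
split.
- by apply: smoothZ; exact: smooth_bump12.
- by move=> t; rewrite mulr_ge0 ?invr_ge0 ?(ltW K0)// mulr_ge0 ?expinv_ge0.
- by move=> t /bump12_0 ->; rewrite mulr0.
- move=> t; exact: (is_deriveZ K^-1 (dB t)).
- by rewrite -mulrBr -/K mulVf// gt_eqF.
Qed.

Definition kernel1 : R -> R := projT1 (cid exists_kernel).

Lemma kernel1P : exists B : R -> R,
  [/\ smooth (kernel1 : R -> R^o), forall t, 0 <= kernel1 t,
      forall t, ~ (1 < t < 2) -> kernel1 t = 0,
      forall t, is_derive (t : R) (1 : R) (B : R -> R^o) (kernel1 t) & B 2 - B 1 = 1].
Proof. by rewrite /kernel1; case: cid. Qed.

(** [B] composed with the affine map gives an explicit antiderivative, so the fundamental theorem of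
    calculus yields the mass. A negative [a] reverses the ends, hence [Num.sg a] and the ordered
    pair [lo], [hi]. *)
Lemma integral_kernel1 (a c : R) : a != 0 ->
  (\int[leb]_t (`|a| * kernel1 (a * t + c))%:E = 1)%E.
Proof.
move=> a0; have [B [sb b0 bz dB BK]] := kernel1P.
pose lo := Num.min ((1 - c) / a) ((2 - c) / a).
pose hi := Num.max ((1 - c) / a) ((2 - c) / a).
have lohi : lo < hi /\ (0 < a -> lo = (1 - c) / a /\ hi = (2 - c) / a) /\
    (a < 0 -> lo = (2 - c) / a /\ hi = (1 - c) / a).
  rewrite /lo /hi; have [ap|an] := ltP 0 a.
    have h : (1 - c) / a < (2 - c) / a by rewrite ltr_pM2r ?invr_gt0//; lra.
    by rewrite (min_idPl (ltW h)) (max_idPr (ltW h)); split=> //; split=> //; lra.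
  have {an} an : a < 0 by rewrite lt_neqAle a0.
  have h : (2 - c) / a < (1 - c) / a by rewrite ltr_nM2r ?invr_lt0//; lra.
  by rewrite (min_idPr (ltW h)) (max_idPl (ltW h)); split=> //; split=> //; lra.
have aff (t : R) : is_derive t (1 : R) (fun t : R => a * t + c : R^o) a.
  have h1 := is_deriveZ a (is_derive_id t (1 : R)).
  have h2 := is_deriveD h1 (is_derive_cst c t (1 : R)).
  by apply: (@is_derive_eq _ _ _ _ _ _ _ _ h2); rewrite addr0; exact: mulr1.
have dF (t : R) : is_derive t (1 : R) (fun t => Num.sg a * B (a * t + c) : R^o)
    (`|a| * kernel1 (a * t + c)).
  have h1 := @is_derive1_comp R B (fun t : R => a * t + c) t _ _ (dB _) (aff t).
  apply: (@is_derive_eq _ _ _ _ _ _ _ _ (is_deriveZ (Num.sg a) h1)).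
  by rewrite -[_ *: _]/(_ * _) normrEsg; ring.
have cg : continuous (fun t : R => `|a| * kernel1 (a * t + c)).
  apply: smooth_continuous; apply: smoothZ.
  apply: (@smooth_affine _ R R ( *%R a)) => //.
    by move=> k x y; rewrite mulrDr -![_ *: _]/(_ * _) mulrCA.
  by move=> x; apply: (@continuousM R R (cst a) id) => //; exact: cst_continuous.
have := integral_derive_segment lohi.1 dF cg.
rewrite -[X in X = _ -> _](@integral_mul_indic _ _ setT)//.
  under eq_integral do rewrite indicT mulr1.
  move=> ->; congr EFin; rewrite -mulrBr.
  have [ap|an] := ltP 0 a.
    have [-> ->] := lohi.2.1 ap; rewrite gtr0_sg// mul1r.
    by rewrite -[RHS]BK; congr (B _ - B _); field.
  have {an} an : a < 0 by rewrite lt_neqAle a0.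
  have [-> ->] := lohi.2.2 an; rewrite ltr0_sg// mulN1r opprB.
  by rewrite -[RHS]BK; congr (B _ - B _); field.
move=> t _ nt; rewrite bz ?mulr0// => /andP[h1 h2]; apply: nt; rewrite /= in_itv/=.
have [ap|an] := ltP 0 a.
  have [-> ->] := lohi.2.1 ap.
  by rewrite ler_pdivrMr// ler_pdivlMr//; apply/andP; split; lra.
have {an} an : a < 0 by rewrite lt_neqAle a0.
have [-> ->] := lohi.2.2 an.
by rewrite ler_ndivrMr// ler_ndivlMr//; apply/andP; split; lra.
Qed.

Lemma is_derive_line (V : normedModType R) (f : V -> R^o) (v p : V) (t : R) :
  smooth f -> is_derive t (1 : R) (fun t : R => f (t *: v + p) : R^o) ('D_v f (t *: v + p)).
Proof.
move=> sf; have hl : @linear_fun R R V (fun t => t *: v).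
  by move=> a y z; rewrite scalerDl scalerA.
apply: DeriveDef.
  by apply: (@derivable_affine _ R V (fun t => t *: v)) => //; exact: smooth_derivable.
by rewrite /derive (affine_quotient p f t 1 hl) scale1r.
Qed.

(** Reduces a directional derivative to a derivative on the line, where a chain rule is at hand. *)
Lemma derive_of_line (V : normedModType R) (h : V -> R^o) (v p : V) (d : R) :
  is_derive (0 : R) (1 : R) (fun t : R => h (t *: v + p) : R^o) d -> 'D_v h p = d.
Proof.
move=> hd; rewrite -(@derive_val _ _ _ _ _ _ _ hd).
have EQ : (fun k : R => k^-1 *: ((h \o shift p) (k *: v) - h p)) =
    (fun k => k^-1 *: (((fun t : R => h (t *: v + p)) \o shift 0) (k *: 1) -
       h (0 *: v + p))).
  apply/funext => k; rewrite /= addr0 scale0r add0r.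
  by rewrite -[_%:A]/(_ * _) mulr1.
by rewrite /derive EQ.
Qed.

Lemma derive_reflect (V : normedModType R) (f : V -> R^o) (x v : V) : smooth f ->
  'D_v (fun y => f (x - y) : R^o) = (fun y => - 'D_v f (x - y)).
Proof.
move=> sf; apply/funext => y; apply: derive_of_line.
have hN : is_derive (0 : R) (1 : R) (fun t : R => - t : R^o) (- 1).
  exact: (is_deriveN (is_derive_id (0 : R) (1 : R))).
have := is_derive_line v (x - y) (- 0) sf.
move=> /(fun h => @is_derive1_comp R (fun t => f (t *: v + (x - y))) -%R 0 _ _ h hN).
have E : (fun t => f (t *: v + (x - y))) \o -%R = (fun t => f (x - (t *: v + y))).
  by apply/funext => t; rewrite /= scaleNr opprD addrCA.
rewrite E => h; apply: (@is_derive_eq _ _ _ _ _ _ _ _ h).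
by rewrite oppr0 scale0r add0r mulrN1.
Qed.

(** * Convolution of an L^2 function with a test function *)

Definition big_box (r : R) : set R2 :=
  `](- r - 1), r]%classic `*` `](- r - 1), r]%classic.

Lemma measurable_big_box r : measurable (big_box r).
Proof. by apply: measurable_box; exact: is_ocitv. Qed.

Lemma big_box_L2 r : (\1_(big_box r) : R2 -> R) \in Lfun leb2 2%:E.
Proof.
apply: indic_L2; first exact: measurable_big_box.
by apply: box_lty; exact: is_ocitv.
Qed.

Lemma big_boxP r (x : R * R) : ~ big_box r x -> r < `|x|.
Proof.
move=> nx; rewrite ltNge; apply/negP => xr; apply: nx.
have [x1 x2] := prod_norm_ge x.
have := le_trans x1 xr; have := le_trans x2 xr.
by rewrite !ler_norml /big_box /= !in_itv/=; lra.
Qed.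

Lemma reflect_far (f : R * R -> R) (r Z : R) (x y : R * R) :
  (forall z, r < `|z| -> f z = 0) -> `|x| <= Z -> ~ big_box (Z + r) y -> f (x - y) = 0.
Proof.
move=> fr xZ /big_boxP yr; apply: fr.
by have := ler_distD x y 0; rewrite !subr0 distrC; lra.
Qed.

Definition conv (u rho : R * R -> R) (x : R * R) : R :=
  ip leb2 u (fun y => rho (x - y)).

Section conv.
Context (u : R * R -> R) (hu : (u : R2 -> R) \in Lfun leb2 2%:E).

(** Applied to the derivatives of [rho], this supplies the local bounds from which
    [continuous_of_partials] draws continuity. *)
Lemma conv_locally_bounded (rho : R * R -> R^o) (Z : R) : test_function setT rho ->
  exists K, forall x, `|x| <= Z -> `|conv u rho x| <= K.
Proof.
move=> tr; have [M rM] := test_bounded tr; have [r r0 rr] := test_compact_support tr.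
pose h : R2 -> R := M \*o \1_(big_box (Z + r)).
have hh : h \in Lfun leb2 2%:E by apply: L2Z; exact: big_box_L2.
exists (ip leb2 u u + ip leb2 h h) => x xZ.
have hx := test_L2 (test_reflect x tr).
have : ip leb2 (fun y => rho (x - y)) (fun y => rho (x - y)) <= ip leb2 h h.
  apply: ip_le => // y; rewrite /h /= indicE.
  have [By|nB] := pselect (big_box (Z + r) y).
    by rewrite mem_set// mulr1 (le_trans (rM _))// ler_norm.
  by rewrite (reflect_far rr xZ nB) normr0.
have := ip_ge0 leb2 (u \- (fun y => rho (x - y))).
have := ip_ge0 leb2 (u \+ (fun y => rho (x - y))).
have := ip_ge0 leb2 u; have := ip_ge0 leb2 (fun y : R2 => rho (x - y)).
rewrite ip_sqrB// ip_sqrD// -/(conv u rho x) ler_norml; lra.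
Qed.

Lemma conv_derive (rho : R * R -> R^o) (v x : R * R) : test_function setT rho ->
  derivable (conv u rho : _ -> R^o) x v /\
  'D_v (conv u rho : _ -> R^o) x = conv u ('D_v rho) x.
Proof.
move=> tr; have tD := test_derive v tr; have sr := test_smooth tr.
have [M DM] := test_bounded tD; have [r r0 Dr] := test_compact_support tD.
pose f (t : R) (y : R2) := u y * rho (t *: v + (x - y)).
have fE t y : f t y = u y * rho ((t *: v + x) - y) by rewrite /f addrA.
have df t y : is_derive t (1 : R) (f ^~ y : R -> R^o) (u y * 'D_v rho (t *: v + (x - y))).
  have := is_derive_line v (x - y) t sr; rewrite /f => h.
  exact: (is_deriveZ (u y) h).
have intf t : leb2.-integrable setT (EFin \o f t).
  rewrite (_ : f t = (fun y => u y * rho ((t *: v + x) - y))); last first.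
    by apply/funext => y; exact: fE.
  by apply: ip_integrable => //; exact: test_L2 (test_reflect _ tr).
(* For |t| < 1 the point t v + x stays in the ball of radius |v| + |x|, so the t-derivative of the
   integrand vanishes for y off this box, and M bounds the derivative of [rho] on it. *)
pose G (y : R2) := `|u y * (M * \1_(big_box (`|v| + `|x| + r)) y)|.
have iG : leb2.-integrable setT (EFin \o G).
  have := ip_integrable hu (L2Z M (big_box_L2 (`|v| + `|x| + r))).
  by move=> /integrable_norm; apply: eq_integrable.
have GE t y : `](-1), 1[%classic t -> `|partial1of2 f t y| <= G y.
  move=> /=; rewrite in_itv/= => t1.
  rewrite partial1of2E derive_val /G !normrM ler_wpM2l// indicE.
  have [By|nB] := pselect (big_box (`|v| + `|x| + r) y).
    by rewrite mem_set// normr1 mulr1 (le_trans (DM _))// ler_norm.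
  rewrite addrA (reflect_far Dr _ nB) ?normr0 ?mulr_ge0//.
  rewrite (le_trans (ler_normD _ _))// lerD2r normrZ ler_piMl//.
  by rewrite ler_norml; lra.
have I0 : `](-1 : R), 1[%classic (0 : R) by rewrite /= in_itv/=; lra.
have dF := @derivable_under_integral R _ R2 leb2 f setT measurableT 0 (-1) 1 I0
  (fun t _ => intf t) (fun t y _ _ => @ex_derive _ _ _ _ _ _ _ (df t y)) G
  (fun=> normr_ge0 _) iG (fun t y It _ => GE t y It).
have DF := @differentiation_under_integral R _ R2 leb2 f setT measurableT 0 (-1) 1 I0
  (fun t _ => intf t) (fun t y _ _ => @ex_derive _ _ _ _ _ _ _ (df t y)) G
  (fun=> normr_ge0 _) iG (fun t y It _ => GE t y It).
have E : (fun t => \int[leb2]_y f t y) = (fun t => conv u rho (t *: v + x)).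
  by apply/funext => t; apply: eq_Rintegral => y _; rewrite fE.
rewrite E in dF DF; split; first exact: (iffRL (@derivable1P R _ R^o (conv u rho) x v) dF).
transitivity (derive1 (fun t : R => conv u rho (t *: v + x) : R^o) 0).
  apply: derive_of_line.
  exact: (DeriveDef dF (esym (derive1E _ _))).
rewrite DF; apply: eq_Rintegral => y _.
by rewrite partial1of2E derive_val scale0r add0r.
Qed.

(** The existence of directional derivatives does not imply continuity. Local bounds on them do: the
    mean value theorem along a vertical and a horizontal segment gives a local Lipschitz
    estimate. *)
Lemma continuous_of_partials (h : R * R -> R^o) :
  (forall x v, derivable h x v) ->
  (forall Z v, exists K, forall x, `|x| <= Z -> `|'D_v h x| <= K) -> continuous h.
Proof.
move=> dh bh x; have [K1 HK1] := bh (`|x| + 1) e1; have [K2 HK2] := bh (`|x| + 1) e2.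
have lip (F : R -> R^o) (dF : R -> R) K a b :
    (forall t, is_derive (t : R) (1 : R) F (dF t)) ->
    (forall t, Num.min a b <= t <= Num.max a b -> `|dF t| <= K) ->
    `|F b - F a| <= K * `|b - a|.
  move=> Fd dK; have cF : continuous F.
    by move=> t; apply: differentiable_continuous; exact/derivable1_diffP.
  have [ab|ba] := leP a b.
    have [c] := MVT_segment ab (fun t _ => Fd t) (continuous_subspaceT cF).
    rewrite in_itv/= => cab ->; rewrite normrM ler_wpM2r// dK//.
    by rewrite (min_idPl ab) (max_idPr ab).
  have [c] := MVT_segment (ltW ba) (fun t _ => Fd t) (continuous_subspaceT cF).
  rewrite in_itv/= => cab; rewrite distrC => ->; rewrite normrM distrC ler_wpM2r// dK//.
  by rewrite (min_idPr (ltW ba)) (max_idPl (ltW ba)).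
have d1 y t := is_derive_section1 t y dh.
have d2 y t := is_derive_section2 y t dh.
have norm_pair (a b c : R) : `|a| <= c -> `|b| <= c -> `|(a, b)| <= c.
  by move=> ac bc; rewrite [X in X <= _]/Num.norm /= ge_max ac bc.
have near_lip x' : `|x' - x| <= 1 -> `|h x' - h x| <= (`|K1| + `|K2|) * `|x' - x|.
  move=> x'x; case: x HK1 HK2 x'x => a b HK1 HK2; case: x' => a' b' x'x.
  have [/= aa bb] := prod_norm_ge ((a', b') - (a, b)).
  have [/= na nb] := prod_norm_ge (a, b).
  have a1 : `|a' - a| <= 1 := le_trans aa x'x.
  have b1 : `|b' - b| <= 1 := le_trans bb x'x.
  have lip2 := lip (fun t => h (a', t)) (fun t => 'D_e2 h (a', t)) K2 b b' (d2 a').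
  have lip1 := lip (fun t => h (t, b)) (fun t => 'D_e1 h (t, b)) K1 a a' (d1 b).
  have {}lip2 : `|h (a', b') - h (a', b)| <= K2 * `|b' - b|.
    apply: lip2 => t ht; apply: HK2; apply: norm_pair.
      by have := ler_distD a a' 0; rewrite !subr0; lra.
    have : `|t - b| <= 1.
      by move: ht b1; rewrite !ler_norml; have [bb'|bb'] := leP b b'; lra.
    by have := ler_distD b t 0; rewrite !subr0; lra.
  have {}lip1 : `|h (a', b) - h (a, b)| <= K1 * `|a' - a|.
    apply: lip1 => t ht; apply: HK1; apply: norm_pair; last by lra.
    have : `|t - a| <= 1.
      by move: ht a1; rewrite !ler_norml; have [bb'|bb'] := leP a a'; lra.
    by have := ler_distD a t 0; rewrite !subr0; lra.
  have := ler_distD (h (a', b)) (h (a', b')) (h (a, b)).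
  have : K2 * `|b' - b| <= `|K2| * `|(a', b') - (a, b)|.
    by rewrite (le_trans (ler_norm _))// normrM normr_id ler_wpM2l.
  have : K1 * `|a' - a| <= `|K1| * `|(a', b') - (a, b)|.
    by rewrite (le_trans (ler_norm _))// normrM normr_id ler_wpM2l.
  by rewrite mulrDl; lra.
have nb (r : R) : 0 < r -> \forall x' \near x, `|x - x'| < r.
  by move=> r0; apply/nbhs_normP; exists r.
apply/cvgrPdist_le => e e0.
have c0 : 0 < `|K1| + `|K2| + 1 by rewrite ltr_wpDl ?addr_ge0.
near=> x'.
have x1 : `|x' - x| <= 1.
  by rewrite distrC; apply: ltW; near: x'; exact: nb.
rewrite distrC; apply: le_trans (near_lip _ x1) _.
apply: (@le_trans _ _ ((`|K1| + `|K2| + 1) * `|x' - x|)).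
  by rewrite ler_wpM2r// lerDl.
rewrite mulrC -ler_pdivlMr// distrC ltW//; near: x'.
by apply: nb; rewrite divr_gt0.
Unshelve. all: by end_near. Qed.

Lemma smooth_conv (rho : R * R -> R^o) : test_function setT rho ->
  smooth (conv u rho : R * R -> R^o).
Proof.
move=> tr; apply: (@smooth_coind R (R * R)%type
  [set h | exists2 rho : R * R -> R^o, test_function setT rho & h = conv u rho]);
  last by exists rho.
move=> _ [{tr}rho tr ->].
have DE v : 'D_v (conv u rho : R * R -> R^o) = conv u ('D_v rho).
  by apply/funext => x; have [] := conv_derive v x tr.
split.
- apply: continuous_of_partials => [x v|Z v].
    by have [] := conv_derive v x tr.
  have [K HK] := conv_locally_bounded Z (test_derive v tr).
  by exists K => x xZ; rewrite (conv_derive v x tr).2; exact: HK.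
- by move=> x v; have [] := conv_derive v x tr.
- by move=> v; exists ('D_v rho); [exact: test_derive|exact: DE].
Qed.

(** The weak derivative is tested against the function rho (x - y) of y: the sign of the integration
    by parts cancels that of the reflection. *)
Lemma conv_weak_derive (g : R * R -> R) (rho : R * R -> R^o) v :
  (forall phi : R * R -> R^o, test_function setT phi ->
     ip leb2 u ('D_v phi) = - ip leb2 g phi) ->
  test_function setT rho -> 'D_v (conv u rho : R * R -> R^o) = conv g rho.
Proof.
move=> ug tr; apply/funext => x; have [_ ->] := conv_derive v x tr.
rewrite /conv; have := ug _ (test_reflect x tr).
rewrite (derive_reflect _ _ (test_smooth tr)).
rewrite (_ : ip leb2 u (fun y => - 'D_v rho (x - y)) =
    - ip leb2 u (fun y => 'D_v rho (x - y))); first by move=> /oppr_inj.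
rewrite -mulN1r -ipZr//; last by apply: test_L2; exact: test_reflect (test_derive v tr).
by apply: eq_Rintegral => y _; rewrite /= mulN1r.
Qed.

End conv.

Lemma sigma_finite_leb2 : sigma_finite setT leb2.
Proof.
exists (fun n => big_box n%:R).
  apply/esym; rewrite -subTset => x _; have [n _ Hn] := nbhs_infty_gtr `|x|.
  exists n => //; apply: contrapT => /big_boxP; apply/negP; rewrite -leNgt ltW//.
  exact: Hn n (leqnn n).
move=> n; split; first exact: measurable_big_box.
by apply: box_lty; exact: is_ocitv.
Qed.

(** The sigma-finite structure that Tonelli's theorem requires on pairs of points of the plane. *)
Definition sleb2 : {sigma_finite_measure set R2 -> \bar R} :=
  HB.pack (Measure.sort leb2) (@Measure_isSigmaFinite.Build _ R2 R leb2 sigma_finite_leb2).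

Lemma test_integrable (f : R * R -> R^o) : test_function setT f ->
  leb2.-integrable setT (EFin \o (f : R2 -> R)).
Proof.
move=> tf; have := test_indic_integrable tf (@measurableT _ R2).
by apply: eq_integrable => // x _; rewrite /= indicT mulr1.
Qed.

Section contraction.
Context (u : R * R -> R) (hu : (u : R2 -> R) \in L2)
  (rho : R * R -> R^o) (tr : test_function setT rho)
  (rho0 : forall z, 0 <= rho z)
  (rho1 : forall x : R2, (\int[leb2]_y (rho (x - y))%:E = 1)%E)
  (rho1' : forall y : R2, (\int[leb2]_x (rho (x - y))%:E = 1)%E).

Let rhoM := test_bounded tr.

Lemma measurable_conv : measurable_fun setT (conv u rho : R2 -> R).
Proof. by apply: continuous_measurable2; apply: smooth_continuous; exact: smooth_conv. Qed.

(** Jensen's inequality for the probability density rho (x - y) in y, obtained from the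
    nonnegativity of the variance of u. *)
Lemma conv_sqr_le (x : R * R) :
  (((conv u rho x) ^+ 2)%:E <= \int[leb2]_y (u y ^+ 2 * rho (x - y))%:E)%E.
Proof.
have [M rM] := rhoM.
have tx := test_reflect x tr; have hx := test_L2 tx; have ix := test_integrable tx.
pose ur (y : R2) : R := u y * rho (x - y).
have hur : ur \in L2.
  by apply: (L2M_bounded (M := M) hu) => //; exact: (L2_measurable hx).
set c := conv u rho x.
have i1 := ip_integrable hu hur.
have i2 := ip_integrable hu hx.
have c2 : 0 <= ip2 u ur - 2 * c * c + c ^+ 2 * 1.
  have E2 : 2 * c * c = \int[leb2]_y (2 * c * (u y * rho (x - y))).
    by rewrite RintegralZl.
  have E3 : c ^+ 2 * 1 = \int[leb2]_y (c ^+ 2 * rho (x - y)).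
    by rewrite RintegralZl// /Rintegral rho1.
  have i2' := integrableZR (2 * c) i2; have i3 := integrableZR (c ^+ 2) ix.
  have i12 := integrableBR i1 i2'.
  rewrite E2 E3 /ip -RintegralB// -RintegralD//.
  apply: Rintegral_ge0 => y _; rewrite /ur.
  have -> : u y * (u y * rho (x - y)) - 2 * c * (u y * rho (x - y)) + c ^+ 2 * rho (x - y) =
    (u y - c) ^+ 2 * rho (x - y) by ring.
  by rewrite mulr_ge0 ?sqr_ge0.
have -> : (\int[leb2]_y (u y ^+ 2 * rho (x - y))%:E = (ip2 u ur)%:E)%E.
  rewrite /ip /Rintegral fineK; last exact: (integrable_fin_num measurableT i1).
  by apply: eq_integral => y _; rewrite /ur expr2 mulrA.
by rewrite lee_fin; lra.
Qed.

Lemma measurable_conv_integrand :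
  measurable_fun setT (fun z : R2 * R2 => (u z.2 ^+ 2 * rho (z.1 - z.2))%:E).
Proof.
apply/measurable_EFinP; apply: measurable_funM.
  apply: measurable_funX; apply: (@measurableT_comp _ _ _ (R2 * R2)%type R2 R1 u setT snd).
    exact: L2_measurable hu.
  exact: measurable_snd.
apply: (@measurableT_comp _ _ _ (R2 * R2)%type R2 R1 rho setT (fun z => z.1 - z.2)).
  exact: (L2_measurable (test_L2 tr)).
have -> : (fun z : R2 * R2 => z.1 - z.2) = (fun z => (z.1.1 - z.2.1, z.1.2 - z.2.2)) by [].
have m1 := @measurable_fst _ _ R2 R2; have m2 := @measurable_snd _ _ R2 R2.
have p1 := @measurable_fst _ _ R1 R1; have p2 := @measurable_snd _ _ R1 R1.
apply: (@measurable_fun_pair _ _ _ (R2 * R2)%type R1 R1).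
- apply: (@measurable_funB _ (R2 * R2)%type R setT (fun z => z.1.1) (fun z => z.2.1)).
    exact: (measurableT_comp p1 m1).
  exact: (measurableT_comp p1 m2).
- apply: (@measurable_funB _ (R2 * R2)%type R setT (fun z => z.1.2) (fun z => z.2.2)).
    exact: (measurableT_comp p2 m1).
  exact: (measurableT_comp p2 m2).
Qed.

(** After Tonelli's theorem the inner integral in x is the mass 1 of [rho] for each fixed y. *)
Lemma conv_sqr_integral : (\int[leb2]_x ((conv u rho x) ^+ 2)%:E <= (ip2 u u)%:E)%E.
Proof.
have mI := measurable_conv_integrand.
have I0 (z : R2 * R2) : (0 <= (u z.2 ^+ 2 * rho (z.1 - z.2))%:E)%E.
  by rewrite lee_fin mulr_ge0 ?sqr_ge0.
apply: (@le_trans _ _ (\int[leb2]_x \int[leb2]_y (u y ^+ 2 * rho (x - y))%:E)%E).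
  apply: ge0_le_integral => //.
  - by move=> x _; rewrite lee_fin sqr_ge0.
  - by apply/measurable_EFinP; apply: measurable_funX; exact: measurable_conv.
  - exact: (@measurable_fun_fubini_tonelli_F _ _ R2 R2 R sleb2 _ mI I0).
  - by move=> x _; exact: conv_sqr_le.
rewrite [X in (X <= _)%E](@fubini_tonelli _ _ R2 R2 R sleb2 sleb2 _ mI I0)/=.
rewrite ip_sqrE// le_eqVlt; apply/orP; left; apply/eqP; apply: eq_integral => y _.
under eq_integral do rewrite EFinM.
rewrite ge0_integralZl_EFin ?sqr_ge0//; last 2 first.
- by move=> x _; rewrite lee_fin.
- apply/measurable_EFinP; apply: (L2_measurable (f := fun x : R2 => rho (x - y))).
  apply: test_L2; have := test_reflect y (test_reflect 0 tr).
  rewrite (_ : (fun x => _) = (fun x => rho (x - y)))//.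
  by apply/funext => x; rewrite sub0r opprB.
by rewrite rho1' mule1.
Qed.

Lemma conv_L2 : (conv u rho : R2 -> R) \in L2.
Proof.
apply/L2P; split; first exact: measurable_conv.
exact: le_lt_trans conv_sqr_integral (ltry _).
Qed.

Lemma conv_contraction : ip2 (conv u rho) (conv u rho) <= ip2 u u.
Proof. by rewrite -lee_fin ip_sqrE ?conv_sqr_integral//; exact: conv_L2. Qed.

End contraction.

(** * One-sided mollifiers *)

Definition kern (a t : R) : R := `|a| * kernel1 (a * t).

Lemma smooth_kern a : smooth (kern a : R -> R^o).
Proof.
have [B [sb _ _ _ _]] := kernel1P.
apply: smoothZ.
have -> : (fun t => kernel1 (a * t)) = (fun t => kernel1 (a * t + 0)).
  by apply/funext => t; rewrite addr0.
apply: (@smooth_affine _ R R ( *%R a)) => //.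
  by move=> k x y; rewrite mulrDr -![_ *: _]/(_ * _) mulrCA.
by move=> x; apply: (@continuousM R R (cst a) id) => //; exact: cst_continuous.
Qed.

Lemma kern_ge0 a t : 0 <= kern a t.
Proof. by have [B [_ b0 _ _ _]] := kernel1P; rewrite /kern mulr_ge0. Qed.

Lemma kern_neq0 a t : kern a t != 0 -> 1 < a * t < 2.
Proof.
have [B [_ _ bz _ _]] := kernel1P.
move=> h; apply: contrapT => /bz hz; move: h.
by rewrite /kern hz mulr0 eqxx.
Qed.

Lemma test_kern a : 1 <= `|a| -> test_function setT (kern a : R -> R^o).
Proof.
move=> a1; have far t : 2 < `|t| -> kern a t = 0.
  move=> t2; apply/eqP/negPn/negP => /kern_neq0 /andP[at1 at2].
  have : `|a * t| < 2 by rewrite ger0_norm; lra.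
  by rewrite normrM; nra.
apply: (@test_segment _ (-2) 2); first exact: smooth_kern.
- by move=> t t2; apply: far; rewrite ltr_normr; lra.
- by move=> t t2; apply: far; rewrite ltr_normr; lra.
Qed.

Lemma integral_kern a (sg c : R) : a != 0 -> `|sg| = 1 ->
  (\int[leb]_t (kern a (sg * t + c))%:E = 1)%E.
Proof.
move=> a0 sg1; have s0 : sg != 0 by rewrite -normr_gt0 sg1.
rewrite -(@integral_kernel1 (a * sg) (a * c)) ?mulf_neq0//.
by apply: eq_integral => t _; rewrite /kern normrM sg1 mulr1 mulrDr mulrA.
Qed.

(* The support of the mollifier lies off the origin, on the side 0 < s * x_2 of
   the axis: convolving with it pushes supports into that side. *)
Definition moll (s : R) (n : nat) (z : R * R) : R :=
  kern n.+1%:R z.1 * kern (n.+1%:R * s) z.2.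

Section moll.
Context (s : R) (hs : `|s| = 1) (n : nat).

Let n1 : 1 <= `|n.+1%:R : R|.
Proof. by rewrite ger0_norm// ler1n. Qed.

Let ns1 : 1 <= `|n.+1%:R * s|.
Proof. by rewrite normrM hs mulr1 ger0_norm// ler1n. Qed.

Lemma test_moll : test_function setT (moll s n : R * R -> R^o).
Proof. by apply: test_subset (test_tensor (test_kern n1) (test_kern ns1)). Qed.

Lemma moll_ge0 z : 0 <= moll s n z.
Proof. by rewrite mulr_ge0 ?kern_ge0. Qed.

Lemma moll_neq0 z : moll s n z != 0 ->
  `|z| <= 2 / n.+1%:R /\ n.+1%:R^-1 < s * z.2.
Proof.
rewrite mulf_eq0 negb_or => /andP[/kern_neq0 /andP[h1 h2] /kern_neq0 /andP[h3 h4]].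
have p0 : (0 : R) < n.+1%:R by [].
move: n.+1%:R p0 h1 h2 h3 h4 => m m0 h1 h2 h3 h4; split; last first.
  by rewrite -(ltr_pM2l m0) mulrA mulfV ?gt_eqF.
rewrite [X in X <= _]/Num.norm /= ge_max; apply/andP; split.
  rewrite ler_pdivlMr// -(gtr0_norm m0) -normrM mulrC ger0_norm; lra.
rewrite ler_pdivlMr// -(gtr0_norm m0) -normrM.
have -> : `|z.2 * m| = `|m * s * z.2| by rewrite !normrM hs mulr1 mulrC.
by rewrite ger0_norm; lra.
Qed.

(** The sign [sg] and the shift [c] cover both the integral in y and the integral in x of the
    mollifier at x - y. *)
Lemma integral_moll (sg : R) (c : R * R) : `|sg| = 1 ->
  (\int[leb2]_y (moll s n (sg * y.1 + c.1, sg * y.2 + c.2))%:E = 1)%E.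
Proof.
move=> sg1.
have ns0 : n.+1%:R * s != 0 by rewrite -normr_gt0 (lt_le_trans ltr01).
have meas a d : measurable_fun setT (fun t : R1 => (kern a (sg * t + d))%:E).
  apply/measurable_EFinP; apply: continuous_measurable_fun.
  apply: smooth_continuous; apply: (@smooth_affine _ R R ( *%R sg)).
  - by move=> k x y; rewrite mulrDr -![_ *: _]/(_ * _) mulrCA.
  - by move=> x; apply: (@continuousM R R (cst sg) id) => //; exact: cst_continuous.
  - exact: smooth_kern.
have k0 a d (t : R1) : (0 <= (kern a (sg * t + d))%:E)%E by rewrite lee_fin kern_ge0.
rewrite -[LHS]/(\int[leb \x leb]_y (kern n.+1%:R (sg * y.1 + c.1) * kern (n.+1%:R * s) (sg * y.2 + c.2))%:E)%E.
rewrite (@fubini_tonelli1 _ _ R1 R1 R leb leb)/=.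
- rewrite -[RHS](@integral_kern n.+1%:R sg c.1)// /fubini_F.
  apply: eq_integral => x _ /=; under eq_integral do rewrite EFinM.
  by rewrite ge0_integralZl_EFin ?kern_ge0// integral_kern// mule1.
- apply/measurable_EFinP; apply: measurable_funM.
    apply: (@measurableT_comp _ _ _ R2 R1 R1 (fun t => kern n.+1%:R (sg * t + c.1)) setT fst).
      by apply/measurable_EFinP; exact: meas.
    exact: measurable_fst.
  apply: (@measurableT_comp _ _ _ R2 R1 R1 (fun t => kern (n.+1%:R * s) (sg * t + c.2)) setT snd).
    by apply/measurable_EFinP; exact: meas.
  exact: measurable_snd.
- by move=> x; rewrite lee_fin mulr_ge0 ?kern_ge0.
Qed.

Lemma integral_moll_l (x : R2) : (\int[leb2]_y (moll s n (x - y))%:E = 1)%E.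
Proof.
rewrite -(@integral_moll (-1) x) ?normrN1//; apply: eq_integral => y _.
by congr (moll s n _)%:E; congr (_, _); rewrite /= mulN1r addrC.
Qed.

Lemma integral_moll_r (y : R2) : (\int[leb2]_x (moll s n (x - y))%:E = 1)%E.
Proof.
rewrite -(@integral_moll 1 (- y)) ?normr1//; apply: eq_integral => x _.
by congr (moll s n _)%:E; congr (_, _); rewrite /= mul1r.
Qed.

End moll.

Section convergence.
Context (s : R) (hs : `|s| = 1).

Lemma conv_moll_L2 (u : R2 -> R) n : u \in L2 -> (conv u (moll s n) : R2 -> R) \in L2.
Proof.
move=> hu; apply: (conv_L2 hu (test_moll hs n)).
- by move=> z; exact: moll_ge0.
- by move=> x; exact: integral_moll_l.
- by move=> x; exact: integral_moll_r.
Qed.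

Lemma conv_moll_le (u : R2 -> R) n : u \in L2 ->
  ip2 (conv u (moll s n)) (conv u (moll s n)) <= ip2 u u.
Proof.
move=> hu; apply: (conv_contraction hu (test_moll hs n)).
- by move=> z; exact: moll_ge0.
- by move=> x; exact: integral_moll_l.
- by move=> x; exact: integral_moll_r.
Qed.

Lemma convB (u v : R2 -> R) rho : u \in L2 -> v \in L2 -> test_function setT (rho : R * R -> R^o) ->
  conv (u \- v) rho = conv u rho \- conv v rho.
Proof.
move=> hu hv tr; apply/funext => x; rewrite /conv /= ipBl//.
exact: test_L2 (test_reflect x tr).
Qed.

Lemma cvg_conv_test (f : R * R -> R^o) : test_function setT f ->
  cvgL2 leb2 (fun n => conv f (moll s n)) f.
Proof.
move=> tf; have hf := test_L2 tf; have [M fM] := test_bounded tf.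
have [r r0 fr] := test_compact_support tf.
have M0 : 0 <= M := le_trans (normr_ge0 _) (fM 0).
(* The convolution at x is a weighted mean of f over the ball of radius 2 / n.+1 about x. With c = f
   x this gives pointwise convergence, with c = 0 domination and a bounded support. *)
have bound n (x : R * R) (K c : R) :
    (forall y, `|x - y| <= 2 / n.+1%:R -> `|f y - c| <= K) ->
    `|conv f (moll s n) x - c| <= K.
  move=> fK; have tm := test_reflect x (test_moll hs n).
  have im := test_integrable tm.
  have i1 := ip_integrable hf (test_L2 tm).
  have E : conv f (moll s n) x - c = \int[leb2]_y ((f y - c) * moll s n (x - y)).
    have -> : c = \int[leb2]_y (c * moll s n (x - y)).
      by rewrite RintegralZl// /Rintegral integral_moll_l// mulr1.
    rewrite /conv /ip -RintegralB//; last exact: integrableZR.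
    apply: eq_Rintegral => y _; rewrite [in RHS]mulrBl; congr (_ - _).
    by rewrite RintegralZl// /Rintegral integral_moll_l// mulr1.
  have i2 : leb2.-integrable setT (EFin \o (fun y => (f y - c) * moll s n (x - y))).
    have := integrableBR i1 (integrableZR c im).
    by apply: eq_integrable => // y _; rewrite /= mulrBl.
  rewrite E (le_trans (le_normr_Rintegral measurableT i2))//.
  have -> : K = \int[leb2]_y (K * moll s n (x - y)).
    by rewrite RintegralZl// /Rintegral integral_moll_l// mulr1.
  apply: le_Rintegral => //.
  - by have := integrable_norm i2; apply: eq_integrable.
  - exact: integrableZR.
  move=> y _; rewrite normrM (ger0_norm (moll_ge0 _ _ _)).
  have [->|m0] := eqVneq (moll s n (x - y)) 0; first by rewrite !mulr0.
  rewrite ler_wpM2r ?moll_ge0// fK//.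
  by have [] := moll_neq0 hs m0.
apply: (@cvgL2_dominated _ R2 _ leb2 _ f (M \*o \1_(big_box (r + 2)))).
- by move=> n; exact: conv_moll_L2.
- exact: hf.
- by apply: L2Z; exact: big_box_L2.
- move=> x; apply/cvgrPdist_le => e e0.
  have cf : f z @[z --> (x : R * R)] --> f x.
    by apply: smooth_continuous; exact: test_smooth tf.
  have /nbhs_normP[d /= d0 hd] : \forall y \near x, `|f x - f y| <= e.
    by move/cvgrPdist_le : cf => /(_ _ e0).
  near=> n; rewrite distrC; apply: bound => y xy; rewrite distrC.
  apply: hd => /=; apply: le_lt_trans xy _.
  rewrite ltr_pdivrMr// mulrC -ltr_pdivrMr//.
  have : 2 / d < n%:R by near: n; exact: nbhs_infty_gtr.
  by move=> h; rewrite (lt_le_trans h)// ler_nat.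
- move=> n x /=; rewrite indicE.
  have n2 : 2 / n.+1%:R <= 2 :> R by rewrite ler_pdivrMr// ler_peMr// ler1n.
  have [Bx|nB] := pselect (big_box (r + 2) x).
    rewrite mem_set// mulr1 (le_trans _ (ler_norm _))//.
    have := @bound n x M 0; rewrite subr0; apply => y _.
    by rewrite subr0.
  rewrite memNset// mulr0 normr0.
  have := @bound n x 0 0; rewrite subr0; apply => y xy; rewrite subr0 fr ?normr0//.
  have := le_trans xy n2; have := big_boxP nB; have := ler_distD y x 0.
  by rewrite !subr0; clear; lra.
Unshelve. all: by end_near. Qed.

(** Convolution being a contraction, convergence on the dense test functions extends to L^2. *)
Lemma cvg_conv (u : R2 -> R) : u \in L2 -> cvgL2 leb2 (fun n => conv u (moll s n)) u.
Proof.
move=> hu; apply/cvgrPdist_le => e e0.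
(* Two uses of the squared triangle inequality bound the total by (2 + 4 + 4) e / 16. *)
have e16 : 0 < e / 16 by rewrite divr_gt0.
have [f tf uf] := dense_test hu e16; have hf := test_L2 tf.
have /cvgrPdist_le/(_ _ e16) := cvg_conv_test tf; apply: filterS => n.
rewrite !sub0r !normrN !ger0_norm ?ip_ge0// => hn.
have hun := conv_moll_L2 n hu; have hfn := conv_moll_L2 n hf.
have h1 := ip_sqrB_le hun hfn hu; have h2 := ip_sqrB_le hfn hf hu.
have h3 : ip2 (conv u (moll s n) \- conv f (moll s n)) (conv u (moll s n) \- conv f (moll s n)) <= e / 16.
  rewrite -convB//; last exact: test_moll.
  by apply: le_trans uf; apply: conv_moll_le; exact: L2B.
have h4 : ip2 (f \- u) (f \- u) <= e / 16 by rewrite ip_sqrBC.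
have arith (a b c d k : R) : a <= 2 * b + 2 * c -> c <= 2 * d + 2 * k ->
    b <= e / 16 -> k <= e / 16 -> d <= e / 16 -> a <= e by clear -e0; lra.
exact: arith h1 h2 h3 h4 hn.
Qed.

End convergence.

(** * Cutoffs and density of test functions in H^1 *)

Lemma derive_scale (V : normedModType R) (f : V -> R^o) (k : R) (v p : V) : smooth f ->
  'D_(k *: v) f p = k * 'D_v f p.
Proof.
move=> sf; apply: derive_of_line.
have hk : is_derive (0 : R) (1 : R) (fun t : R => t * k : R^o) k.
  have h := is_deriveZ k (is_derive_id (0 : R) (1 : R)).
  have E : (fun t : R => t * k) = k \*: id by apply/funext => t; rewrite mulrC.
  rewrite E; apply: (@is_derive_eq _ _ _ _ _ _ _ _ h); exact: mulr1.
have := is_derive_line v p (0 * k) sf.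
move=> /(fun h => @is_derive1_comp R (fun t => f (t *: v + p)) (fun t : R => t * k) 0 _ _ h hk).
have E : (fun t => f (t *: v + p)) \o (fun t : R => t * k) = (fun t => f (t *: (k *: v) + p)).
  by apply/funext => t; rewrite /= scalerA.
rewrite E => h; apply: (@is_derive_eq _ _ _ _ _ _ _ _ h).
by rewrite mul0r scale0r add0r mulrC.
Qed.

(** The constant normalises the value at 0 to 1: by continuity the cutoffs then tend to 1 pointwise,
    and the product extending a function off the axis has the right value on it. *)
Definition chi1 (t : R) : R :=
  (expinv 1 ^+ 2)^-1 * (expinv (1 * t + 1) * expinv ((-1) * t + 1)).

Lemma test_chi1 : test_function setT (chi1 : R -> R^o).
Proof.
apply: (@test_segment _ (-1) 1).
- by apply: smoothZ; apply: smoothM; exact: smooth_expinv_affine.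
- by move=> t t1; rewrite /chi1 [expinv (_ * t + _)]expinv0 ?mul0r ?mulr0//; lra.
- by move=> t t1; rewrite /chi1 [expinv (- _ * t + _)]expinv0 ?mulr0//; lra.
Qed.

Definition chi (x : R * R) : R := chi1 x.1 * chi1 x.2.

Lemma test_chi : test_function setT (chi : R * R -> R^o).
Proof. by apply: test_subset (test_tensor test_chi1 test_chi1). Qed.

Lemma chi1_0 : chi1 0 = 1.
Proof.
have e0 : expinv (1 : R) != 0 by rewrite gt_eqF// expinv_gt0.
by rewrite /chi1 !mulr0 !add0r -expr2 mulVf// expf_neq0.
Qed.

Lemma chi_0 : chi 0 = 1.
Proof. by rewrite /chi /= chi1_0 mulr1. Qed.

(** The [+ 0] gives the shape expected by [smooth_affine]. *)
Definition cutoff (m : nat) (x : R * R) : R := chi (m.+1%:R^-1 *: x + 0).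

Let scaling_linear (k : R) : @linear_fun R (R * R)%type (R * R)%type ( *:%R k).
Proof. by move=> a x y; rewrite scalerDr !scalerA mulrC. Qed.

Lemma smooth_cutoff m : smooth (cutoff m : R * R -> R^o).
Proof.
apply: (@smooth_affine _ (R * R)%type (R * R)%type ( *:%R m.+1%:R^-1)) => //.
- exact: scaler_continuous.
- exact: test_smooth test_chi.
Qed.

Lemma test_cutoff m : test_function setT (cutoff m : R * R -> R^o).
Proof.
have [r r0 cr] := test_compact_support test_chi.
have m0 : (0 : R) < m.+1%:R by [].
have far x : m.+1%:R * r < `|x| -> cutoff m x = 0.
  move=> mr; rewrite /cutoff addr0; apply: cr.
  by rewrite normrZ ger0_norm ?invr_ge0// mulrC ltr_pdivlMr// mulrC.
apply: (@test_intro _ _ _ (`[- (m.+1%:R * r), m.+1%:R * r]%classic `*`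
    `[- (m.+1%:R * r), m.+1%:R * r]%classic)) => //.
- exact: smooth_cutoff.
- by apply: compact_setX; exact: segment_compact.
- move=> x nx; apply: far; rewrite ltNge; apply/negP => xr; apply: nx.
  have [x1 x2] := prod_norm_ge x.
  by split; rewrite /= in_itv/= -ler_norml; lra.
Qed.

Lemma derive_cutoff m v x :
  'D_v (cutoff m : R * R -> R^o) x = m.+1%:R^-1 * 'D_v chi (m.+1%:R^-1 *: x + 0).
Proof.
rewrite (congr1 (@^~ x) (derive_affine 0 (chi : _ -> R^o) v (scaling_linear m.+1%:R^-1))).
by rewrite derive_scale//; exact: test_smooth test_chi.
Qed.

Lemma cvg_cutoff x : (fun m => cutoff m x) @ \oo --> (1 : R).
Proof.
rewrite -chi_0; have cc : chi z @[z --> (0 : R * R)] --> chi 0.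
  by apply: (@smooth_continuous _ _ (chi : R * R -> R^o)); exact: test_smooth test_chi.
have h : (fun m : nat => m.+1%:R^-1 *: x) @ \oo --> (0 : R * R).
  by rewrite -(scale0r x); apply: cvgZr_tmp; exact: cvg_harmonic.
apply: (eq_cvg_to (cvg_comp _ _ h cc)) => // m.
by rewrite /cutoff addr0.
Qed.

(** In Leibniz's rule the term carrying the derivative of the cutoff has a factor 1 / m.+1 and tends
    to 0; the other one converges by domination. *)
Lemma cutoff_approx (f : R * R -> R^o) (v : R * R) : smooth f -> (f : R2 -> R) \in L2 ->
  ('D_v f : R2 -> R) \in L2 ->
  cvgL2 leb2 (fun m x => f x * cutoff m x) f /\
  cvgL2 leb2 (fun m => 'D_v (fun x => f x * cutoff m x : R^o)) ('D_v f).
Proof.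
move=> sf hf hDf.
have [M cM] := test_bounded test_chi.
have [M' DM'] := test_bounded (test_derive v test_chi).
have cut0 m : (cutoff m : R2 -> R) \in L2 := test_L2 (test_cutoff m).
have Dcut0 m : ('D_v (cutoff m : R * R -> R^o) : R2 -> R) \in L2.
  exact: test_L2 (test_derive v (test_cutoff m)).
have cutM m x : `|cutoff m x| <= M by exact: cM.
have DcutM m x : `|'D_v (cutoff m : R * R -> R^o) x| <= M'.
  rewrite derive_cutoff normrM ger0_norm ?invr_ge0//.
  apply: le_trans (DM' (m.+1%:R^-1 *: x + 0)); rewrite ler_piMl//.
  by rewrite invf_le1// ler1n.
have key (g : R2 -> R) : g \in L2 -> cvgL2 leb2 (fun m x => g x * cutoff m x) g.
  move=> hg; apply: (@cvgL2_dominated _ R2 _ leb2 _ g (M \*o g)) => //.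
  - by move=> m; apply: (L2M_bounded hg (L2_measurable (cut0 m)) (cutM m)).
  - exact: L2Z.
  - move=> x; rewrite -[X in _ --> X](mulr1 (g x)).
    by apply: cvgMr; exact: cvg_cutoff.
  - move=> m x; rewrite -[(M \*o g) x]/(M * g x) normrM (normrM M) [X in X <= _]mulrC.
    rewrite ler_wpM2r//.
    by rewrite (le_trans (cutM m x))// ler_norm.
split; first exact: key.
have E : (fun m => 'D_v (fun x => f x * cutoff m x : R^o)) =
    (fun m => (fun x => f x * 'D_v (cutoff m : R * R -> R^o) x) \+ (fun x => 'D_v f x * cutoff m x)).
  apply/funext => m; apply/funext => x.
  by rewrite (deriveM_test _ _ sf (smooth_cutoff m)) /= [cutoff m x * _]mulrC.
rewrite E (_ : 'D_v f = (cst 0 : R2 -> R) \+ 'D_v f); last first.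
  by apply/funext => x /=; rewrite add0r.
apply: cvgL2D; rewrite -?E.
- by move=> m; exact: (L2M_bounded hf (L2_measurable (Dcut0 m)) (DcutM m)).
- exact: L20.
- by move=> m; exact: (L2M_bounded hDf (L2_measurable (cut0 m)) (cutM m)).
- exact: hDf.
- apply: (@cvgL2_dominated _ R2 _ leb2 _ _ (M' \*o f)).
  + by move=> m; exact: (L2M_bounded hf (L2_measurable (Dcut0 m)) (DcutM m)).
  + exact: L20.
  + exact: L2Z.
  + move=> x; have h : (fun m : nat => (m.+1%:R^-1 * (`|f x| * M'))) @ \oo --> (0 : R).
      rewrite -(mul0r (`|f x| * M')); apply: cvgMl; exact: cvg_harmonic.
    apply: norm_cvg0; apply: (squeeze_cvgr _ (cvg_cst 0) h).
    apply: nearW => m /=; rewrite normr_ge0/= normrM.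
    have h2 : `|'D_v (cutoff m : R * R -> R^o) x| <= m.+1%:R^-1 * M'.
      by rewrite derive_cutoff (normrM m.+1%:R^-1) ger0_norm ?invr_ge0// ler_wpM2l ?invr_ge0.
    by rewrite (le_trans (ler_wpM2l (normr_ge0 (f x)) h2))// mulrCA.
  + move=> m x; rewrite -[(M' \*o f) x]/(M' * f x) normrM (normrM M') [X in X <= _]mulrC.
    rewrite ler_wpM2r//.
    by rewrite (le_trans (DcutM m x))// ler_norm.
- exact: key.
Qed.

Definition wderiv (v : R * R) (u g : R * R -> R) := (g : R2 -> R) \in L2 /\
  forall phi : R * R -> R^o, test_function setT phi -> ip2 u ('D_v phi) = - ip2 g phi.

Lemma conv_support (u : R * R -> R) s n x : `|s| = 1 -> (forall y, ~ side s y -> u y = 0) ->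
  ~ (n.+1%:R^-1 <= s * x.2) -> conv u (moll s n) x = 0.
Proof.
move=> hs us nx; rewrite /conv /ip (_ : (fun y => _) = cst 0) ?Rintegral_cst ?mul0r//.
apply/funext => y /=; have [hy|/us ->] := pselect (side s y); last by rewrite mul0r.
have [->|/(moll_neq0 hs)[_ xy]] := eqVneq (moll s n (x - y)) 0; first by rewrite mulr0.
exfalso; apply: nx; move: hy xy; rewrite /side /= mulrBr.
by move: n.+1%:R^-1 => k; lra.
Qed.

Lemma ip_sqrB_quarter (a b c : R2 -> R) (e : R) :
  a \in L2 -> b \in L2 -> c \in L2 ->
  ip2 (a \- b) (a \- b) <= e / 4 -> ip2 (b \- c) (b \- c) <= e / 4 ->
  ip2 (a \- c) (a \- c) <= e.
Proof. by move=> ha hb hc; have := ip_sqrB_le ha hb hc; lra. Qed.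

(** Mollification commutes with weak derivatives, and the cutoff makes the support compact. One
    statement serves H^1 of the plane, for either s, and H^1_0 of a side, through its last
    clause. *)
Lemma H1_approx (u g1 g2 : R * R -> R) (s e : R) : `|s| = 1 -> (u : R2 -> R) \in L2 ->
  wderiv e1 u g1 -> wderiv e2 u g2 -> 0 < e ->
  exists phi : R * R -> R^o, [/\ test_function setT phi,
    ip2 (phi \- u) (phi \- u) <= e, ip2 ('D_e1 phi \- g1) ('D_e1 phi \- g1) <= e,
    ip2 ('D_e2 phi \- g2) ('D_e2 phi \- g2) <= e &
    (forall x, ~ side s x -> u x = 0) -> test_function (side s) phi].
Proof.
move=> hs hu [hg1 w1] [hg2 w2] e0.
have e4 : 0 < e / 4 by rewrite divr_gt0.
have step (a_ : nat -> R2 -> R) a : cvgL2 leb2 a_ a ->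
    exists N, forall n, (N <= n)%N -> ip2 (a_ n \- a) (a_ n \- a) <= e / 4.
  move=> /cvgrPdist_le/(_ _ e4)[N _ HN]; exists N => n /HN.
  by rewrite /= sub0r normrN ger0_norm ?ip_ge0.
have [N0 HN0] := step _ _ (cvg_conv hs hu).
have [N1 HN1] := step _ _ (cvg_conv hs hg1).
have [N2 HN2] := step _ _ (cvg_conv hs hg2).
pose n := maxn N0 (maxn N1 N2).
have n0 := HN0 n (leq_maxl _ _).
have n1 := HN1 n (leq_trans (leq_maxl N1 N2) (leq_maxr _ _)).
have n2 := HN2 n (leq_trans (leq_maxr N1 N2) (leq_maxr _ _)).
set f : R * R -> R^o := conv u (moll s n) in n0.
have tm := test_moll hs n.
have sf : smooth f by exact: smooth_conv hu _ tm.
have hf : (f : R2 -> R) \in L2 by exact: conv_moll_L2.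
have D1 : 'D_e1 f = conv g1 (moll s n) by exact: conv_weak_derive.
have D2 : 'D_e2 f = conv g2 (moll s n) by exact: conv_weak_derive.
rewrite -D1 in n1; rewrite -D2 in n2.
have hD1 : ('D_e1 f : R2 -> R) \in L2 by rewrite D1; exact: conv_moll_L2.
have hD2 : ('D_e2 f : R2 -> R) \in L2 by rewrite D2; exact: conv_moll_L2.
pose psi (m : nat) : R * R -> R^o := fun x => f x * cutoff m x.
have [c0 c1] : cvgL2 leb2 psi f /\ cvgL2 leb2 (fun m => 'D_e1 (psi m)) ('D_e1 f).
  exact: cutoff_approx.
have [_ c2] : cvgL2 leb2 psi f /\ cvgL2 leb2 (fun m => 'D_e2 (psi m)) ('D_e2 f).
  exact: cutoff_approx.
have [M0 HM0] := step _ _ c0.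
have [M1 HM1] := step _ _ c1.
have [M2 HM2] := step _ _ c2.
pose m := maxn M0 (maxn M1 M2).
have m0 := HM0 m (leq_maxl _ _).
have m1 := HM1 m (leq_trans (leq_maxl M1 M2) (leq_maxr _ _)).
have m2 := HM2 m (leq_trans (leq_maxr M1 M2) (leq_maxr _ _)).
have tphi : test_function setT (psi m).
  rewrite (_ : psi m = (fun x => cutoff m x * f x)); last first.
    by apply/funext => x; rewrite /psi mulrC.
  exact: testM (test_cutoff m) sf.

exists (psi m); split=> //.
- exact: ip_sqrB_quarter (test_L2 tphi) hf hu m0 n0.
- exact: ip_sqrB_quarter (test_L2 (test_derive e1 tphi)) hD1 hg1 m1 n1.
- exact: ip_sqrB_quarter (test_L2 (test_derive e2 tphi)) hD2 hg2 m2 n2.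
- move=> us; have [sphi cphi _] := tphi.
  (* The mollifier carries a function living on the side to distance at least 1 / n.+1 from the
     axis; this closed set keeps the support inside the open side. *)
  pose F : set (R * R) := [set x | n.+1%:R^-1 <= s * x.2].
  have cF : closed F.
    have -> : F = (fun x : R * R => s * x.2) @^-1` [set y | n.+1%:R^-1 <= y] by [].
    apply: closed_comp; last exact: closed_ge.
    move=> x _; apply: (@continuousM R (R * R)%type (cst s) snd).
      exact: cst_continuous.
    exact: cvg_snd.
  apply: (@test_intro _ _ _ (closure [set x | psi m x != 0] `&` F)) => //.
  + exact: compact_closedI.
  + move=> x [_]; rewrite /F /side /=; apply: lt_le_trans; rewrite invr_gt0//.
  + move=> x /not_andP[nx|nx]; first exact: test_off tphi nx.
    by rewrite /psi /f (conv_support hs us nx) mul0r.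
Qed.

End plane.

(** * Weak derivatives and H^1 norms on a subset of the plane *)

Section sobolev.
Context (R : realType).
Local Notation leb := (@leb R).
Local Notation leb2 := (@leb2 R).
Local Notation e1 := (@e1 R).
Local Notation e2 := (@e2 R).
Local Notation R1 := (measurableTypeR R).
Local Notation R2 := (measurableTypeR R * measurableTypeR R)%type.
Local Notation L2 := (Lfun leb2 2%:E).
Local Notation ip2 := (ip leb2).
Local Notation L1 := (Lfun leb 2%:E).
Local Notation ip1 := (ip leb).
Local Notation H := (@H R).

Lemma restrT (f : R * R -> R) : restr setT f = f.
Proof. by apply/funext => x; rewrite /restr indicT mulr1. Qed.

Lemma restrB (W : set (R * R)) (f g : R * R -> R) :
  restr W (f \- g) = restr W f \- restr W g.
Proof. by apply/funext => x; rewrite /restr /= mulrBl. Qed.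

Definition wpart (W : set (R * R)) (v : R * R) (u g : R * R -> R) :=
  (restr W g : R2 -> R) \in L2 /\ forall phi : R * R -> R^o, test_function W phi ->
  ip2 (restr W u) ('D_v phi) = - ip2 (restr W g) phi.

Lemma weak_partial_ofE W v u g : weak_partial_of W v u g <-> wpart W v u g.
Proof.
rewrite /weak_partial_of /wpart /L2on patch_restr.
have E (a b : R2 -> R) : \int[leb2]_(x in W) (a x * b x) = ip2 (restr W a) b.
  rewrite Rintegral_mkcond; apply: eq_Rintegral => x _.
  by rewrite (patch_restr W (fun x => a x * b x)) /restr mulrAC.
split=> -[hg H]; split=> // phi tphi; first by have := H phi tphi; rewrite !E.
by rewrite !E; exact: H.
Qed.

(** Says that W has enough test functions for weak derivatives to be unique almost everywhere. It is
    checked for the domains that occur: the plane, its sides and the slit plane. *)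
Definition separating (W : set (R * R)) := forall f : R2 -> R, f \in L2 ->
  (forall phi : R * R -> R^o, test_function W phi -> ip2 (restr W f) phi = 0) ->
  ae_eq leb2 setT (restr W f) (cst 0).

Lemma separatingT : separating setT.
Proof.
move=> f hf f0; rewrite restrT in f0 *.
apply: (@denseL2_eq0 _ R2 _ leb2 (test_function setT : set (R * R -> R^o)) f) => //.
- by move=> g; exact: test_L2.
- exact: dense_test.
Qed.

(** A smooth step vanishing for s x_2 <= 1 / n.+1, hence near the axis, and tending to the indicator
    of the side. It turns test functions of the plane into test functions of the side. *)
Definition halfstep (s : R) (n : nat) (x : R * R) : R := expinv (n.+1%:R * s * x.2 + (-1)).

Lemma smooth_halfstep s n : smooth (halfstep s n : R * R -> R^o).
Proof.
apply: (@smooth_snd _ (fun t : R => expinv (n.+1%:R * s * t + (-1)))).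
exact: smooth_expinv_affine.
Qed.

Lemma cvg_halfstep s x : (fun n => halfstep s n x) @ \oo --> (\1_(side s) x : R).
Proof.
have [hx|nx] := pselect (side s x); last first.
  rewrite indicE memNset//=; apply: (eq_cvg_to (cvg_cst 0)) => // n.
  rewrite /halfstep expinv0// -mulrA.
  have : n.+1%:R * (s * x.2) <= 0 by rewrite mulr_ge0_le0// leNgt; apply/negP.
  lra.
rewrite indicE mem_set//=; move: hx; rewrite /side /= => hx.
have h2 : 0 < s * x.2 / 2 by rewrite divr_gt0.
have c1 := @cvg_expinv R (s * x.2 / 2); rewrite h2 in c1.
have {}c1 : (fun n : nat => expinv (n.+1%:R * (s * x.2 / 2))) @ \oo --> (1 : R).
  by move: c1; rewrite -(cvg_shiftS (fun n : nat => expinv (n%:R * (s * x.2 / 2)))).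
move: c1; set c := fun n : nat => _; move=> c1.
have c1' : (fun n => halfstep s n x) @ \oo --> (1 : R); last by exact: c1'.
(* Once n.+1 s x_2 >= 2, the argument n.+1 s x_2 - 1 is at least n.+1 s x_2 / 2. *)
apply: (@squeeze_cvgr _ _ _ _ c (cst 1)) => //; last exact: cvg_cst.
rewrite /c; near=> n.
rewrite /halfstep expinv_le1 andbT le_expinv// -(mulrA _ s).
have : 1 / (s * x.2 / 2) < n%:R by near: n; exact: nbhs_infty_gtr.
rewrite ltr_pdivrMr// => h; have : n%:R <= n.+1%:R :> R by rewrite ler_nat.
by move: n.+1%:R (s * x.2) h2 h => a b h2 h h3; nra.
Unshelve. all: by end_near. Qed.

Lemma test_halfstep s n (phi : R * R -> R^o) : test_function setT phi ->
  test_function (side s) (fun x => phi x * halfstep s n x : R^o).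
Proof.
move=> tp; have tps := testM tp (@smooth_halfstep s n); have [sp cp _] := tps.
pose F : set (R * R) := [set x | n.+1%:R^-1 <= s * x.2].
have cF : closed F.
  have -> : F = (fun x : R * R => s * x.2) @^-1` [set y | n.+1%:R^-1 <= y] by [].
  apply: closed_comp; last exact: closed_ge.
  move=> x _; apply: (@continuousM R (R * R)%type (cst s) snd).
    exact: cst_continuous.
  exact: cvg_snd.
apply: (@test_intro _ _ _ (closure [set x | phi x * halfstep s n x != 0] `&` F)) => //.
- exact: compact_closedI.
- by move=> x [_]; rewrite /F /side /=; apply: lt_le_trans; rewrite invr_gt0.
- move=> x /not_andP[nx|nx]; first exact: test_off tps nx.
  rewrite /halfstep expinv0 ?mulr0// -mulrA.
  have m0 : (0 : R) < n.+1%:R by [].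
  have : s * x.2 < n.+1%:R^-1 by rewrite ltNge; apply/negP.
  by rewrite -(ltr_pM2l m0) mulfV ?gt_eqF// => h; lra.
Qed.

(** Test functions of the plane multiplied by [halfstep] converge to their restrictions, so
    [restr (side s) f] is orthogonal to a dense subspace. *)
Lemma separating_side s : separating (side s).
Proof.
move=> f hf f0; have mh := measurable_side s; have hrf := restr_L2 mh hf.
apply: (@denseL2_eq0 _ R2 _ leb2 (test_function setT : set (R * R -> R^o)) (restr (side s) f)) => //.
- by move=> g; exact: test_L2.
- exact: dense_test.
move=> phi tphi; have hphi := test_L2 tphi.
have stepM n x : `|halfstep s n x| <= 1 by rewrite ger0_norm ?expinv_ge0// expinv_le1.
have tn n := test_subset (@subsetT _ _) (test_halfstep s n tphi).
have hn n := test_L2 (tn n).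
have c : cvgL2 leb2 (fun n x => phi x * halfstep s n x) (restr (side s) phi).
  apply: (@cvgL2_dominated _ R2 _ leb2 _ _ phi) => //.
  - exact: restr_L2.
  - by move=> x; apply: cvgMr; exact: cvg_halfstep.
  - by move=> n x; rewrite normrM ler_piMr.
have c1 := cvgL2_ip (fun=> hrf) hrf hn (restr_L2 mh hphi) (cvgL2_cst leb2 _) c.
have c2 : (fun n => ip2 (restr (side s) f) (fun x => phi x * halfstep s n x)) @ \oo --> (0 : R).
  by apply: (eq_cvg_to (cvg_cst 0)) => // n; rewrite f0//; exact: test_halfstep.
rewrite -(cvg_unique _ c1 c2)//.
apply: eq_Rintegral => x _; rewrite /restr indicE; case: (_ \in _); rewrite ?mulr1 ?mulr0 ?mul0r//.
Qed.

Lemma separating_slit : separating (@slit_plane R).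
Proof.
move=> f hf f0; have mh s := measurable_side s.
have half_slit s : s = 1 \/ s = -1 -> side s `<=` @slit_plane R.
  by rewrite /slit_plane upperE lowerE => -[->|->] x hx; [left|right].
have h s : s = 1 \/ s = -1 -> ae_eq leb2 setT (restr (side s) f) (cst 0).
  move=> hs; apply: separating_side => // phi tphi.
  rewrite -(f0 phi (test_subset (half_slit s hs) tphi)).
  apply: eq_Rintegral => x _; rewrite /restr !indicE.
  have [hx|nx] := pselect (side s x); last by rewrite (test_supp tphi nx) !mulr0.
  by rewrite !mem_set//; exact: half_slit hx.
apply: ae_mono2 (h 1 (or_introl erefl)) (h (-1) (or_intror erefl)) => x h1 h2 _.
by rewrite /restr indic_slit_plane mulrDr [X in X + _]h1// [X in _ + X]h2// addr0.
Qed.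

(** The chosen derivative and g have the same pairings with test functions, and [separating]
    identifies them on W. *)
Lemma weak_partial_ae W v u g : separating W -> measurable (W : set R2) ->
  wpart W v u g -> wpart W v u (weak_partial W v u) /\
  ae_eq leb2 setT (restr W (weak_partial W v u)) (restr W g).
Proof.
move=> sW mW wg.
have : weak_partial_of W v u (weak_partial W v u).
  by apply: xgetPex; exists g; exact/weak_partial_ofE.
move=> /weak_partial_ofE w; split=> //.
have [hg Hg] := wg; have [hp Hp] := w.
have idem (f : R * R -> R) : restr W (restr W f) = restr W f.
  apply/funext => x; rewrite /restr indicE.
  by case: (_ \in _); rewrite ?mulr1 ?mulr0.
have := sW (restr W (weak_partial W v u) \- restr W g).
rewrite restrB !idem => /(_ (L2B hp hg)) H.
have /H : forall phi : R * R -> R^o, test_function W phi ->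
    ip2 (restr W (weak_partial W v u) \- restr W g) phi = 0.
  move=> phi tphi; rewrite ipBl//; last exact: test_L2 (test_subset (@subsetT _ _) tphi).
  by apply/eqP; rewrite subr_eq0 -eqr_opp -Hp// -Hg.
apply: ae_mono => x /(_ Logic.I) /= /eqP; rewrite subr_eq0 => /eqP -> _.
by [].
Qed.

Lemma integral_sqr_restr (W : set R2) (f : R2 -> R) : (restr W f : R2 -> R) \in L2 ->
  (\int[leb2]_(x in W) ((f x) ^+ 2)%:E = (ip2 (restr W f) (restr W f))%:E)%E.
Proof.
move=> hf; rewrite ip_sqrE// [LHS]integral_mkcond; apply: eq_integral => x _.
rewrite patchE /restr indicE; case: ifP => _; first by rewrite mulr1.
by rewrite mulr0 expr0n.
Qed.

Lemma integral_sqrD_restr (W : set R2) (f g : R2 -> R) :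
  (restr W f : R2 -> R) \in L2 -> (restr W g : R2 -> R) \in L2 ->
  (\int[leb2]_(x in W) ((f x) ^+ 2 + (g x) ^+ 2)%:E =
   (ip2 (restr W f) (restr W f) + ip2 (restr W g) (restr W g))%:E)%E.
Proof.
move=> hf hg.
have -> : (\int[leb2]_(x in W) (f x ^+ 2 + g x ^+ 2)%:E =
    \int[leb2]_x ((restr W f x ^+ 2)%:E + (restr W g x ^+ 2)%:E))%E.
  rewrite integral_mkcond; apply: eq_integral => x _.
  rewrite -EFinD patchE /restr indicE.
  by case: ifP => _; rewrite ?mulr1 ?mulr0 ?expr0n ?addr0.
have msq (h : R2 -> R) : h \in L2 -> measurable_fun setT (fun x => (h x ^+ 2)%:E).
  by move=> hh; apply/measurable_EFinP; apply: measurable_funX; exact: L2_measurable hh.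
rewrite ge0_integralD//; [by rewrite -!ip_sqrE| | exact: msq | | exact: msq].
- by move=> x _; rewrite lee_fin sqr_ge0.
- by move=> x _; rewrite lee_fin sqr_ge0.
Qed.

Lemma dirichletE W u g1 g2 : separating W -> measurable (W : set R2) ->
  wpart W e1 u g1 -> wpart W e2 u g2 ->
  dirichlet W u = (ip2 (restr W g1) (restr W g1) + ip2 (restr W g2) (restr W g2))%:E.
Proof.
move=> sW mW w1 w2.
have [[h1 _] a1] := weak_partial_ae sW mW w1; have [[h2 _] a2] := weak_partial_ae sW mW w2.
have [hg1 _] := w1; have [hg2 _] := w2.
rewrite /dirichlet.
have E := integral_sqrD_restr h1 h2.
rewrite -(eq_ip h1 hg1 h1 hg1 a1 a1).
rewrite -(eq_ip h2 hg2 h2 hg2 a2 a2).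
exact: E.
Qed.

Lemma H1norm2E W u g1 g2 : separating W -> measurable (W : set R2) ->
  (restr W u : R2 -> R) \in L2 -> wpart W e1 u g1 -> wpart W e2 u g2 ->
  H1norm2 W u = (ip2 (restr W u) (restr W u) +
    (ip2 (restr W g1) (restr W g1) + ip2 (restr W g2) (restr W g2)))%:E.
Proof.
by move=> sW mW hu w1 w2; rewrite /H1norm2 (dirichletE sW mW w1 w2) integral_sqr_restr.
Qed.

Lemma wpartB W v u g u' g' : (restr W u : R2 -> R) \in L2 -> (restr W u' : R2 -> R) \in L2 ->
  wpart W v u g -> wpart W v u' g' -> wpart W v (u \- u') (g \- g').
Proof.
move=> hu hu' [hg Hg] [hg' Hg']; split; first by rewrite restrB; exact: L2B.
move=> phi tphi; have tT := test_subset (@subsetT _ _) tphi.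
have hp := test_L2 tT; have hDp := test_L2 (test_derive v tT).
by rewrite !restrB !ipBl// Hg// Hg'// opprB opprK addrC.
Qed.

Lemma restr_ip (W : set R2) (f : R2 -> R) (phi : R * R -> R^o) : test_function W phi ->
  ip2 (restr W f) phi = ip2 f phi.
Proof.
move=> tp; apply: eq_Rintegral => x _; rewrite /restr indicE.
have [Wx|nW] := pselect (W x); first by rewrite mem_set// mulr1.
by rewrite (test_supp tp nW) !mulr0.
Qed.

Lemma wpart_restrict W v u g : measurable (W : set R2) -> (u : R2 -> R) \in L2 ->
  wderiv v u g -> wpart W v u g.
Proof.
move=> mW hu [hg H]; split; first exact: restr_L2.
move=> phi tphi; rewrite !restr_ip//; last exact: test_derive.
by apply: H; exact: test_subset tphi.
Qed.

Lemma wpartT v u g : wpart setT v u g <-> wderiv v u g.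
Proof. by rewrite /wpart /wderiv !restrT. Qed.

Lemma test_wderiv v (phi : R * R -> R^o) : v = e1 \/ v = e2 -> test_function setT phi ->
  wderiv v phi ('D_v phi).
Proof.
move=> hv tp; split; first exact: test_L2 (test_derive v tp).
by move=> psi tpsi; exact: test_ibp.
Qed.

Lemma H1norm2_test W (phi : R * R -> R^o) u g1 g2 :
  separating W -> measurable (W : set R2) -> (restr W u : R2 -> R) \in L2 ->
  wpart W e1 u g1 -> wpart W e2 u g2 -> test_function setT phi ->
  H1norm2 W (phi \- u) = (ip2 (restr W phi \- restr W u) (restr W phi \- restr W u) +
    (ip2 (restr W ('D_e1 phi) \- restr W g1) (restr W ('D_e1 phi) \- restr W g1) +
     ip2 (restr W ('D_e2 phi) \- restr W g2) (restr W ('D_e2 phi) \- restr W g2)))%:E.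
Proof.
move=> sW mW hu w1 w2 tp; have hp := test_L2 tp; have hrp := restr_L2 mW hp.
rewrite (@H1norm2E W _ ('D_e1 phi \- g1) ('D_e2 phi \- g2))// ?restrB//.
- exact: L2B.
- apply: wpartB => //; apply: wpart_restrict => //.
  by apply: test_wderiv => //; left.
- apply: wpartB => //; apply: wpart_restrict => //.
  by apply: test_wderiv => //; right.
Qed.

Lemma cvg_sum3 (a b c : nat -> R) : (forall n, 0 <= a n) -> (forall n, 0 <= b n) ->
  (forall n, 0 <= c n) ->
  ((fun n => (a n + (b n + c n))%:E) @ \oo --> 0%E) <->
  [/\ a @ \oo --> (0 : R), b @ \oo --> (0 : R) & c @ \oo --> (0 : R)].
Proof.
move=> a0 b0 c0; split=> [/fine_cvg h|[ca cb cc]].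
  by split; apply: (squeeze_cvgr _ (cvg_cst 0) h); apply: nearW => n /=;
    move: (a0 n) (b0 n) (c0 n) => ? ? ?; apply/andP; split; lra.
apply: EFin_cvgn; rewrite -[X in _ --> X](addr0 0) -[X in _ --> _ + X](addr0 0).
by apply: cvgD => //; apply: cvgD.
Qed.

Lemma H1norm2_cvg W (phi_ : nat -> R * R -> R^o) u g1 g2 :
  separating W -> measurable (W : set R2) -> (restr W u : R2 -> R) \in L2 ->
  wpart W e1 u g1 -> wpart W e2 u g2 -> (forall n, test_function setT (phi_ n)) ->
  (H1norm2 W (phi_ n \- u) @[n --> \oo] --> 0%E) <->
  [/\ cvgL2 leb2 (fun n => restr W (phi_ n)) (restr W u),
      cvgL2 leb2 (fun n => restr W ('D_e1 (phi_ n))) (restr W g1) &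
      cvgL2 leb2 (fun n => restr W ('D_e2 (phi_ n))) (restr W g2)].
Proof.
move=> sW mW hu w1 w2 tp; rewrite -cvg_sum3; try by move=> n; exact: ip_ge0.
by under eq_fun do rewrite (H1norm2_test sW mW hu w1 w2 (tp _)).
Qed.

(** * Traces of H^1 functions *)

Definition sob (u g1 g2 : R * R -> R) :=
  [/\ (u : R2 -> R) \in L2, wderiv e1 u g1 & wderiv e2 u g2].

Lemma H1_sob u : H1 setT u <-> exists g1 g2, sob u g1 g2.
Proof.
rewrite /H1 /= /L2on patch_restr restrT; split.
  move=> [hu [g1 /weak_partial_ofE/wpartT w1] [g2 /weak_partial_ofE/wpartT w2]].
  by exists g1, g2.
move=> [g1 [g2 [hu w1 w2]]].
by split=> //; [exists g1|exists g2]; apply/weak_partial_ofE/wpartT.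
Qed.

Lemma sob_test (phi : R * R -> R^o) : test_function setT phi ->
  sob phi ('D_e1 phi) ('D_e2 phi).
Proof.
by move=> tp; split; [exact: test_L2 tp| |]; apply: test_wderiv tp; [left|right].
Qed.

Definition cvgH1 (phi_ : nat -> R * R -> R^o) (u g1 g2 : R * R -> R) :=
  [/\ cvgL2 leb2 phi_ u, cvgL2 leb2 (fun n => 'D_e1 (phi_ n)) g1 &
      cvgL2 leb2 (fun n => 'D_e2 (phi_ n)) g2].

Lemma H1norm2_cvgT (phi_ : nat -> R * R -> R^o) u g1 g2 : sob u g1 g2 ->
  (forall n, test_function setT (phi_ n)) ->
  (H1norm2 setT (phi_ n \- u) @[n --> \oo] --> 0%E) <-> cvgH1 phi_ u g1 g2.
Proof.
move=> [hu w1 w2] tp; rewrite (@H1norm2_cvg _ _ u g1 g2)//.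
- have E (a_ : nat -> R * R -> R) : (fun n => restr setT (a_ n)) = a_.
    by apply/funext => n; rewrite restrT.
  by rewrite /cvgH1 !restrT !(E phi_) (E (fun n => 'D_e1 (phi_ n)))
    (E (fun n => 'D_e2 (phi_ n))).
- exact: separatingT.
- by rewrite restrT.
- exact/wpartT.
- exact/wpartT.
Qed.

Lemma cvgH1_approx u g1 g2 s : `|s| = 1 -> sob u g1 g2 ->
  exists phi_ : nat -> R * R -> R^o, [/\ forall n, test_function setT (phi_ n),
    cvgH1 phi_ u g1 g2 &
    (forall x, ~ side s x -> u x = 0) -> forall n, test_function (side s) (phi_ n)].
Proof.
move=> hs [hu w1 w2].
have n0 n : (0 : R) < n.+1%:R^-1 by rewrite invr_gt0.
have [phi_ H] := choice (fun n => H1_approx hs hu w1 w2 (n0 n)).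
have small (a_ : nat -> R2 -> R) a :
    (forall n, ip2 (a_ n \- a) (a_ n \- a) <= n.+1%:R^-1) -> cvgL2 leb2 a_ a.
  move=> h; apply: (@squeeze_cvgr _ _ _ _ (cst 0) (fun n => n.+1%:R^-1)).
  - by apply: nearW => n; rewrite ip_ge0 h.
  - exact: cvg_cst.
  - exact: cvg_harmonic.
exists phi_; split.
- by move=> n; have [] := H n.
- by split; apply: small => n; have [] := H n.
- by move=> us n; have [_ _ _ _] := H n; exact.
Qed.

Lemma trace_ofP u g1 g2 f : sob u g1 g2 -> trace_of u f <->
  (f : R1 -> R) \in L1 /\ exists phi_ : nat -> R * R -> R^o,
  [/\ forall n, test_function setT (phi_ n), cvgH1 phi_ u g1 g2 &
      cvgL2 leb (fun n x => phi_ n (x, 0)) f].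
Proof.
move=> hu.
have E (phi : R * R -> R^o) : (f : R1 -> R) \in L1 -> test_function setT phi ->
    (\int[leb]_x ((phi (x, 0) - f x) ^+ 2)%:E)%E =
    (ip1 ((fun x => phi (x, 0)) \- f) ((fun x => phi (x, 0)) \- f))%:E.
  by move=> hf tp; rewrite ip_sqrE//; apply: L2B => //; exact: test_L2_line (test_trace tp).
split=> -[hf [phi [tp c1 c2]]]; split=> //; exists phi; split=> //.
- exact/(H1norm2_cvgT hu tp).
- by apply/fine_cvg; move: c2; under eq_fun do rewrite E//.
- exact/(H1norm2_cvgT hu tp).
- by under eq_fun do rewrite E//; apply: EFin_cvgn.
Qed.

(** [test_trace_ineq] applied to differences makes the traces of approximating test functions a
    Cauchy sequence on the line. *)
Lemma trace_exists u g1 g2 : sob u g1 g2 -> exists f, trace_of u f.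
Proof.
move=> su; have [hu [hg1 _] [hg2 _]] := su.
have [phi [tp cp _]] := cvgH1_approx (normr1 R) su; have [c _ c2] := cp.
pose tr n (x : R) : R := phi n (x, 0).
have htr n : (tr n : R1 -> R) \in L1 by exact: test_L2_line (test_trace (tp n)).
have hp n : (phi n : R2 -> R) \in L2 := test_L2 (tp n).
have hd n : ('D_e2 (phi n) : R2 -> R) \in L2 := test_L2 (test_derive e2 (tp n)).
have cauchy e : 0 < e -> exists N, forall m n, (N <= m)%N -> (N <= n)%N ->
    ip1 (tr m \- tr n) (tr m \- tr n) <= e.
  move=> e0; have e8 : 0 < e / 8 by rewrite divr_gt0.
  have bnd (a_ : nat -> R2 -> R) a : cvgL2 leb2 a_ a ->
      exists N, forall n, (N <= n)%N -> ip2 (a_ n \- a) (a_ n \- a) <= e / 8.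
    move=> /cvgrPdist_le/(_ _ e8)[N _ HN]; exists N => n /HN.
    by rewrite /= sub0r normrN ger0_norm ?ip_ge0.
  have [N1 H1] := bnd _ _ c; have [N2 H2] := bnd _ _ c2.
  exists (maxn N1 N2) => m n; rewrite !geq_max => /andP[m1 m2] /andP[n1 n2].
  have tmn : test_function setT (phi m \+ (-1 \*o phi n)) by exact: test_lin.
  have := test_trace_ineq tmn.
  have -> : 'D_e2 (phi m \+ (-1 \*o phi n)) = 'D_e2 (phi m) \- 'D_e2 (phi n).
    apply/funext => x; have [sm _ _] := tp m; have [sn _ _] := tp n.
    rewrite deriveD; [|exact: smooth_derivable sm|].
      by rewrite deriveZ/= ?scaleN1r//; exact: smooth_derivable sn.
    by apply: derivableZ; exact: smooth_derivable sn.
  have -> : phi m \+ (-1 \*o phi n) = phi m \- phi n.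
    by apply/funext => x /=; rewrite mulN1r.
  have tri (a b c' : R2 -> R) : a \in L2 -> b \in L2 -> c' \in L2 ->
      ip2 (a \- b) (a \- b) <= e / 8 -> ip2 (c' \- b) (c' \- b) <= e / 8 ->
      ip2 (a \- c') (a \- c') <= e / 2.
    move=> ha hb hc'; rewrite (ip_sqrBC _ c'); have := ip_sqrB_le ha hb hc'.
    by move: (ip2 _ _) (ip2 _ _) (ip2 _ _) => *; lra.
  move=> h; apply: (le_trans h); rewrite [leRHS](splitr e).
  apply: lerD.
  - by apply: (tri _ u) => //; [exact: H1|exact: H1].
  - by apply: (tri _ g2) => //; [exact: H2|exact: H2].
have [f hf cf] := L2_complete htr cauchy.
by exists f; apply/(trace_ofP f su); split=> //; exists phi.
Qed.

(** Moving the restriction onto the fixed factor lets a convergence of the other factor be applied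
    unchanged. *)
Lemma restr_sym (W : set (R * R)) (f g : R * R -> R) :
  ip2 (restr W f) g = ip2 f (restr W g).
Proof. by apply: eq_Rintegral => x _; rewrite /restr mulrAC mulrA. Qed.

Lemma test_green1 (f g : R * R -> R^o) s : test_function setT f -> test_function setT g ->
  ip2 (restr (side s) f) ('D_e1 g) = - ip2 (restr (side s) ('D_e1 f)) g.
Proof.
move=> tf tg; have := green1 s (testM tf (test_smooth tg)).
have hf := test_L2 tf; have hg := test_L2 tg.
have hDf := test_L2 (test_derive e1 tf); have hDg := test_L2 (test_derive e1 tg).
have mh := measurable_side s.
rewrite (@eq_Rintegral _ _ _ leb2 _ (fun x => restr (side s) f x * 'D_e1 g x +
    restr (side s) ('D_e1 f) x * g x)); last first.
  move=> x _; rewrite (deriveM_test _ _ (test_smooth tf) (test_smooth tg)) /restr; ring.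
rewrite RintegralD//; [by move=> /eqP; rewrite addr_eq0 => /eqP| |];
  by apply: ip_integrable => //; exact: restr_L2.
Qed.

Lemma restr_cvg W (a_ : nat -> R2 -> R) (a v : R2 -> R) : measurable (W : set R2) ->
  (forall n, a_ n \in L2) -> a \in L2 -> v \in L2 -> cvgL2 leb2 a_ a ->
  (fun n => ip2 (restr W (a_ n)) v) @ \oo --> ip2 (restr W a) v.
Proof.
move=> mW ha_ ha hv c; have := cvgL2_weak ha_ ha c (restr_L2 mW hv) => h.
by apply: (eq_cvg_to h) => [n|]; rewrite restr_sym.
Qed.

Lemma sob_green1 u g1 g2 s (psi : R * R -> R^o) : sob u g1 g2 -> test_function setT psi ->
  ip2 (restr (side s) u) ('D_e1 psi) = - ip2 (restr (side s) g1) psi.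
Proof.
move=> su tpsi; have [hu [hg1 _] _] := su; have mh := measurable_side s.
have [phi [tp [c0 c1 _] _]] := cvgH1_approx (normr1 R) su.
have l1 := restr_cvg mh (fun n => test_L2 (tp n)) hu (test_L2 (test_derive e1 tpsi)) c0.
have l2 := restr_cvg mh (fun n => test_L2 (test_derive e1 (tp n))) hg1 (test_L2 tpsi) c1.
have l3 : (fun n => ip2 (restr (side s) (phi n)) ('D_e1 psi)) @ \oo -->
    - ip2 (restr (side s) g1) psi.
  by apply: (eq_cvg_to (cvgN l2)) => // n; rewrite test_green1.
by rewrite -(cvg_unique _ l1 l3).
Qed.

(** Each term of Green's formula is continuous in u, its weak gradient or its trace, so the formula
    passes from approximating test functions to u. *)
Lemma sob_green2 u g1 g2 f s (psi : R * R -> R^o) : s = 1 \/ s = -1 ->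
  sob u g1 g2 -> trace_of u f -> test_function setT psi ->
  ip2 (restr (side s) u) ('D_e2 psi) =
  - ip2 (restr (side s) g2) psi - s * ip1 f (fun x => psi (x, 0)).
Proof.
move=> hs su /(trace_ofP f su) [hf [phi [tp [c0 _ c2] ct]]] tpsi.
have [hu _ [hg2 _]] := su; have mh := measurable_side s.
have l1 := restr_cvg mh (fun n => test_L2 (tp n)) hu (test_L2 (test_derive e2 tpsi)) c0.
have l2 := restr_cvg mh (fun n => test_L2 (test_derive e2 (tp n))) hg2 (test_L2 tpsi) c2.
have l3 := cvgL2_weak (fun n => test_L2_line (test_trace (tp n))) hf ct
  (test_L2_line (test_trace tpsi)).
have l4 : (fun n => ip2 (restr (side s) (phi n)) ('D_e2 psi)) @ \oo -->
    (- ip2 (restr (side s) g2) psi - s * ip1 f (fun x => psi (x, 0))).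
  apply: (eq_cvg_to (cvgB (cvgN l2) (cvgM (cvg_cst s) l3))) => // n.
  by rewrite (test_green2 hs (tp n) tpsi).
by rewrite -(cvg_unique _ l1 l4).
Qed.

(* Extends eta off the axis, so that Green's formula on the upper side expresses
   the trace of u tested against eta through u and its gradient. *)
Definition collar (eta : R -> R^o) (x : R * R) : R^o := eta x.1 * chi1 x.2.

Lemma test_collar eta : test_function setT eta -> test_function setT (collar eta).
Proof. by move=> te; apply: test_subset (test_tensor te (@test_chi1 R)). Qed.

Lemma collar0 eta x : collar eta (x, 0) = eta x.
Proof.
by rewrite /collar /= chi1_0 mulr1.
Qed.

Lemma trace_collar u g1 g2 f (eta : R -> R^o) : sob u g1 g2 -> trace_of u f ->
  test_function setT eta -> ip1 f eta =
  - ip2 (restr (side 1) g2) (collar eta) - ip2 (restr (side 1) u) ('D_e2 (collar eta)).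
Proof.
move=> su tf te; have s1 : (1 : R) = 1 \/ (1 : R) = -1 by left.
rewrite (sob_green2 s1 su tf (test_collar te)) mul1r opprB opprK.
have -> : (fun x => collar eta (x, 0)) = eta by apply/funext => x; exact: collar0.
by rewrite addrCA addNr addr0.
Qed.

Lemma L2_line_eq (f g : R -> R) : (f : R1 -> R) \in L1 -> (g : R1 -> R) \in L1 ->
  (forall eta : R -> R^o, test_function setT eta -> ip1 f eta = ip1 g eta) ->
  ae_eq leb setT f g.
Proof.
move=> hf hg fg.
have H : ae_eq leb setT (f \- g) (cst 0).
  apply: (@denseL2_eq0 _ R1 _ leb (test_function setT : set (R -> R^o))) => //.
  - by move=> eta; exact: test_L2_line.
  - exact: dense_test_line.
  - exact: L2B.
  - by move=> eta te; have he := test_L2_line te; rewrite ipBl// fg// subrr.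
by apply: ae_mono H => x /(_ Logic.I)/eqP; rewrite subr_eq0 => /eqP ->.
Qed.

(** By [trace_collar] the pairings of a trace with test functions depend on u and its gradient
    alone, whatever the approximating sequence. *)
Lemma trace_uniq u g1 g2 f f' : sob u g1 g2 -> trace_of u f -> trace_of u f' ->
  ae_eq leb setT f f'.
Proof.
move=> su tf tf'; have [hf _] := tf; have [hf' _] := tf'.
by apply: L2_line_eq => // eta te; rewrite (trace_collar su tf te) (trace_collar su tf' te).
Qed.

Lemma traceP u g1 g2 : sob u g1 g2 -> trace_of u (trace u).
Proof. by move=> su; apply: xgetPex; exact: trace_exists su. Qed.

(** * Weak derivatives on the line *)

Lemma weak_deriv_ofE f g : weak_deriv_of f g <-> (g : R1 -> R) \in L1 /\
  forall eta : R -> R^o, test_function setT eta -> ip1 f ('D_1 eta) = - ip1 g eta.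
Proof. by []. Qed.

Lemma weak_derivP f g : weak_deriv_of f g -> weak_deriv_of f (weak_deriv f) /\
  ae_eq leb setT (weak_deriv f) g.
Proof.
move=> fg; have fd : weak_deriv_of f (weak_deriv f) by apply: xgetPex; exists g.
split=> //; have [hd Hd] := fd; have [hg Hg] := fg.
apply: L2_line_eq => // eta te; apply: oppr_inj.
by have := Hd _ te; have := Hg _ te; rewrite /ip => <- <-.
Qed.

(** The vanishing mean is what brings the antiderivative back to 0 beyond the support of [psi]. *)
Lemma test_primitive (psi : R -> R^o) : test_function setT psi ->
  \int[leb]_x psi x = 0 -> exists2 Psi : R -> R^o, test_function setT Psi & 'D_1 Psi = psi.
Proof.
move=> tpsi psi0; have [r _ hr] := test_compact_support tpsi.
have [G [dG Gl Gr]] := antiderivative (smooth_continuous (test_smooth tpsi))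
  (test_integrable_line tpsi) hr.
exists (G : R -> R^o); last by apply/funext => x; exact: derive_val.
apply: (@test_segment _ (- r) r) => // [|t /ltW rt].
  by apply: smooth_antiderivative dG _; exact: test_smooth tpsi.
by rewrite Gr.
Qed.

(** The indicator of ]a, b + 1] is 1 wherever a bump is nonzero, so the integral is a scalar product
    and convergence in L^2 suffices. *)
Lemma integral_bump (a b : R) : a <= b ->
  (fun n => \int[leb]_x (bump a b n x)) @ \oo --> b - a.
Proof.
move=> ab.
have := cvgL2_weak (fun n => test_L2_line (test_bump a b n)) (ocitv_L2 a b)
  (cvgL2_bump a b) (ocitv_L2 a (b + 1)).
move=> h; apply: (eq_cvg_to h) => {h} [n|].
  apply: eq_Rintegral => x _; have := bump_le a b n x; have := bump_ge0 a b n x.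
  rewrite indicE; case: (_ \in _) => /=; rewrite ?mulr1 ?mulr0// => h0 h1.
  by apply/eqP; rewrite eq_le h0 h1.
rewrite /ip (_ : (fun x => _) = \1_(`]a, b]%classic)); last first.
  apply/funext => x; rewrite -[LHS]/((\1_(`]a, b]%classic) \* \1_(`]a, (b + 1)]%classic)) x).
  rewrite -indicI; congr (\1_ _ x); apply/setIidl => t /=.
  by rewrite !in_itv/= => /andP[-> tb]/=; rewrite (le_trans tb)// lerDl.
rewrite /Rintegral integral_indic ?setIT//.
rewrite [leb _]lebesgue_measure_itv/= lte_fin; case: ltP => // ba.
have -> : a = b by apply/eqP; rewrite eq_le ab ba.
by rewrite subrr.
Qed.

(* Such an f is orthogonal to the test functions of mean 0, so integration against
   f is a multiple of the integral on test functions. As the indicator of ]0, N]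
   has integral N but L^2 norm sqrt N, the multiple is 0. *)
Lemma weak_deriv0 (f : R -> R) : (f : R1 -> R) \in L1 ->
  (forall eta : R -> R^o, test_function setT eta -> ip1 f ('D_1 eta) = 0) ->
  ae_eq leb setT f (cst 0).
Proof.
move=> hf f0.
have key (p q : R -> R^o) : test_function setT p -> test_function setT q ->
    (\int[leb]_x p x) * ip1 f q = (\int[leb]_x q x) * ip1 f p.
  move=> tp tq; set P := \int[leb]_x p x; set Q := \int[leb]_x q x.
  have t0 : test_function setT (cst 0 : R -> R^o) := test_cst0 _.
  have tPq : test_function setT (cst 0 \+ (P \*o q)) by exact: test_lin.
  have tpsi := test_lin (- Q) tPq tp.
  have [] := test_primitive tpsi.
    have ip_ := test_integrable_line tp; have iq := test_integrable_line tq.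
    rewrite (@eq_Rintegral _ _ _ leb _ (fun x => P * q x - Q * p x)); last first.
      by move=> x _ /=; rewrite add0r mulNr.
    rewrite RintegralB// ?RintegralZl//; [|exact: integrableZR|exact: integrableZR].
    by rewrite -/P -/Q mulrC subrr.
  move=> Psi tPsi dPsi; have := f0 _ tPsi; rewrite dPsi.
  have hp := test_L2_line tp; have hq := test_L2_line tq.
  rewrite (_ : _ \+ _ = (P \*o q) \+ (- Q \*o p)); last first.
    by apply/funext => x /=; rewrite add0r.
  rewrite ipDr ?ipZr//; [|exact: L2Z|exact: L2Z].
  by move=> h; apply/eqP; rewrite -subr_eq0 -mulNr h.
apply: L2_line_eq => //; first exact: L20.
move=> eta te; have he := test_L2_line te; rewrite ip0l.
set a := ip1 f eta; set b := \int[leb]_x eta x.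
have arith (x y z m : R) : 0 < m -> (m * x) ^+ 2 <= y ^+ 2 * (z * m) ->
    x ^+ 2 * m <= y ^+ 2 * z.
  move=> m0 h; rewrite -(ler_pM2l m0) (le_trans _ (le_trans h _))// le_eqVlt; apply/orP; left.
    by apply/eqP; ring.
  by apply/eqP; ring.
have bound (N : nat) : a ^+ 2 * N%:R <= b ^+ 2 * ip1 f f.
  pose w := \1_(`]0, N%:R]%classic) : R1 -> R.
  have hw : w \in L1 := ocitv_L2 0 N%:R.
  have c1 : (fun n => b * ip1 f (bump 0 N%:R n)) @ \oo --> b * ip1 f w.
    apply: cvgMr; have := cvgL2_weak (fun n => test_L2_line (test_bump 0 N%:R n)) hw
      (cvgL2_bump 0 N%:R) hf.
    by move=> h; apply: (eq_cvg_to h) => [n|]; rewrite ipC.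
  have c2 : (fun n => b * ip1 f (bump 0 N%:R n)) @ \oo --> N%:R * a.
    have h := integral_bump (ler0n R N).
    apply: (eq_cvg_to (cvgM h (cvg_cst a))) => [n|]; last by rewrite subr0.
    exact/esym/(key eta _ te (test_bump _ _ _)).
  have E : b * ip1 f w = N%:R * a by apply: (cvg_unique _ c1 c2).
  have ww : ip1 w w = N%:R.
    rewrite /ip (_ : (fun x => _) = w); last first.
      by apply/funext => x; rewrite /w indicE; case: (_ \in _); rewrite ?mulr1 ?mulr0.
    rewrite /Rintegral integral_indic ?setIT//.
    rewrite [leb _]lebesgue_measure_itv/= lte_fin; case: ltP => [_|]/=; first by rewrite subr0.
    by move=> h; apply/esym/eqP; rewrite eq_le h/=.
  have := CauchySchwarz hf hw; rewrite ww => cs.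
  have [->|N0] := posnP N; first by rewrite mulr0 mulr_ge0 ?sqr_ge0 ?ip_ge0.
  have Np : (0 : R) < N%:R by rewrite ltr0n.
  apply: (arith a b _ N%:R Np).
  by rewrite -E exprMn ler_wpM2l// sqr_ge0.
apply/eqP; rewrite -sqrf_eq0; apply/negP => /negP a0.
have ap : 0 < a ^+ 2 by rewrite lt_neqAle eq_sym a0 sqr_ge0.
have X0 : 0 <= b ^+ 2 * ip1 f f / a ^+ 2.
  by rewrite divr_ge0 ?sqr_ge0// mulr_ge0 ?sqr_ge0 ?ip_ge0.
have := archi_boundP X0; rewrite ltr_pdivrMr// [ltRHS]mulrC => h.
by have := lt_le_trans h (bound _); rewrite ltxx.
Qed.

(** * H^1_0 of the sides and functions of zero trace *)

Lemma cvgL2_ae d (T : measurableType d) (mu : {measure set T -> \bar R})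
    (u_ : nat -> T -> R) (u u' : T -> R) :
  (forall n, u_ n \in Lfun mu 2%:E) -> u \in Lfun mu 2%:E -> u' \in Lfun mu 2%:E ->
  ae_eq mu setT u u' -> cvgL2 mu u_ u -> cvgL2 mu u_ u'.
Proof.
move=> hu_ hu hu' uu' c; apply: (eq_cvg_to c) => // n.
have E : ae_eq mu setT (u_ n \- u) (u_ n \- u').
  by apply: ae_mono uu' => x h xT /=; rewrite h.
by apply: eq_ip => //; exact: L2B.
Qed.

Lemma cvgH1_sob (phi_ : nat -> R * R -> R^o) (u g1 g2 : R * R -> R) :
  (u : R2 -> R) \in L2 -> (g1 : R2 -> R) \in L2 -> (g2 : R2 -> R) \in L2 ->
  (forall n, test_function setT (phi_ n)) -> cvgH1 phi_ u g1 g2 -> sob u g1 g2.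
Proof.
move=> hu hg1 hg2 tp [c0 c1 c2].
have H v g : v = e1 \/ v = e2 -> (g : R2 -> R) \in L2 ->
    cvgL2 leb2 (fun n => 'D_v (phi_ n)) g -> wderiv v u g.
  move=> hv hg c; split=> // psi tpsi.
  have l1 := cvgL2_weak (fun n => test_L2 (tp n)) hu c0 (test_L2 (test_derive v tpsi)).
  have l2 := cvgL2_weak (fun n => test_L2 (test_derive v (tp n))) hg c (test_L2 tpsi).
  have l3 : (fun n => ip2 (phi_ n) ('D_v psi)) @ \oo --> - ip2 g psi.
    by apply: (eq_cvg_to (cvgN l2)) => // n; rewrite (test_ibp hv (tp n) tpsi).
  by rewrite -(cvg_unique _ l1 l3).
by split=> //; apply: H => //; [left|right].
Qed.

Lemma restr_test (W : set (R * R)) (phi : R * R -> R^o) : test_function W phi ->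
  restr W phi = phi.
Proof.
move=> tp; apply/funext => x; rewrite /restr indicE.
have [Wx|nW] := pselect (W x); first by rewrite mem_set// mulr1.
by rewrite (test_supp tp nW) mul0r.
Qed.

(** Test functions of the side and their derivatives vanish off it, so approximation on the side is
    approximation on the whole plane of the function extended by zero. *)
Lemma cvgH1_restr (phi_ : nat -> R * R -> R^o) s (u g1 g2 : R * R -> R) :
  (forall n, test_function (side s) (phi_ n)) ->
  (restr (side s) u : R2 -> R) \in L2 -> wpart (side s) e1 u g1 -> wpart (side s) e2 u g2 ->
  (H1norm2 (side s) (phi_ n \- u) @[n --> \oo] --> 0%E) <->
  cvgH1 phi_ (restr (side s) u) (restr (side s) g1) (restr (side s) g2).
Proof.
move=> tp hu w1 w2.
rewrite (H1norm2_cvg (@separating_side s) (measurable_side s) hu w1 w2 _); last first.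
  by move=> n; exact: test_subset (tp n).
have E (a_ : nat -> R * R -> R^o) : (forall n, test_function (side s) (a_ n)) ->
    (fun n => restr (side s) (a_ n)) = a_.
  by move=> ta; apply/funext => n; rewrite restr_test.
rewrite /cvgH1 !(E phi_ tp) (E (fun n => 'D_e1 (phi_ n))).
  by rewrite (E (fun n => 'D_e2 (phi_ n)))// => n; exact: test_derive.
by move=> n; exact: test_derive.
Qed.

(* A zero trace kills the boundary term of Green's formula, so that u cut off to one
   side is in H^1 of the plane, and the mollifier keeps it on that side. *)
Lemma trace0_H10 (u g1 g2 : R * R -> R) s : s = 1 \/ s = -1 -> sob u g1 g2 ->
  trace_of u (cst 0) -> H10 (side s) u.
Proof.
move=> hs su t0; have [hu w1 w2] := su; have [hg1 _] := w1; have [hg2 _] := w2.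
have mh := measurable_side s.
have ws1 := wpart_restrict mh hu w1; have ws2 := wpart_restrict mh hu w2.
have hru := restr_L2 mh hu.
have sv : sob (restr (side s) u) (restr (side s) g1) (restr (side s) g2).
  split=> //; (split; first exact: restr_L2); move=> phi tphi.
    exact: sob_green1 su tphi.
  by rewrite (sob_green2 hs su t0 tphi) ip0l mulr0 subr0.
have ns : `|s| = 1 by case: hs => ->; rewrite ?normrN normr1.
split.
  split; first by rewrite /L2on patch_restr.
  - by exists g1; apply/weak_partial_ofE.
  - by exists g2; apply/weak_partial_ofE.
have [phi [_ cphi tphi]] := cvgH1_approx ns sv.
have {}tphi : forall n, test_function (side s) (phi n).
  by apply: tphi => x nx; rewrite /restr indicE memNset ?mulr0.
by exists phi; split; [|exact/(cvgH1_restr tphi hru ws1 ws2)].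
Qed.

Lemma H10_approx (u : R * R -> R) s : H10 (side s) u ->
  exists (phi_ : nat -> R * R -> R^o) g1 g2, [/\ forall n, test_function (side s) (phi_ n),
    (restr (side s) u : R2 -> R) \in L2, (restr (side s) g1 : R2 -> R) \in L2,
    (restr (side s) g2 : R2 -> R) \in L2 &
    cvgH1 phi_ (restr (side s) u) (restr (side s) g1) (restr (side s) g2)].
Proof.
move=> [[hu [g1 /weak_partial_ofE w1] [g2 /weak_partial_ofE w2]] [phi [tp c]]].
have {}hu : (restr (side s) u : R2 -> R) \in L2 by rewrite -patch_restr.
exists phi, g1, g2; split=> //; [by have [] := w1|by have [] := w2|].
exact/(cvgH1_restr tp hu w1 w2).
Qed.

(** The sum of the two approximating sequences converges in H^1 of the plane, the axis being null,
    and its terms vanish on the axis. *)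
Lemma H10_trace0 (u : R * R -> R) : (u : R2 -> R) \in L2 ->
  H10 (@upper R) u -> H10 (@lower R) u ->
  exists g1 g2, sob u g1 g2 /\ trace_of u (cst 0).
Proof.
move=> hu; rewrite upperE lowerE => /H10_approx[p [g1 [g2 [tp hpu hg1 hg2 [p0 p1 p2]]]]].
move=> /H10_approx[q [h1 [h2 [tq hqu hh1 hh2 [q0 q1 q2]]]]].
have tpT n := test_subset (@subsetT _ _) (tp n).
have tqT n := test_subset (@subsetT _ _) (tq n).
pose phi n : R * R -> R^o := p n \+ (1 \*o q n).
have tphi n : test_function setT (phi n) by exact: test_lin.
pose G1 := restr (side 1) g1 \+ restr (side (-1)) h1.
pose G2 := restr (side 1) g2 \+ restr (side (-1)) h2.
have hG1 : (G1 : R2 -> R) \in L2 by exact: L2D.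
have hG2 : (G2 : R2 -> R) \in L2 by exact: L2D.
have phiE n : phi n = (p n : R2 -> R) \+ q n by apply/funext => x; rewrite /phi /= mul1r.
have dphiE v n : 'D_v (phi n) = ('D_v (p n) : R2 -> R) \+ 'D_v (q n).
  apply/funext => x; have [sp _ _] := tpT n; have [sq _ _] := tqT n.
  rewrite phiE; apply: deriveD; exact: smooth_derivable.
have c : cvgH1 phi u G1 G2.
  split.
  - apply: (@cvgL2_ae _ R2 leb2 _ (restr (side 1) u \+ restr (side (-1)) u)) => //.
    + by move=> n; exact: test_L2.
    + exact: L2D.
    + apply: ae_mono (ae_slit_plane R) => x sx _ /=; rewrite /restr -mulrDr.
      by rewrite -indic_slit_plane indicE mem_set// mulr1.
    + rewrite (_ : phi = fun n => (p n : R2 -> R) \+ q n); last by apply/funext.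
      by apply: cvgL2D => // n; exact: test_L2.
  - rewrite (_ : (fun n => _) = fun n => ('D_e1 (p n) : R2 -> R) \+ 'D_e1 (q n)); last exact/funext.
    by apply: cvgL2D => // n; apply: test_L2; exact: test_derive.
  - rewrite (_ : (fun n => _) = fun n => ('D_e2 (p n) : R2 -> R) \+ 'D_e2 (q n)); last exact/funext.
    by apply: cvgL2D => // n; apply: test_L2; exact: test_derive.
exists G1, G2; have su := cvgH1_sob hu hG1 hG2 tphi c; split=> //.
apply/(trace_ofP _ su); split; first exact: L20.
exists phi; split=> //; rewrite (_ : (fun n x => _) = fun n => cst 0).
  exact: cvgL2_cst.
apply/funext => n; apply/funext => x; rewrite phiE /=.
rewrite (test_supp (tp n)) ?(test_supp (tq n)) ?addr0// /side /= mulr0 ltxx//.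
Qed.

(** * Elements of H and values of the three energies *)

Lemma HL2 (u : H) : (u : R2 -> R) \in L2.
Proof.
case: u => f [[hf]] /=; apply/andP; split; rewrite inE/=.
  exact: (@measurable_funPT _ _ _ _ (repr f)).
exact: hf.
Qed.

(** An element of H coerces to a chosen representative of its class, which agrees with f only almost
    everywhere; hence the a.e. invariance statements that follow. *)
Lemma H_of_L2 (f : R2 -> R) : f \in L2 -> exists u : H, ae_eq leb2 setT (u : R2 -> R) f.
Proof.
move=> hf; have mf : @measurable_fun _ _ R2 R1 setT f := L2_measurable hf.
pose F : {mfun R2 >-> R1} := HB.pack f (isMeasurableFun.Build _ _ R2 R1 f mf).
pose q : {mfun_ leb2, R2 >-> R1} := (\pi_({mfun_ leb2, R2 >-> R1}) F)%qT.
have : (F == repr q %[mod {mfun_ leb2, R2 >-> R1}])%qT by rewrite reprK.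
rewrite eqmodE => /asboolP Fq.
have qf : ae_eq leb2 setT (repr q : R2 -> R) f.
  by apply: ae_mono Fq => x h _; rewrite -h.
have mq : (repr q : R2 -> R) \in L2.
  have mr : @measurable_fun _ _ R2 R1 setT (repr q) := measurable_funPT _.
  apply/L2P; split; first exact: mr.
  have [_ fin] := (L2P leb2 f).1 hf.
  rewrite (@ae_eq_integral _ R2 _ leb2 _ (fun x => (f x ^+ 2)%:E))//.
  - by apply/measurable_EFinP; exact: measurable_funX.
  - by apply/measurable_EFinP; exact: measurable_funX.
  - by apply: ae_mono qf => x h _; rewrite h.
have fin : finite_norm leb2 2%:E q by move: mq; rewrite inE => /andP[_]; rewrite inE.
pose u : H := HB.pack q (isFinLebesgue.Build _ R2 R leb2 2%:E (lee1n 2) q fin).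
by exists u.
Qed.

Lemma Lnorm2 (w : R2 -> R) : w \in L2 ->
  ('N[leb2]_2%:E[EFin \o w] = (Num.sqrt (ip2 w w))%:E)%E.
Proof.
move=> hw; rewrite unlock /Lnorm.
rewrite (@eq_integral _ _ _ leb2 setT (fun x => (w x ^+ 2)%:E)); last first.
  by move=> x _; rewrite /= powR_mulrn// real_normK// num_real.
by rewrite -ip_sqrE// poweR_EFin powR12_sqrt// ip_ge0.
Qed.

Lemma strong_cvgE (u_ : nat -> H) (u : H) :
  cvgL2 leb2 (fun n => u_ n : R2 -> R) u -> strong_cvg u_ u.
Proof.
move=> c; rewrite /strong_cvg.
have E n : ('N[leb2]_2%:E[EFin \o ((u_ n : R2 -> R) \- u)%R] =
    (Num.sqrt (ip2 ((u_ n : R2 -> R) \- u) ((u_ n : R2 -> R) \- u))%R)%:E)%E.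
  by rewrite Lnorm2//; apply: L2B; exact: HL2.
under eq_fun do rewrite E; apply: EFin_cvgn; rewrite -[X in _ --> X](@sqrtr0 R).
by apply: continuous_cvg c; exact: sqrt_continuous.
Qed.

Lemma ae_eq_refl_cst d (T : measurableType d) (mu : {measure set T -> \bar R}) (f : T -> R) :
  ae_eq mu setT f f.
Proof. by apply: aeW => x _. Qed.

Lemma ae_eq_flip d (T : measurableType d) (mu : {measure set T -> \bar R}) (f g : T -> R) :
  ae_eq mu setT f g -> ae_eq mu setT g f.
Proof. by apply: ae_mono => x h xT; rewrite h. Qed.

Lemma eq_ipl d (T : measurableType d) (mu : {measure set T -> \bar R}) (f f' g : T -> R) :
  f \in Lfun mu 2%:E -> f' \in Lfun mu 2%:E -> g \in Lfun mu 2%:E ->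
  ae_eq mu setT f f' -> ip mu f g = ip mu f' g.
Proof. by move=> hf hf' hg ff'; apply: eq_ip => //; exact: ae_eq_refl_cst. Qed.

Lemma sob_ae (u u' g1 g2 : R * R -> R) : (u' : R2 -> R) \in L2 ->
  ae_eq leb2 setT (u : R2 -> R) u' -> sob u g1 g2 -> sob u' g1 g2.
Proof.
move=> hu' uu' [hu [hg1 w1] [hg2 w2]].
split=> //; split=> // phi tp; rewrite -(w1, w2)//; apply: eq_ipl => //.
- by apply: test_L2; exact: test_derive.
- exact: ae_eq_flip.
- by apply: test_L2; exact: test_derive.
- exact: ae_eq_flip.
Qed.

Lemma trace_of_ae (u u' g1 g2 : R * R -> R) (f f' : R -> R) : sob u g1 g2 ->
  (u' : R2 -> R) \in L2 -> ae_eq leb2 setT (u : R2 -> R) u' ->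
  (f' : R1 -> R) \in L1 -> ae_eq leb setT (f : R1 -> R) f' ->
  trace_of u f -> trace_of u' f'.
Proof.
move=> su hu' uu' hf' ff' /(trace_ofP f su)[hf [phi [tp [c0 c1 c2] ct]]].
have [hu _ _] := su.
apply/(trace_ofP f' (sob_ae hu' uu' su)); split=> //; exists phi; split=> //.
  by split=> //; apply: cvgL2_ae uu' c0 => // n; exact: test_L2.
by apply: cvgL2_ae ff' ct => // n; exact: test_L2_line (test_trace (tp n)).
Qed.

Lemma weak_deriv_of_ae (f f' g : R -> R) : (f : R1 -> R) \in L1 -> (f' : R1 -> R) \in L1 ->
  ae_eq leb setT (f : R1 -> R) f' -> weak_deriv_of f g -> weak_deriv_of f' g.
Proof.
move=> hf hf' ff' /weak_deriv_ofE[hg H]; apply/weak_deriv_ofE; split=> // eta te.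
rewrite -H//; apply: eq_ipl => //; last exact: ae_eq_flip.
by apply: test_L2_line; exact: test_derive.
Qed.

Lemma dirichletT (u g1 g2 : R * R -> R) : sob u g1 g2 ->
  dirichlet setT u = (ip2 g1 g1 + ip2 g2 g2)%:E.
Proof.
move=> [hu /wpartT w1 /wpartT w2].
by rewrite (dirichletE separatingT measurableT w1 w2) !restrT.
Qed.

(** The weak gradient on the plane restricts to a weak gradient on the slit plane, and the axis is
    null. *)
Lemma dirichlet_slit (u g1 g2 : R * R -> R) : sob u g1 g2 ->
  dirichlet (@slit_plane R) u = (ip2 g1 g1 + ip2 g2 g2)%:E.
Proof.
move=> [hu w1 w2]; have mS := @measurable_slit_plane R.
rewrite (dirichletE separating_slit mS (wpart_restrict mS hu w1) (wpart_restrict mS hu w2)).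
have E (g : R2 -> R) : g \in L2 ->
    ip2 (restr (@slit_plane R) g) (restr (@slit_plane R) g) = ip2 g g.
  move=> hg; have hr := restr_L2 mS hg.
  have a : ae_eq leb2 setT (restr (@slit_plane R) g) g.
    by apply: ae_mono (ae_slit_plane R) => x sx _; rewrite /restr indicE mem_set// mulr1.
  exact: eq_ip.
by congr (_ + _)%:E; apply: E; [have [] := w1|have [] := w2].
Qed.

Lemma formI_energy (u : H) (g1 g2 : R * R -> R) : sob u g1 g2 ->
  Defs.extended (@formI R) u = (2^-1 * (ip2 g1 g1 + ip2 g2 g2))%:E.
Proof.
move=> su; rewrite /Defs.extended; case: asboolP => [_|[]] /=.
  by rewrite (dirichletT su) -EFinM.
by apply/H1_sob; exists g1, g2.
Qed.

Lemma formI_dom (u : H) : domain (@formI R) u -> exists g1 g2, sob u g1 g2.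
Proof. by move=> /H1_sob. Qed.

Lemma formV_energy (u : H) (g1 g2 : R * R -> R) : sob u g1 g2 -> trace_of u (cst 0) ->
  Defs.extended (@formV R) u = (2^-1 * (ip2 g1 g1 + ip2 g2 g2))%:E.
Proof.
move=> su t0; rewrite /Defs.extended; case: asboolP => [_|[]] /=.
  by rewrite (dirichlet_slit su) -EFinM.
by rewrite upperE lowerE; split; apply: trace0_H10 su t0; [left|right].
Qed.

Lemma formV_dom (u : H) : domain (@formV R) u ->
  exists g1 g2, sob u g1 g2 /\ trace_of u (cst 0).
Proof. by move=> [hp hm]; apply: H10_trace0 => //; exact: HL2. Qed.

Lemma formIV_energy (u : H) (g1 g2 : R * R -> R) (h : R -> R) (lambda : R) :
  sob u g1 g2 -> weak_deriv_of (trace u) h ->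
  Defs.extended (formIV lambda) u =
  (2^-1 * (ip2 g1 g1 + ip2 g2 g2) + lambda * ip1 h h)%:E.
Proof.
move=> su dh; have [hf _] := traceP su; have [[hd _] dE] := weak_derivP dh.
have [hh _] := dh.
rewrite /Defs.extended; case: asboolP => [_|[]] /=.
  rewrite (dirichletT su) -(@ip_sqrE _ R1 _ leb)// -!EFinM -EFinD.
  by congr (_ + _ * _)%:E; exact: eq_ip.
by split; [apply/H1_sob; exists g1, g2|split=> //; exists h].
Qed.

Lemma formIV_dom (lambda : R) (u : H) : domain (formIV lambda) u ->
  exists g1 g2 h, sob u g1 g2 /\ weak_deriv_of (trace u) h.
Proof. by move=> [/H1_sob[g1 [g2 su]] [_ [h dh]]]; exists g1, g2, h. Qed.

Lemma form_at_pos (r : R) : 0 < r -> form_at r%:E = formIV r.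
Proof. by move=> r0; rewrite /form_at gt_eqF. Qed.

(** * The lower bound *)

Lemma extended_finite (r C : R) (u : H) : 0 < r -> (Defs.extended (form_at r%:E) u < C%:E)%E ->
  exists g1 g2 h, [/\ sob u g1 g2, weak_deriv_of (trace u) h &
    2^-1 * (ip2 g1 g1 + ip2 g2 g2) + r * ip1 h h <= C].
Proof.
move=> r0; rewrite form_at_pos//; have [/formIV_dom|nd] := pselect (domain (formIV r) u).
  move=> [g1 [g2 [h [su dh]]]]; rewrite (formIV_energy r su dh) lte_fin => /ltW.
  by exists g1, g2, h.
by rewrite /Defs.extended asboolF.
Qed.

(** Each squared norm is replaced by its tangent at the limit, which converges under weak
    convergence even when multiplied by the varying [b_ n]. Nonnegative coefficients keep the
    inequality in the right direction. *)
Lemma cvgL2w_lsc (g1_ g2_ : nat -> R2 -> R) (g1 g2 : R2 -> R) (h_ : nat -> R1 -> R)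
    (h : R1 -> R) (b_ : nat -> R) (b C : R) :
  (forall n, g1_ n \in L2) -> (forall n, g2_ n \in L2) -> (forall n, h_ n \in L1) ->
  g1 \in L2 -> g2 \in L2 -> h \in L1 ->
  cvgL2w leb2 g1_ g1 -> cvgL2w leb2 g2_ g2 -> cvgL2w leb h_ h ->
  (forall n, 0 <= b_ n) -> b_ @ \oo --> b ->
  (forall n, 2^-1 * (ip2 (g1_ n) (g1_ n) + ip2 (g2_ n) (g2_ n)) + b_ n * ip1 (h_ n) (h_ n) <= C) ->
  2^-1 * (ip2 g1 g1 + ip2 g2 g2) + b * ip1 h h <= C.
Proof.
move=> hg1_ hg2_ hh_ hg1 hg2 hh c1 c2 ch b0 cb le_.
have ct : (fun n => 2^-1 * ((2 * ip2 (g1_ n) g1 - ip2 g1 g1) + (2 * ip2 (g2_ n) g2 - ip2 g2 g2)) +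
    b_ n * (2 * ip1 (h_ n) h - ip1 h h)) @ \oo -->
    2^-1 * (ip2 g1 g1 + ip2 g2 g2) + b * ip1 h h.
  apply: cvgD; apply: cvgM => //; last exact: cvg_ip_tangent hh ch.
    exact: cvg_cst.
  by apply: cvgD; [exact: cvg_ip_tangent hg1 c1|exact: cvg_ip_tangent hg2 c2].
rewrite -(cvg_lim _ ct)//; apply: limr_le; first exact: cvgP ct.
apply: nearW => n; apply: le_trans (le_ n).
by apply: lerD; rewrite ler_wpM2l// ?lerD//; exact: ip_tangent_le.
Qed.

Lemma cvgL2w_lsc2 (g1_ g2_ : nat -> R2 -> R) (g1 g2 : R2 -> R) (C : R) :
  (forall n, g1_ n \in L2) -> (forall n, g2_ n \in L2) -> g1 \in L2 -> g2 \in L2 ->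
  cvgL2w leb2 g1_ g1 -> cvgL2w leb2 g2_ g2 ->
  (forall n, 2^-1 * (ip2 (g1_ n) (g1_ n) + ip2 (g2_ n) (g2_ n)) <= C) ->
  2^-1 * (ip2 g1 g1 + ip2 g2 g2) <= C.
Proof.
move=> hg1_ hg2_ hg1 hg2 c1 c2 le_; have h0 : (cst 0 : R1 -> R) \in L1 := L20 leb.
have := @cvgL2w_lsc g1_ g2_ g1 g2 (fun=> cst 0) (cst 0) (fun=> 0) 0 C.
rewrite mul0r addr0; apply=> //; last by move=> n; rewrite addr0.
- by move=> v _; exact: cvg_cst.
- exact: cvg_cst.
Qed.

Lemma bounded_of_energy (x y b z C : R) : 0 <= x -> 0 <= y -> 0 <= b -> 0 <= z ->
  2^-1 * (x + y) + b * z <= C -> [/\ x <= 2 * C, y <= 2 * C & b * z <= C].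
Proof. by move=> x0 y0 b0 z0; have := mulr_ge0 b0 z0; move: (b * z) => t *; split; lra. Qed.

(** The pairings of the gradients with phi are the opposites of those of [w_ n] with ['D_v phi],
    whose limits are known, so [weak_limit_dense] applies. *)
Lemma weak_limit_sob (w_ : nat -> R2 -> R) (u : R2 -> R) (g1_ g2_ : nat -> R * R -> R) C :
  u \in L2 -> (forall n, sob (w_ n) (g1_ n) (g2_ n)) ->
  (forall n, ip2 (g1_ n) (g1_ n) <= C) -> (forall n, ip2 (g2_ n) (g2_ n) <= C) ->
  cvgL2w leb2 w_ u ->
  exists g1 g2, [/\ sob u g1 g2, cvgL2w leb2 g1_ g1 & cvgL2w leb2 g2_ g2].
Proof.
move=> hu sw b1 b2 cw.
have H v (g_ : nat -> R * R -> R) : (forall n, wderiv v (w_ n) (g_ n)) ->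
    (forall n, ip2 (g_ n) (g_ n) <= C) -> exists2 g, wderiv v u g & cvgL2w leb2 g_ g.
  move=> wg bg.
  have [n|f tf|g [hg Lg cg]] := @weak_limit_dense _ R2 _ leb2
    (test_function setT : set (R * R -> R^o)) g_ (fun phi => - ip2 u ('D_v phi)) C
    (@subspace_test R) (@dense_test R) _ bg _.
  - by have [] := wg n.
  - apply: (eq_cvg_to (cvgN (cw _ (test_L2 (test_derive v tf))))) => // n.
    have [_ W] := wg n; have E := W f tf.
    have -> : ip2 (g_ n) f = - - ip2 (g_ n) f by rewrite opprK.
    exact: (congr1 -%R E).
  by exists g => //; split=> // phi tp; rewrite -Lg// opprK.
have [n|g1 w1 c1] := H e1 g1_ _ b1; first by have [] := sw n.
have [n|g2 w2 c2] := H e2 g2_ _ b2; first by have [] := sw n.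
by exists g1, g2.
Qed.

(** Tested against [eta], the trace is by [trace_collar] a weakly continuous function of u and its
    vertical derivative. *)
Lemma weak_limit_trace (w_ : nat -> R2 -> R) (u : R2 -> R) (g1_ g2_ : nat -> R * R -> R)
    (g1 g2 : R * R -> R) (eta : R -> R^o) :
  (forall n, sob (w_ n) (g1_ n) (g2_ n)) -> sob u g1 g2 ->
  cvgL2w leb2 w_ u -> cvgL2w leb2 g2_ g2 -> test_function setT eta ->
  (fun n => ip1 (trace (w_ n)) eta) @ \oo --> ip1 (trace u) eta.
Proof.
move=> sw su cw c2 te; have mh := measurable_side (1 : R).
have tl := test_collar te.
have l1 := cw _ (restr_L2 mh (test_L2 (test_derive e2 tl))).
have l2 := c2 _ (restr_L2 mh (test_L2 tl)).
have E v h1 h2 : sob v h1 h2 -> - ip2 h2 (restr (side 1) (collar eta)) -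
    ip2 v (restr (side 1) ('D_e2 (collar eta))) = ip1 (trace v) eta.
  move=> sv; apply: esym; apply: (etrans (trace_collar sv (traceP sv) te)).
  by rewrite (restr_sym _ h2) (restr_sym _ v).
by apply: (eq_cvg_to (cvgB (cvgN l2) l1)) => [n|]; [exact: E (sw n)|exact: E su].
Qed.

(** Reduces the lower bound to real C above the lower limit, for which infinitely many energies lie
    below C; this also covers infinite lower limits. *)
Lemma lee_of_bounds (x y : \bar R) : (forall C : R, (y < C%:E)%E -> (x <= C%:E)%E) -> (x <= y)%E.
Proof.
case: y => [y| |] h; last 2 first.
- by rewrite leey.
- case: x h => [x||] // h.
    by have := h (x - 1)%R (ltNyr _); rewrite lee_fin lerDl oppr_ge0 ler10.
  by have := h 0%R (ltNyr _).
- by apply/lee_addgt0Pr => e e0; apply: h; rewrite lte_fin ltrDl.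
Qed.

(** Choosing one index past each N yields a map that tends to infinity, monotone or not. *)
Lemma cvg_subseq (k : nat -> nat) : (forall N, (N <= k N)%N) -> k @ \oo --> \oo.
Proof.
move=> hk; apply/cvgnyPge => A; near=> n.
by apply: leq_trans (hk n); near: n; exact: nbhs_infty_ge.
Unshelve. all: by end_near. Qed.

Lemma weak_cvg_sub (u_ : nat -> H) (u : H) (k : nat -> nat) : (forall N, (N <= k N)%N) ->
  weak_cvg u_ u -> cvgL2w leb2 (fun n => u_ (k n) : R2 -> R) u.
Proof.
move=> hk c v hv; have [w wv] := H_of_L2 hv.
have E (a : H) : ip2 a w = ip2 a v.
  by rewrite ipC [RHS]ipC; apply: eq_ipl => //; exact: HL2.
have cw : (fun n => ip2 (u_ n) w) @ \oo --> ip2 u w := c w.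
apply: (eq_cvg_to (cvg_comp _ _ (cvg_subseq hk) cw)) => [n|]; exact: E.
Qed.

Section liminf.
Context (al : nat -> R) (u_ : nat -> H) (u : H) (C : R)
  (hal : forall l : nat, (1 <= l)%N -> 0 < al l) (cu : weak_cvg u_ u)
  (ltC : (limn_einf (fun l => Defs.extended (form_at (al l)%:E) (u_ l)) < C%:E)%E).

(** [N0] skips the indices at which a lower bound on [al] is not yet valid, and [n.+1] keeps the
    indices at least 1, where [al] is known to be positive. *)
Lemma liminf_extract (N0 : nat) : exists (k : nat -> nat) (g1_ g2_ : nat -> R * R -> R)
    (h_ : nat -> R -> R) (g1 g2 : R * R -> R),
  [/\ forall n, (N0 + n.+1 <= k n)%N,
      forall n, [/\ sob (u_ (k n)) (g1_ n) (g2_ n), weak_deriv_of (trace (u_ (k n))) (h_ n),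
        2^-1 * (ip2 (g1_ n) (g1_ n) + ip2 (g2_ n) (g2_ n)) + al (k n) * ip1 (h_ n) (h_ n) <= C &
        al (k n) * ip1 (h_ n) (h_ n) <= C],
      sob u g1 g2, cvgL2w leb2 g1_ g1 &
      cvgL2w leb2 g2_ g2 /\ (forall eta : R -> R^o, test_function setT eta ->
        (fun n => ip1 (trace (u_ (k n))) eta) @ \oo --> ip1 (trace u) eta)].
Proof.
have /choice[k hk] n : exists l, (N0 + n.+1 <= l)%N /\
    (Defs.extended (form_at (al l)%:E) (u_ l) < C%:E)%E.
  by have [l hl ll] := limn_einf_lt ltC (N0 + n.+1); exists l.
have k1 n : (1 <= k n)%N by have [h _] := hk n; apply: leq_trans h; rewrite addnS.
have kn n : (n <= k n)%N by have [h _] := hk n; apply: leq_trans h; rewrite addnS ltnW// ltnS leq_addl.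
have ak n : 0 < al (k n) := hal (k1 n).
have /choice[g1_ /choice[g2_ /choice[h_ H]]] n := extended_finite (ak n) (hk n).2.
have bnd n : [/\ ip2 (g1_ n) (g1_ n) <= 2 * C, ip2 (g2_ n) (g2_ n) <= 2 * C &
    al (k n) * ip1 (h_ n) (h_ n) <= C].
  by have [_ _] := H n; apply: bounded_of_energy; rewrite ?ip_ge0// ltW.
have sw n : sob (u_ (k n)) (g1_ n) (g2_ n) by have [] := H n.
have cw := weak_cvg_sub kn cu.
have [n|n|g1 [g2 [su c1 c2]]] := weak_limit_sob (C := 2 * C) (HL2 u) sw _ _ cw.
- by have [] := bnd n.
- by have [] := bnd n.
exists k, g1_, g2_, h_, g1, g2; split=> //.
- by move=> n; have [] := hk n.
- by move=> n; have [? ? ?] := H n; have [_ _ ?] := bnd n.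
- by split=> // eta te; exact: weak_limit_trace sw su cw c2 te.
Qed.

Lemma liminf_dirichlet : exists g1 g2, sob u g1 g2 /\
  2^-1 * (ip2 g1 g1 + ip2 g2 g2) <= C.
Proof.
have [k [g1_ [g2_ [h_ [g1 [g2 [hk H su c1 [c2 _]]]]]]]] := liminf_extract 0.
exists g1, g2; split=> //.
have [hu [hg1 _] [hg2 _]] := su.
apply: (@cvgL2w_lsc2 g1_ g2_) => // n.
- by have [[_ [] ]] := H n.
- by have [[_ _ []]] := H n.
- have [_ _ + _] := H n; apply: le_trans.
  have l1 : (1 <= k n)%N by apply: leq_trans (hk n).
  by rewrite lerDl mulr_ge0// ?ip_ge0// ltW// hal.
Qed.

End liminf.

Lemma liminf_formIV (al : nat -> R) (u_ : nat -> H) (u : H) (C r : R) :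
  (forall l : nat, (1 <= l)%N -> 0 < al l) -> weak_cvg u_ u ->
  (limn_einf (fun l => Defs.extended (form_at (al l)%:E) (u_ l)) < C%:E)%E ->
  0 < r -> al @ \oo --> r -> (Defs.extended (formIV r) u <= C%:E)%E.
Proof.
move=> hal cu ltC r0 alr; have r2 : 0 < r / 2 by rewrite divr_gt0.
(* Beyond N0 the coefficient is at least r / 2, so the line energies bound the squared norms of the
   derivatives of the traces by 2 C / r. *)
have [N0 hN0] : exists N0, forall n, (N0 <= n)%N -> r / 2 <= al n.
  have rr : r / 2 < r by lra.
  by have [N0 _ h] := cvgr_ge _ alr _ rr; exists N0 => n /h.
have [k [g1_ [g2_ [h_ [g1 [g2 [hk H0 su c1 [c2 ct]]]]]]]] := liminf_extract hal cu ltC N0.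
have kn n : (n <= k n)%N by apply: leq_trans (hk n); rewrite addnS ltnW// ltnS leq_addl.
have ak n : r / 2 <= al (k n) by apply: hN0; apply: leq_trans (hk n); rewrite leq_addr.
have [hu [hg1 _] [hg2 _]] := su.
have hh n : (h_ n : R1 -> R) \in L1 by have [_ [? _]] := H0 n.
have bh n : ip1 (h_ n) (h_ n) <= C / (r / 2).
  have [_ _ _ le_] := H0 n; rewrite ler_pdivlMr// mulrC; apply: le_trans le_.
  by rewrite ler_wpM2r ?ip_ge0.
have [eta te|h [hh0 Lh ch]] := @weak_limit_dense _ R1 _ leb
    (test_function setT : set (R -> R^o)) h_ (fun eta => - ip1 (trace u) ('D_1 eta)) _
    (@subspace_test_line R) (@dense_test_line R) hh bh _.
  have c := ct ('D_(1 : R) eta) (test_derive (1 : R) te).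
  apply: (eq_cvg_to (cvgN c)) => // n.
  have [_ /weak_deriv_ofE[_ W] _ _] := H0 n; have E := W eta te.
  have -> : ip1 (h_ n) eta = - - ip1 (h_ n) eta by rewrite opprK.
  exact: (congr1 -%R E).
have dh : weak_deriv_of (trace u) h.
  by apply/weak_deriv_ofE; split=> // eta te; rewrite -Lh// opprK.
rewrite (formIV_energy r su dh) lee_fin.
apply: (@cvgL2w_lsc g1_ g2_ g1 g2 h_ h (al \o k)) => //.
- by move=> n; have [[_ []]] := H0 n.
- by move=> n; have [[_ _ []]] := H0 n.
- by move=> n; apply: le_trans (ak n); exact: ltW.
- exact: cvg_comp (cvg_subseq kn) alr.
- by move=> n; have [_ _ ? _] := H0 n.
Qed.

Lemma liminf_formV (al : nat -> R) (u_ : nat -> H) (u : H) (C : R) :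
  (forall l : nat, (1 <= l)%N -> 0 < al l) -> weak_cvg u_ u ->
  (limn_einf (fun l => Defs.extended (form_at (al l)%:E) (u_ l)) < C%:E)%E ->
  al @ \oo --> +oo%R -> (Defs.extended (@formV R) u <= C%:E)%E.
Proof.
move=> hal cu ltC aloo.
have [k [g1_ [g2_ [h_ [g1 [g2 [hk H0 su c1 [c2 ct]]]]]]]] := liminf_extract hal cu ltC 0.
have kn n : (n <= k n)%N by apply: leq_trans (hk n); rewrite addnS ltnW// ltnS leq_addl.
have ak n : 0 < al (k n) by apply: hal; apply: leq_trans (hk n).
have alk : (fun n => (al (k n))^-1) @ \oo --> (0 : R).
  have aloo' : (al \o k) @ \oo --> +oo%R by exact: cvg_comp (cvg_subseq kn) aloo.
  exact: ((gtr0_cvgV0 (f := al \o k) (nearW _ ak)).2 aloo').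
have hh n : (h_ n : R1 -> R) \in L1 by have [_ [? _]] := H0 n.
have hf : (trace u : R1 -> R) \in L1 by have [] := traceP su.
have arith (a s x y c : R) : 0 < a -> s <= x * y -> a * x <= c -> 0 <= y -> s <= c * y * a^-1.
  move=> a0 sxy axc y0; rewrite ler_pdivlMr// mulrC.
  apply: le_trans (_ : a * (x * y) <= _); first by rewrite ler_wpM2l// ltW.
  by rewrite mulrA ler_wpM2r.
have t0 : ae_eq leb setT (trace u : R1 -> R) (cst 0).
  apply: weak_deriv0 => // eta te; have he := test_L2_line te.
  have c := ct ('D_(1 : R) eta) (test_derive (1 : R) te).
  (* By Cauchy-Schwarz the square of the pairing is at most |h|^2 |eta|^2, and the energy bound
     gives |h|^2 <= C / al. *)
  have z : (fun n => ip1 (h_ n) eta) @ \oo --> (0 : R).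
    apply: sqr_cvg0.
    apply: (@squeeze_cvgr _ _ _ _ (cst 0) (fun n => C * ip1 eta eta * (al (k n))^-1)).
    - apply: nearW => n; rewrite sqr_ge0/=; have [_ _ _ le_] := H0 n.
      exact: arith (ak n) (CauchySchwarz (hh n) he) le_ (ip_ge0 _ _).
    - exact: cvg_cst.
    - by rewrite -[X in _ --> X](mulr0 (C * ip1 eta eta)); apply: cvgM alk; exact: cvg_cst.
  have z' : (fun n => ip1 (trace (u_ (k n))) ('D_(1 : R) eta)) @ \oo --> (0 : R).
    apply: (eq_cvg_to (cvgN z)) => [n|]; last by rewrite oppr0.
    by have [_ /weak_deriv_ofE[_ W] _ _] := H0 n; have E := W eta te; exact: esym E.
  by rewrite -(cvg_unique _ c z').
have [hu [hg1 _] [hg2 _]] := su.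
have tu : trace_of u (cst 0).
  by apply: trace_of_ae su hu (ae_eq_refl_cst _ _) (L20 leb) t0 (traceP su).
rewrite (formV_energy su tu) lee_fin.
apply: (@cvgL2w_lsc2 g1_ g2_) => // n.
- by have [[_ [] ]] := H0 n.
- by have [[_ _ []]] := H0 n.
- have [_ _ + _] := H0 n; apply: le_trans.
  by rewrite lerDl mulr_ge0// ?ip_ge0// ltW.
Qed.

Lemma mosco_liminf (al : nat -> R) (a : \bar R) (u_ : nat -> H) (u : H) :
  (forall l : nat, (1 <= l)%N -> 0 < al l) -> (0 <= a)%E ->
  (al l)%:E @[l --> \oo] --> a -> weak_cvg u_ u ->
  (Defs.extended (form_at a) u <= limn_einf (fun l => Defs.extended (form_at (al l)%:E) (u_ l)))%E.
Proof.
move=> hal a0 ala cu; apply: lee_of_bounds => C ltC.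
case: a a0 ala => [r| |] // r0 ala.
- have alr : al @ \oo --> r by exact: fine_cvg ala.
  rewrite lee_fin le_eqVlt in r0; case/orP: r0 => [/eqP <-|r0].
    rewrite /form_at eqxx; have [g1 [g2 [su leC]]] := liminf_dirichlet hal cu ltC.
    by rewrite (formI_energy su) lee_fin.
  by rewrite form_at_pos//; exact: liminf_formIV hal cu ltC r0 alr.
- by apply: liminf_formV hal cu ltC _; exact/cvgeryP.
Qed.

(** * Recovery sequences and conclusion *)

Lemma test_ibp_line (f g : R -> R^o) : test_function setT f -> test_function setT g ->
  ip1 f ('D_(1 : R) g) = - ip1 ('D_(1 : R) f) g.
Proof.
move=> tf tg; have tfg := testM tf (test_smooth tg).
have [r r0 hr] := test_compact_support tfg.
have tD := test_derive (1 : R) tfg.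
have [r' r'0 hr'] := test_compact_support tD.
have i0 : \int[leb]_x ('D_(1 : R) (fun y => f y * g y : R^o) x) = 0.
  apply: congr1 (@integral_derive_line R (fun y => f y * g y) _ (Num.max r r') _ _ _ _ _).
  - by rewrite lt_max r0.
  - by move=> x; apply: DeriveDef => //; exact: smooth_derivable (test_smooth tfg).
  - exact: smooth_continuous (test_smooth tD).
  - by move=> t; rewrite gt_max => /andP[h _]; exact: hr.
  - by move=> t; rewrite gt_max => /andP[_ h]; exact: hr'.
move: i0; rewrite (@eq_Rintegral _ _ _ leb _ (fun x => f x * 'D_(1 : R) g x +
    'D_(1 : R) f x * g x)); last first.
  move=> x _; rewrite [_ * g x]mulrC; apply: deriveM.
    exact: smooth_derivable (test_smooth tf).
  exact: smooth_derivable (test_smooth tg).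
have hf := test_L2_line tf; have hg := test_L2_line tg.
have hDf := test_L2_line (test_derive (1 : R) tf).
have hDg := test_L2_line (test_derive (1 : R) tg).
rewrite RintegralD//; [|exact: ip_integrable|exact: ip_integrable].
by move=> /eqP; rewrite addr_eq0 => /eqP.
Qed.

(** Stated for any u equal to [phi] almost everywhere, since the element of H attached to [phi] is
    known only through a representative. *)
Lemma test_trace_weak_deriv (phi : R * R -> R^o) (u : R * R -> R) : test_function setT phi ->
  (u : R2 -> R) \in L2 -> ae_eq leb2 setT (phi : R2 -> R) u ->
  let phi0 : R -> R^o := fun x => phi (x, 0) in
  sob u ('D_e1 phi) ('D_e2 phi) /\ weak_deriv_of (trace u) ('D_(1 : R) phi0).
Proof.
move=> tp hu pu phi0; have sp := sob_test tp; have su := sob_ae hu pu sp; split=> //.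
have t0 : test_function setT phi0 := test_trace tp.
have h0 := test_L2_line t0.
have tr : trace_of phi phi0.
  apply/(trace_ofP _ sp); split=> //; exists (fun=> phi); split=> //.
    by split; exact: cvgL2_cst.
  exact: cvgL2_cst.
have tru := trace_of_ae sp hu pu h0 (ae_eq_refl_cst _ _) tr.
have [ht _] := traceP su.
apply: weak_deriv_of_ae h0 ht (trace_uniq su tru (traceP su)) _.
apply/weak_deriv_ofE; split; first exact: test_L2_line (test_derive (1 : R) t0).
by move=> eta te; exact: test_ibp_line.
Qed.

(** For each K the products [al l * B K] fall below 1 / K.+1 past some rank [m K]; [k l] is the
    largest index i <= l whose rank [m i] has been reached, so [B] may grow at any speed. *)
Lemma diagonal_index (al : nat -> R) (B : nat -> R) : al @ \oo --> (0 : R) ->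
  exists k : nat -> nat, k @ \oo --> \oo /\ \forall l \near \oo, al l * B (k l) <= (k l).+1%:R^-1.
Proof.
move=> al0.
have /choice[m hm] K : exists m, forall l, (m <= l)%N -> al l * B K <= K.+1%:R^-1.
  have c : (fun l => al l * B K) @ \oo --> (0 : R).
    by rewrite -[X in _ --> X](mul0r (B K)); apply: cvgM al0 _; exact: cvg_cst.
  have K0 : (0 : R) < K.+1%:R^-1 by rewrite invr_gt0.
  by have [m _ h] := cvgr_le _ c _ K0; exists m => l /h.
pose k l := (\max_(i < l.+1 | (m i <= l)%N) i)%N.
exists k; split.
  apply/cvgnyPge => K; exists (maxn K (m K)) => // l /=; rewrite geq_max => /andP[Kl ml].
  by have := @leq_bigmax_cond _ (fun i : 'I_l.+1 => m i <= l)%N (fun i => i : nat) (Ordinal (Kl : K < l.+1)%N) ml.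
(* From [m 0] on the index 0 is eligible, so the maximum is attained at an eligible index; over an
   empty range it would be 0 by default. *)
exists (m 0%N) => // l /= ml; apply: hm.
have c : (0 < #|(fun i : 'I_l.+1 => m i <= l)%N|)%N.
  by apply/card_gt0P; exists ord0.
have [i im E] := eq_bigmax_cond (fun i : 'I_l.+1 => i : nat) c.
by have -> : k l = i := E.
Qed.

Lemma strong_cvg_cst (u : H) : strong_cvg (fun=> u) u.
Proof. by apply: strong_cvgE; exact: cvgL2_cst. Qed.

(** The index 0 is left out because positivity of [al], and with it the value of the energy, is
    known from 1 on. *)
Lemma limn_esup_near (v : nat -> \bar R) (w_ : nat -> R) (w : R) :
  (forall l, (1 <= l)%N -> v l = (w_ l)%:E) -> w_ @ \oo --> w -> limn_esup v = w%:E.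
Proof.
move=> vw cw; apply: (cvg_limn_einf_sup _).2.
apply: cvg_trans (EFin_cvgn cw); apply: near_eq_cvg; near=> l.
by rewrite vw//; near: l; exact: nbhs_infty_ge.
Unshelve. all: by end_near. Qed.

(* The trace of an element of H^1 of the plane need not be in H^1 of the line, but
   that of a test function is: u is approximated by test functions slowly enough
   for the line energies, multiplied by al l, to vanish in the limit. *)
Lemma recovery_formI (al : nat -> R) (u : H) (g1 g2 : R * R -> R) :
  (forall l : nat, (1 <= l)%N -> 0 < al l) -> al @ \oo --> (0 : R) -> sob u g1 g2 ->
  exists2 u_ : nat -> H, strong_cvg u_ u &
    limn_esup (fun l => Defs.extended (form_at (al l)%:E) (u_ l)) =
    (2^-1 * (ip2 g1 g1 + ip2 g2 g2))%:E.
Proof.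
move=> hal al0 su; have [hu [hg1 _] [hg2 _]] := su.
have [phi [tp [c0 c1 c2] _]] := cvgH1_approx (normr1 R) su.
have hp n := test_L2 (tp n).
have hd1 n := test_L2 (test_derive e1 (tp n)).
have hd2 n := test_L2 (test_derive e2 (tp n)).
have /choice[w hw] n := H_of_L2 (hp n).
have W n := test_trace_weak_deriv (tp n) (HL2 (w n)) (ae_eq_flip (hw n)).
pose d n : R -> R := 'D_(1 : R) (fun x => phi n (x, 0) : R^o).
pose A n := 2^-1 * (ip2 ('D_e1 (phi n)) ('D_e1 (phi n)) + ip2 ('D_e2 (phi n)) ('D_e2 (phi n))).
pose B n := ip1 (d n) (d n).
have cA : A @ \oo --> 2^-1 * (ip2 g1 g1 + ip2 g2 g2).
  apply: cvgM; first exact: cvg_cst.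
  by apply: cvgD; apply: cvgL2_ip.
have [k [koo kB]] := diagonal_index B al0.
exists (w \o k).
  have cw : cvgL2 leb2 (fun n => w n : R2 -> R) u.
    have hB (f : R2 -> R) : f \in L2 -> f \- u \in L2 by move=> hf; exact: L2B.
    have ae n : ae_eq leb2 setT (phi n \- u : R2 -> R) ((w n : R2 -> R) \- u).
      by apply: ae_mono (hw n) => x h xT /=; rewrite h.
    apply: (eq_cvg_to c0) => // n.
    by apply: eq_ip => //; apply: hB => //; exact: HL2.
  by apply: strong_cvgE; exact: (cvg_comp _ _ koo cw).
apply: (@limn_esup_near _ (fun l => A (k l) + al l * B (k l))).
  move=> l l1; rewrite form_at_pos; last exact: hal.
  by have [sw dw] := W (k l); rewrite (formIV_energy (al l) sw dw).
rewrite -[X in _ --> X]addr0; apply: cvgD; first exact: cvg_comp koo cA.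
apply: (@squeeze_cvgr _ _ _ _ (cst 0) (fun l => (k l).+1%:R^-1)).
- near=> l; apply/andP; split; last by near: l.
  rewrite mulr_ge0 ?ip_ge0// ltW// hal//; near: l; exact: nbhs_infty_ge.
- exact: cvg_cst.
- exact: (cvg_comp _ _ koo (@cvg_harmonic R)).
Unshelve. all: by end_near. Qed.

Lemma mosco_recovery (al : nat -> R) (a : \bar R) (u : H) :
  (forall l : nat, (1 <= l)%N -> 0 < al l) -> (0 <= a)%E ->
  (al l)%:E @[l --> \oo] --> a ->
  exists2 u_ : nat -> H, strong_cvg u_ u &
    (limn_esup (fun l => Defs.extended (form_at (al l)%:E) (u_ l)) <=
     Defs.extended (form_at a) u)%E.
Proof.
move=> hal a0 ala; have [du|ndu] := pselect (domain (form_at a) u); last first.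
  (* Off the domain the target energy is infinite, and any sequence converging to u will do. *)
  by exists (fun=> u); [exact: strong_cvg_cst|rewrite {2}/Defs.extended asboolF// leey].
case: a a0 ala du => [r| |] // r0 ala du.
- have alr : al @ \oo --> r by exact: fine_cvg ala.
  rewrite lee_fin le_eqVlt in r0; case/orP: r0 => [/eqP r0|r0].
    rewrite -r0 in alr du *; rewrite /form_at eqxx in du *.
    have [g1 [g2 su]] := formI_dom du; have [u_ cu E] := recovery_formI hal alr su.
    by exists u_ => //; rewrite E (formI_energy su).
  rewrite form_at_pos// in du *; exists (fun=> u); first exact: strong_cvg_cst.
  have [g1 [g2 [h [su dh]]]] := formIV_dom du; rewrite (formIV_energy r su dh).
  rewrite (@limn_esup_near _ (fun l => 2^-1 * (ip2 g1 g1 + ip2 g2 g2) + al l * ip1 h h)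
    (2^-1 * (ip2 g1 g1 + ip2 g2 g2) + r * ip1 h h))//.
    by move=> l l1; rewrite form_at_pos; [exact: formIV_energy|exact: hal].
  by apply: cvgD; [exact: cvg_cst|apply: cvgM alr _; exact: cvg_cst].
- exists (fun=> u); first exact: strong_cvg_cst.
  have [g1 [g2 [su t0]]] := formV_dom du; rewrite (formV_energy su t0).
  have dh : weak_deriv_of (trace u) (cst 0).
    have [ht _] := traceP su; have h0 := L20 leb.
    apply: weak_deriv_of_ae h0 ht (trace_uniq su t0 (traceP su)) _.
    apply/weak_deriv_ofE; split; first exact: L20.
    by move=> eta te; rewrite !ip0l oppr0.
  rewrite (@limn_esup_near _ (fun=> 2^-1 * (ip2 g1 g1 + ip2 g2 g2))
    (2^-1 * (ip2 g1 g1 + ip2 g2 g2)))//; last exact: cvg_cst.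
  move=> l l1; rewrite form_at_pos; last exact: hal.
  by rewrite (formIV_energy _ su dh) ip0l mulr0 addr0.
Qed.

End sobolev.

Theorem theorem3p15 (R : realType) (al : nat -> R) (a : \bar R)
    (hal : forall l : nat, (1 <= l)%N -> 0 < al l)
    (ha : (0 <= a)%E)
    (hlim : (al l)%:E @[l --> \oo] --> a) :
  mosco_cvg (fun l => form_at (al l)%:E) (form_at a).
Proof. by split=> [u_ u|u]; [exact: mosco_liminf|exact: mosco_recovery]. Qed.
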